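(* Let $\varepsilon\in(0,1/2)$ and let $\varepsilon_1>0$, $\varepsilon_2>0$ satisfy $\varepsilon_1+\varepsilon_2=\varepsilon$. For each $n$ define $$\rho=\frac{\sqrt{(P+1)(\mathbb{E}[E^2]+3P^2)\log(1+P)\log\frac1{\varepsilon_2}}}{P\sqrt{2nP}}=\Theta\!\left(\frac1{\sqrt n}\right),\qquad S=(1-\rho)P,$$ $$\alpha=\frac{2\rho P}{\mathbb{E}[E^2]+3S^2},\qquad \beta=\frac{\alpha}{1+63\alpha S},\qquad m=\left\lceil\frac{\log\frac1{\varepsilon_2}}{P\beta+\frac{\alpha^2\mathbb{E}[E^2]}{2}}\right\rceil=\Theta(\sqrt n).$$ Then there exists a constant $\kappa>0$ not depending on $n$ such that for all sufficiently large $n$ there is a save-and-transmit $(n,M,\varepsilon)$-EH code, with average transmit power (codeword symbol variance) $S$ and saving phase of length $m$, which satisfies $$\frac1n\log M\ge\frac12\log(1+P)-\sqrt{\frac{(\mathbb{E}[E^2]+3P^2)\log(1+P)\log\frac1{\varepsilon_2}}{2nP(P+1)}}+\sqrt{\frac{P}{(P+1)n}}\,\Phi^{-1}(\varepsilon_1)-\frac{\kappa}{n^{3/4}}.$$ In particular, the probability of seeing a mismatch event in the transmission phase is bounded as $$\mathbb{P}\left\{\bigcup_{k=m+1}^n\left\{\sum_{i=1}^kE_i<\sum_{i=m+1}^kX_i^2\right\}\right\}\le\varepsilon_2,$$ where $X_1,\dots,X_n$ are the symbols of the chosen message's codeword (i.i.d. $\mathcal{N}(0,S)$, independent of the energy arrivals),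 and each term in the union is the event that the energy accumulated during the first $k$ time slots is insufficient to output the desired codeword symbols from time $m+1$ to time $k$.
   Context: Logarithms are natural; $\Phi$ is the standard normal cdf; $\mathcal{N}(\mu,\sigma^2)$ denotes the normal law or its density; $\Theta(\cdot)$ is with respect to $n\to\infty$. Energy and channel. $E$ is a non-negative random variable with $0<P=\mathbb{E}[E]$ and $\mathbb{E}[E^2]<\infty$; $E_1,E_2,\dots$ are i.i.d. copies of $E$. The channel is $Y_k=X_k+Z_k$ with $Z_1,Z_2,\dots$ i.i.d. $\mathcal{N}(0,1)$, independent of messages, codebook and energy. An $(n,M)$-EH code has a message $W$ uniform on $\{1,\dots,M\}$, encoders producing the time-$k$ input from $(W,E_1,\dots,E_k)$ such that almost surely $\sum_{i=1}^kX_i^2\le\sum_{i=1}^kE_i$ for all $k\le n$, and a decoder $\varphi$ producing an estimate of $W$ from the $n$ channel outputs only. It is an $(n,M,\varepsilon)$-EH code if its average probability of decoding error (probability that the estimate differs from $W$) is at most $\varepsilon$. Save-and-transmit $(n,M)$-EH code with length-$m$ saving phase and variance $S\in(0,P)$. For each message $w$, the codeword $X^n(w)=(X_1(w),\dots,X_n(w))$ has i.i.d. $\mathcal{N}(0,S)$ entries; codewords are mutually independent and independent of $W$, the energy arrivals and the noise. The transmitted symbols are defined recursively: $\tilde X_k(w)=X_k(w)$ if $k>m$ and $X_k(w)^2\le E_k+\sum_{i=1}^{k-1}(E_i-\tilde X_i(w)^2)$, and $\tilde X_k(w)=0$ otherwise. The received symbols are $\tilde Y_k(W)=\tilde X_k(W)+Z_k$.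 For a threshold $\log\xi$ (a free design parameter of the code), the decoder outputs $j$ if $j$ is the unique message with $\sum_{k=m+1}^n\log\frac{q_{Y|X}(\tilde Y_k(W)|X_k(j))}{p_Y(\tilde Y_k(W))}\ge\log\xi$, where $q_{Y|X}(\cdot|x)=\mathcal{N}(x,1)$ and $p_Y=\mathcal{N}(0,S+1)$; otherwise it outputs a uniformly random message. All probabilities are taken jointly over the random codebook, $W$, the energy arrivals, the noise, and the decoder's randomization. *)

(* Defs.v *)
(* MathComp / MathComp-Analysis *)
From HB Require Import structures.
From mathcomp Require Import all_boot all_order all_algebra.
From mathcomp Require Import all_classical all_reals all_analysis.

Set Implicit Arguments.
Unset Strict Implicit.
Unset Printing Implicit Defensive.

Import Order.TTheory GRing.Theory Num.Theory.
Import numFieldNormedType.Exports.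

Local Open Scope classical_set_scope.
Local Open Scope ring_scope.

(* Time slots are numbered from 0: index k stands for the slot k + 1, so that
   the slots k > m of the 1-based numbering are the indices k >= m. *)

Section gaussian.
Context {R : realType}.
Implicit Types (x v p : R) (A : set R).

Definition Phi x : R := fine (normal_prob 0 1 `]-oo, x]).

(* Phi is a bijection from R onto ]0, 1[, so on ]0, 1[ this is its inverse. *)
Definition PhiInv p : R := pinv setT Phi p.

(* The library parameterizes normal laws by the standard deviation; here v is
   the variance. *)
Definition gauss_law x v A : \bar R := normal_prob x (Num.sqrt v) A.
Definition gauss_density x v : R -> R := normal_pdf x (Num.sqrt v).

End gaussian.

Section probability_notions.
Context {R : realType} {d : measure_display} {T : measurableType d}.
Variable Pr : probability T R.

Definition mutually_independent (I : finType) (F : I -> set_system T) :=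
  forall (J : {set I}) (A : I -> set T),
    (forall i, i \in J -> F i (A i)) ->
    Pr (\bigcap_(i in [set` J]) A i) = (\prod_(i in J) Pr (A i))%E.

Definition same_law {d' d2 : measure_display} {T' : measurableType d'}
    {V : measurableType d2} (Q : probability T' R)
    (X : {RV Pr >-> V}) (Y : {RV Q >-> V}) :=
  forall A, measurable A -> distribution Pr X A = distribution Q Y A.

Definition has_law (X : {RV Pr >-> R}) (mu : set R -> \bar R) :=
  forall A, measurable A -> distribution Pr X A = mu A.

(* The values of a 'I_M-valued random variable carry the discrete
   sigma-algebra. *)
Definition discrete_sigma (M : nat) (W : T -> 'I_M) : set_system T :=
  preimage_set_system setT W [set: set 'I_M].

Definition is_uniform (M : nat) (W : T -> 'I_M) :=
  (forall j, measurable (W @^-1` [set j])) /\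
  (forall j, Pr (W @^-1` [set j]) = (M%:R^-1)%:E).

End probability_notions.

Section EH_code.
Context {R : realType} {d : measure_display} {T : measurableType d}.
Variables (Pr : probability T R) (n M : nat).
Variables (E Z : nat -> T -> R) (W : T -> 'I_M).

(* C is the randomness shared by encoder and decoder (a random codebook), and U
   the private randomness of the decoder. *)
Variables (CT UT : Type) (C : T -> CT) (U : T -> UT).
Variables (enc : CT -> 'I_M -> (nat -> R) -> nat -> R)
          (dec : CT -> UT -> (nat -> R) -> 'I_M).

Definition causal_encoder :=
  forall c w (e e' : nat -> R) k,
    (forall i, (i <= k)%N -> e i = e' i) -> enc c w e k = enc c w e' k.

Definition output_decoder :=
  forall c u (y y' : nat -> R),
    (forall i, (i < n)%N -> y i = y' i) -> dec c u y = dec c u y'.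

Definition channel_input (k : nat) (t : T) : R :=
  enc (C t) (W t) (E ^~ t) k.

Definition channel_output (k : nat) (t : T) : R :=
  channel_input k t + Z k t.

Definition energy_constraint :=
  {ae Pr, forall t, forall k, (k < n)%N ->
    \sum_(i < k.+1) channel_input i t ^+ 2 <= \sum_(i < k.+1) E i t}.

Definition decoding_error : set T :=
  [set t | dec (C t) (U t) (channel_output ^~ t) <> W t].

Definition is_EH_code (eps : R) :=
  [/\ is_uniform Pr W, causal_encoder, output_decoder, energy_constraint
    & (Pr decoding_error <= eps%:E)%E].

End EH_code.

Section save_and_transmit_code.
Context {R : realType}.
Variables (n M m : nat) (S xi : R).

(* The symbol sent in slot k when the stored energy is b at its beginning,
   i.e. before the arrival e k. *)
Definition st_send (x e : nat -> R) (k : nat) (b : R) : R :=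
  if (m <= k)%N && (x k ^+ 2 <= e k + b) then x k else 0.

Fixpoint st_stored (x e : nat -> R) (k : nat) : R :=
  if k is j.+1 then
    st_stored x e j + (e j - st_send x e j (st_stored x e j) ^+ 2)
  else 0.

Definition st_symbol (x e : nat -> R) (k : nat) : R :=
  st_send x e k (st_stored x e k).

Lemma st_symbolE (x e : nat -> R) (k : nat) :
  st_symbol x e k =
  if (m <= k)%N &&
     (x k ^+ 2 <= e k + \sum_(i < k) (e i - st_symbol x e i ^+ 2))
  then x k else 0.
Proof.
suff h j : st_stored x e j = \sum_(i < j) (e i - st_symbol x e i ^+ 2).
  by rewrite -h.
by elim: j => [|j IH]; rewrite ?big_ord0// big_ord_recr/= -IH.
Qed.

Definition st_encoder (cb : 'I_M -> nat -> R) (w : 'I_M) (e : nat -> R)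
  : nat -> R := st_symbol (cb w) e.

Definition st_score (x y : nat -> R) : R :=
  \sum_(m <= k < n) ln (gauss_density (x k) 1 (y k) /
                        gauss_density 0 (S + 1) (y k)).

(* u is the uniformly random message used when no message, or more than one,
   passes the threshold. *)
Definition st_decoder (cb : 'I_M -> nat -> R) (u : 'I_M) (y : nat -> R) : 'I_M :=
  if [pick j | [forall j', (ln xi <= st_score (cb j') y) == (j' == j)]]
  is Some j then j else u.

End save_and_transmit_code.

Section st_model.
Context {R : realType} {dE : measure_display} {TE : measurableType dE}.
Variables (mu : probability TE R) (E : {RV mu >-> R}).
Variables (n M : nat) (S : R).

(* A realization, on (T, Pr), of all the random quantities entering n uses of a
   save-and-transmit code: only the indices k < n are constrained. *)
Record st_model (d : measure_display) (T : measurableType d)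
    (Pr : probability T R) := StModel {
  arrival : nat -> {RV Pr >-> R} ;
  codeword : 'I_M -> nat -> {RV Pr >-> R} ;
  noise : nat -> {RV Pr >-> R} ;
  message : T -> 'I_M ;
  tiebreak : T -> 'I_M ;
  arrival_law : forall k, (k < n)%N -> same_law (arrival k) E ;
  codeword_law : forall w k, (k < n)%N ->
    has_law (codeword w k) (gauss_law 0 S) ;
  noise_law : forall k, (k < n)%N -> has_law (noise k) (gauss_law 0 1) ;
  message_law : is_uniform Pr message ;
  tiebreak_law : is_uniform Pr tiebreak ;
  st_independent : mutually_independent Pr
    (fun i : 'I_n + 'I_M * 'I_n + 'I_n + bool =>
       match i with
       | inl (inl (inl k)) => g_sigma_algebra_preimage (arrival k)
       | inl (inl (inr (w, k))) => g_sigma_algebra_preimage (codeword w k)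
       | inl (inr k) => g_sigma_algebra_preimage (noise k)
       | inr true => discrete_sigma message
       | inr false => discrete_sigma tiebreak
       end)
}.

Definition is_st_code (m : nat) (xi eps : R) (d : measure_display)
    (T : measurableType d) (Pr : probability T R) (c : st_model Pr) :=
  is_EH_code Pr n (arrival c) (noise c) (message c)
    (fun t w k => codeword c w k t) (tiebreak c)
    (st_encoder m) (st_decoder n m S xi) eps.

Definition mismatch (m : nat) (d : measure_display)
    (T : measurableType d) (Pr : probability T R) (c : st_model Pr) : set T :=
  \bigcup_(k in [set k | (m <= k < n)%N])
    [set t | \sum_(i < k.+1) arrival c i t <
             \sum_(m <= i < k.+1) codeword c (message c t) i t ^+ 2].

End st_model.

Section parameters.
Context {R : realType}.
(* P and E2 are the first two moments of the energy arrivals. *)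
Variables (P E2 eps2 : R) (n : nat).

Definition rho : R :=
  Num.sqrt ((P + 1) * (E2 + 3 * P ^+ 2) * ln (1 + P) * ln (1 / eps2)) /
  (P * Num.sqrt (2 * n%:R * P)).

Definition st_power : R := (1 - rho) * P.

Definition alpha : R := 2 * rho * P / (E2 + 3 * st_power ^+ 2).

Definition beta : R := alpha / (1 + 63 * alpha * st_power).

(* For large n the ceiled quantity is positive, and the absolute value only
   casts the ceiling from int to nat. *)
Definition saving_length : nat :=
  `|Num.ceil (ln (1 / eps2) / (P * beta + alpha ^+ 2 * E2 / 2))|%N.

End parameters.

(* Main.v *)
(* Given the message, an error needs an energy shortage during transmission, an
   abnormally small information density of the sent codeword, or a wrong codeword
   passing the threshold.

   Shortage: the exponential of lam times the net energy spent, stopped at the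
   first shortage, is a supermartingale after the saving phase if
   E[exp(- lam E)] E[exp(lam X^2)] <= 1; its mean at the end of the saving phase,
   E[exp(- lam E)]^m, is at most eps2 for a suitable lam slightly larger than
   alpha.

   Information density: it is the capacity plus a traceless quadratic form in two
   standard normals, so after a rotation the sum over N slots is
   N C + sqrt(S / (S + 1)) (u_1 v_1 + ... + u_N v_N). Given the v_j it is normal,
   and v_1^2 + ... + v_N^2 is at most N (1 + n^(-1/4)) up to a negligible
   probability; this replaces the Berry-Esseen theorem.

   Wrong codeword: the likelihood ratio of an independent codeword has mean 1, so
   Markov's inequality bounds the probability of passing log xi by 1 / xi. *)

Require Import Defs.
From HB Require Import structures.
From mathcomp Require Import all_boot all_order all_algebra.
From mathcomp Require Import all_classical all_reals all_analysis.
From mathcomp Require Import measurable_realfun zify ring lra.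

Set Implicit Arguments.
Unset Strict Implicit.
Unset Printing Implicit Defensive.

Import Order.TTheory GRing.Theory Num.Theory.
Import numFieldNormedType.Exports.

Local Open Scope classical_set_scope.
Local Open Scope ring_scope.

Set Implicit Arguments.
Unset Strict Implicit.
Unset Printing Implicit Defensive.

(** * Coordinatewise integration on a product space *)

(** A model may live on any probability space, so its events are transported to the product of real
    lines indexed by [slots]. There the estimates use independence through one fact: a single
    coordinate can be integrated on its own ([integral_resample]). The message is averaged out
    separately, because for a fixed message none of the bad events involves its coordinate.

    The main loss of rate has two sources. Lowering the power to (1 - rho) P costs about rho P / (2
    (1 + P)); the m silent slots cost about (m / n) log(1 + P) / 2, where m is close to log(1 /
    eps2) (E2 + 3 P^2) / (2 P^2 rho). The product of the two costs does not depend on rho, so their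
    sum is least when they are equal. The given rho is that choice, and each cost is half of the
    first square root in the bound.

    The exponent lam is held from two sides: the supermartingale condition allows it up to about 2
    rho P / (E2 + 2 S^2), whereas the length m calls for P (lam - alpha) to exceed lam^2 E2, and
    alpha has 3 S^2 in its denominator. Taking 5/2 S^2 instead puts lam strictly between; both
    margins are then of first order in rho and the errors of second order. *)

Section product_space.
Context {R : realType} {I : finType}.

Definition box (B : I -> set R) : set (I -> R) := [set w | forall i, B i (w i)].

Definition boxes : set_system (I -> R) :=
  [set box B | B in [set B | forall i, measurable (B i)]].

(** Boxes are closed under intersection, so a probability on this space is determined by its values
    on them. *)
Definition prodspace := g_sigma_algebraType boxes.

Definition upd (w : I -> R) (i : I) (v : R) : I -> R :=
  fun j => if j == i then v else w j.

Lemma upd_eq w i v : upd w i v i = v.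
Proof. by rewrite /upd eqxx. Qed.

Lemma upd_neq w i v j : j != i -> upd w i v j = w j.
Proof. by rewrite /upd => /negbTE ->. Qed.

Lemma measurable_box (B : I -> set R) : (forall i, measurable (B i)) ->
  measurable (box B : set prodspace).
Proof. by move=> mB; apply: sub_sigma_algebra; exists B. Qed.

Lemma measurable_coord i : measurable_fun setT (fun w : prodspace => w i).
Proof.
move=> _ Y mY; rewrite setTI.
rewrite (_ : _ @^-1` _ = box (fun j => if j == i then Y else setT)).
  by apply: measurable_box => j; case: ifP.
apply/seteqP; split=> w /=.
  by move=> Yw j; case: eqP => [->|].
by move/(_ i); rewrite eqxx.
Qed.

Lemma bigcap_fin_measurable d (T : measurableType d) (A : I -> set T) :
  (forall i, measurable (A i)) -> measurable [set t | forall i, A i t].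
Proof.
move=> mA; have -> : [set t | forall i, A i t] = \bigcap_(i in [set: I]) A i.
  by apply/seteqP; split=> t h i; [move=> _; exact: h|exact: h].
exact: fin_bigcap_measurable.
Qed.

Lemma measurable_to_prodspace d (T : measurableType d) (f : T -> prodspace) :
  (forall i, measurable_fun setT (fun t => f t i)) -> measurable_fun setT f.
Proof.
move=> mf; apply: (@measurability _ _ T (prodspace : measurableType _) setT f boxes) => //.
move=> _ [_ [B mB <-] <-]; rewrite setTI.
apply: (@bigcap_fin_measurable _ _ (fun i => (fun t => f t i) @^-1` B i)) => i.
by rewrite -[X in measurable X]setTI; exact: mf.
Qed.

Lemma measurable_upd i :
  measurable_fun setT (fun p : prodspace * R => (upd p.1 i p.2 : prodspace)).
Proof.
apply: measurable_to_prodspace => j; rewrite /upd; case: eqP => _.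
  exact: measurable_snd.
exact: (measurableT_comp (measurable_coord j) measurable_fst).
Qed.

Variables (nu : I -> probability R R) (Q : probability prodspace R).

(** The product measure is characterized on boxes instead of being constructed: [Q] will be the
    joint law of random variables given in advance, and this property is their independence. *)
Definition product_law :=
  forall B : I -> set R, (forall i, measurable (B i)) ->
  Q (box B) = (\prod_i nu i (B i))%E.

Hypothesis HQ : product_law.

(** Two probabilities that agree on boxes are equal. In probabilistic terms, a product measure is
    invariant under an independent redrawing of one coordinate. *)
Lemma resample_law i (A : set prodspace) : measurable A ->
  Q A = pushforward (Q \x nu i)%E (fun p : prodspace * R => (upd p.1 i p.2 : prodspace)) A.
Proof.
pose phi := [the {mfun _ >-> _} of mfun_Sub (mem_set (measurable_upd i))].
have -> : pushforward (Q \x nu i)%E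
    (fun p : prodspace * R => (upd p.1 i p.2 : prodspace)) A =
  distribution (Q \x nu i)%E phi A by [].
move=> mA; apply: (@measure_unique _ R prodspace boxes (fun=> setT)) => //.
- move=> _ _ [B mB <-] [C mC <-]; exists (fun j => B j `&` C j).
    by move=> j; exact: measurableI.
  by apply/seteqP; split=> w /=; [move=> h; split=> j; case: (h j)
    | move=> [hb hc] j; split].
- by move=> _; exists (fun=> setT) => //; apply/seteqP; split.
- by rewrite bigcup_const.
- move=> _ [B mB <-]; transitivity (\prod_i nu i (B i))%E; first exact: HQ.
  (* The old value of coordinate [i] is discarded, so its constraint [B i] passes to the fresh
     variable and the coordinate itself becomes free. *)
  pose B' j := if j == i then setT else B j.
  rewrite /distribution /pushforward /=.
  have -> : (fun p : prodspace * R => (upd p.1 i p.2 : prodspace)) @^-1` box B =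
     box B' `*` B i.
    apply/seteqP; split=> -[w v] /=.
      move=> h; split; last by have := h i; rewrite upd_eq.
      by move=> j; rewrite /B'; have := h j; rewrite /upd; case: eqP.
    move=> [h hv] j; rewrite /upd; case: eqP => [->//|/eqP ji].
    by have := h j; rewrite /B' (negbTE ji).
  have mB' j : measurable (B' j) by rewrite /B'; case: ifP.
  rewrite product_measure1E//; last exact: measurable_box.
  transitivity ((\prod_j nu j (B' j)) * nu i (B i))%E; last first.
    by congr (_ * _)%E; exact/esym/HQ.
  rewrite (bigD1 i)//= [in RHS](bigD1 i)//= /B' eqxx probability_setT mul1e.
  rewrite muleC; congr (_ * _)%E.
  by apply: eq_bigr => j /negbTE ->.
- by move=> _; exact: (le_lt_trans (probability_le1 Q measurableT) (ltry _)).
Qed.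

(** Tonelli applied to [resample_law]. The probability estimates below draw on independence only in
    this form. *)
Lemma integral_resample (i : I) (F : prodspace -> \bar R) :
  measurable_fun [set: prodspace] F -> (forall w, (0 <= F w)%E) ->
  (\int[Q]_w F w = \int[Q]_w \int[nu i]_v F (upd w i v))%E.
Proof.
move=> mF F0.
have mu := measurable_upd i.
transitivity (\int[pushforward (Q \x nu i)%E
    (fun p : prodspace * R => (upd p.1 i p.2 : prodspace))]_w F w)%E.
  by apply: eq_measure_integral => A mA _; exact: resample_law.
rewrite ge0_integral_pushforward//.
rewrite preimage_setT fubini_tonelli1//.
  exact: measurableT_comp.
by move=> p; exact: F0.
Qed.

End product_space.
Arguments prodspace R I : clear implicits.

(** * Gaussian integrals *)

Section lebesgue_affine.
Context {R : realType}.
Local Notation leb := (@lebesgue_measure R).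

(** The image measure gives every half-open interval its length, which characterizes Lebesgue
    measure; the scaling lemma below is the same argument with a factor [c]. *)
Lemma lebesgue_integral_shift (f : R -> \bar R) (a : R) :
  measurable_fun setT f -> (forall x, (0 <= f x)%E) ->
  (\int[leb]_x f (x + a)%R = \int[leb]_x f x)%E.
Proof.
move=> mf f0.
pose g : measurableTypeR R -> measurableTypeR R := fun x => x + a.
have mg : measurable_fun setT g by exact: measurable_funD.
transitivity (\int[pushforward leb g]_x f x)%E.
  by rewrite (ge0_integral_pushforward mg leb)//= => x _; exact: f0.
apply: eq_measure_integral => A mA _; apply/esym.
pose phi := [the {mfun _ >-> _} of mfun_Sub (mem_set mg)].
apply: (@lebesgue_measure_unique R (pushforward leb phi)) => // _ [[u v] _ <-].
change (leb `]u, v] = leb (g @^-1` `]u, v])).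
rewrite (_ : _ @^-1` _ = `](u - a), (v - a)]%classic); last first.
  by apply/seteqP; split=> x /=; rewrite !in_itv/= ltrBlDr lerBrDr.
rewrite !lebesgue_measure_itv /= !lte_fin ltrD2r.
by case: ifP => // _; rewrite -!EFinB; congr EFin; ring.
Qed.

Lemma lebesgue_integral_scale (f : R -> \bar R) (c : R) : 0 < c ->
  measurable_fun setT f -> (forall x, (0 <= f x)%E) ->
  (c%:E * \int[leb]_x f (c * x)%R = \int[leb]_x f x)%E.
Proof.
move=> c0 mf f0.
pose g : measurableTypeR R -> measurableTypeR R := fun x => c * x.
have mg : measurable_fun setT g by exact: measurable_funM.
pose cn := NngNum (ltW c0).
have [pm pmE] : exists pm : {measure set (measurableTypeR R) -> \bar R},
    forall A, pm A = pushforward leb g A.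
  by unshelve eexists (pushforward leb g).
transitivity (\int[mscale cn pm]_x f x)%E.
  rewrite ge0_integral_mscale//=; congr (_ * _)%E.
  transitivity (\int[pushforward leb g]_x f x)%E.
    by rewrite (ge0_integral_pushforward mg leb)//= => x _; exact: f0.
  by apply: eq_measure_integral => A mA _; exact/esym/pmE.
apply: eq_measure_integral => A mA _; apply/esym.
apply: (@lebesgue_measure_unique R (mscale cn pm)) => // _ [[u v] _ <-].
transitivity (c%:E * pm `]u, v]%classic)%E; last by [].
rewrite pmE.
change (leb `]u, v] = c%:E * leb (g @^-1` `]u, v]))%E.
rewrite (_ : _ @^-1` _ = `](u / c), (v / c)]%classic); last first.
  by apply/seteqP; split=> x /=; rewrite !in_itv/= ltr_pdivrMr// ler_pdivlMr// /g mulrC.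
rewrite !lebesgue_measure_itv /= !lte_fin ltr_pM2r ?invr_gt0//.
case: ifP => // _; last by rewrite mule0.
by rewrite -!EFinB -EFinM; congr EFin; field; rewrite gt_eqF.
Qed.

End lebesgue_affine.

Section gaussian_integrals.
Context {R : realType}.

Lemma measurable_mull (s : R) : measurable_fun setT (fun x : R => s * x).
Proof. exact: measurable_funM. Qed.

Local Notation leb := (@lebesgue_measure R).
Local Notation gam := (normal_prob (0:R) 1).

(** The Radon-Nikodym derivative and [normal_pdf] have the same integral over every measurable set,
    hence agree almost everywhere. *)
Lemma integral_normal_prob (m s : R) (f : R -> \bar R) :
  measurable_fun setT f -> (forall x, (0 <= f x)%E) ->
  (\int[normal_prob m s]_x f x = \int[leb]_x (f x * (normal_pdf m s x)%:E))%E.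
Proof.
move=> mf f0.
have dom := normal_prob_dominates m s.
rewrite -(Radon_Nikodym_SigmaFinite.change_of_variables dom)//.
have mp : measurable_fun setT (fun x => (normal_pdf m s x)%:E).
  by apply/measurable_EFinP; exact: measurable_normal_pdf.
have mRN := measurable_int _ (Radon_Nikodym_SigmaFinite.f_integrable dom).
apply: ge0_ae_eq_integral => //.
- exact: emeasurable_funM.
- exact: emeasurable_funM.
- by move=> x _; rewrite mule_ge0 ?Radon_Nikodym_SigmaFinite.f_ge0.
- by move=> x _; rewrite mule_ge0 ?lee_fin ?normal_pdf_ge0.
- have := @integral_ae_eq _ _ _ leb setT measurableT (fun x => (normal_pdf m s x)%:E) _
    (Radon_Nikodym_SigmaFinite.f_integrable dom) mp.
  move=> /(_ _)/(@filterS _ _ _ _ _ _) H; apply: H; last first.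
    by move=> A _ mA; rewrite -Radon_Nikodym_SigmaFinite.f_integral.
  by move=> x /= h _; rewrite h.
Qed.


Let idR : measurableTypeR R -> R := idfun.

#[local] HB.instance Definition _ :=
  @isMeasurableFun.Build _ _ _ _ idR (@measurable_id _ _ setT).

(** The centred normal law of standard deviation [s]. Pushing forward along the identity moves it
    from the copy [measurableTypeR R] to [R], where the laws of the random variables live. *)
Definition gau (s : R) : probability R R :=
  distribution (normal_prob (0:R) s) (idR : {RV (normal_prob (0:R) s) >-> R}).

Lemma gauE s A : gau s A = normal_prob 0 s A.
Proof. by []. Qed.

Lemma integral_gau (s : R) (f : R -> \bar R) :
  measurable_fun setT f -> (forall x, (0 <= f x)%E) ->
  (\int[gau s]_x f x = \int[leb]_x (f x * (normal_pdf 0 s x)%:E))%E.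
Proof.
move=> mf f0; rewrite ge0_integral_distribution//=.
by rewrite integral_normal_prob.
Qed.

(** With the dependence on [s] explicit and [normal_peak 1] kept opaque, identities between products
    of densities split into one between prefactors and one between exponents. *)
Lemma normal_pdf_pos (m s x : R) : 0 < s ->
  normal_pdf m s x = normal_peak 1 / s * expR (- (x - m) ^+ 2 / (2 * s ^+ 2)).
Proof.
move=> s0; rewrite normal_pdfE ?gt_eqF// /normal_fun /normal_peak.
congr (_ * expR (_ / _)); last by rewrite mulr_natl.
rewrite expr1n mul1r -mulrnAr sqrtrM ?sqr_ge0// sqrtr_sqr gtr0_norm//.
by rewrite invfM mulrC.
Qed.

Lemma normal_peak1_gt0 : 0 < normal_peak (1 : R).
Proof. by rewrite normal_peak_gt0// oner_eq0. Qed.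

Lemma gau_scale (s : R) (f : R -> \bar R) : 0 < s ->
  measurable_fun setT f -> (forall x, (0 <= f x)%E) ->
  (\int[gau s]_x f x = \int[gau 1]_x f (s * x)%R)%E.
Proof.
move=> s0 mf f0.
have mp s' : measurable_fun setT (fun x : R => (normal_pdf 0 s' x)%:E).
  by apply/measurable_EFinP; exact: measurable_normal_pdf.
have mfs := measurableT_comp mf (measurable_mull s).
rewrite (integral_gau s mf f0) (integral_gau 1 mfs (fun x => f0 _)).
rewrite -(@lebesgue_integral_scale _ _ s)//; last 2 first.
- exact: (emeasurable_funM mf (mp s)).
- by move=> x; rewrite mule_ge0// lee_fin normal_pdf_ge0.
rewrite -ge0_integralZl//; last 3 first.
- exact: (emeasurable_funM mfs (measurableT_comp (mp s) (measurable_mull s))).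
- by move=> x _; rewrite mule_ge0// lee_fin normal_pdf_ge0.
- by rewrite lee_fin ltW.
apply: eq_integral => x _; rewrite muleCA -EFinM; congr (_ * _%:E)%E.
rewrite (normal_pdf_pos _ _ s0) (normal_pdf_pos _ _ ltr01).
have -> : - (s * x - 0) ^+ 2 / (2 * s ^+ 2) = - (x - 0) ^+ 2 / (2 * 1 ^+ 2).
  by field; rewrite gt_eqF.
by field; rewrite gt_eqF.
Qed.

(** Tilting the density by exp(l x^2) gives 1 / k times the normal density of standard deviation s /
    k, with k^2 = 1 - 2 l s^2. *)
Lemma gau_mgf_sq (s l : R) : 0 < s -> 2 * l * s ^+ 2 < 1 ->
  (\int[gau s]_x (expR (l * x ^+ 2))%:E = ((Num.sqrt (1 - 2 * l * s ^+ 2))^-1)%:E)%E.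
Proof.
move=> s0 ls.
have me : measurable_fun setT (fun x : R => (expR (l * x ^+ 2))%:E).
  apply/measurable_EFinP; apply: measurableT_comp => //.
  by apply: measurable_funM => //; exact: measurable_funX.
rewrite (integral_gau s me); last by move=> x; rewrite lee_fin expR_ge0.
set k := Num.sqrt _.
have k2 : k ^+ 2 = 1 - 2 * l * s ^+ 2 by rewrite sqr_sqrtr// subr_ge0 ltW.
have k0 : 0 < k by rewrite sqrtr_gt0 subr_gt0.
have sk : 0 < s / k by rewrite divr_gt0.
transitivity (\int[leb]_x ((k^-1)%:E * (normal_pdf 0 (s / k) x)%:E))%E.
  apply: eq_integral => x _; rewrite -!EFinM; congr EFin.
  rewrite (normal_pdf_pos _ _ s0) (normal_pdf_pos _ _ sk) mulrCA -expRD.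
  have -> : l * x ^+ 2 + - (x - 0) ^+ 2 / (2 * s ^+ 2) = - (x - 0) ^+ 2 / (2 * (s / k) ^+ 2).
    rewrite expr_div_n k2; field.
    by rewrite !gt_eqF// subr_gt0.
  by field; rewrite !gt_eqF.
rewrite ge0_integralZl//.
- by rewrite integral_normal_pdf mule1.
- by apply/measurable_EFinP; exact: measurable_normal_pdf.
- by move=> x _; rewrite lee_fin normal_pdf_ge0.
- by rewrite lee_fin invr_ge0 ltW.
Qed.

Lemma measurable_gauss_ratio (S y : R) : 0 < S ->
  measurable_fun setT (fun x : R => normal_pdf x 1 y / normal_pdf 0 (Num.sqrt (S + 1)) y).
Proof.
move=> S0; apply: measurable_funM => //.
rewrite (_ : (fun _ => _) = fun x => normal_pdf y 1 x).
  exact: measurable_normal_pdf.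
apply/funext => x; rewrite (normal_pdf_pos x y ltr01) (normal_pdf_pos y x ltr01).
by rewrite -sqrrN opprB.
Qed.

(** Bayes' rule: input density times channel density equals output density times the posterior
    density, which is normal with mean S y / (S + 1) and variance S / (S + 1) and integrates to
    1. *)
Lemma gau_likelihood_ratio (S y : R) : 0 < S ->
  (\int[gau (Num.sqrt S)]_x
     (normal_pdf x 1 y / normal_pdf 0 (Num.sqrt (S + 1)) y)%:E = 1)%E.
Proof.
move=> S0; rewrite integral_gau//; last 2 first.
- by apply/measurable_EFinP; exact: measurable_gauss_ratio.
- by move=> x; rewrite lee_fin divr_ge0// normal_pdf_ge0.
set a := Num.sqrt S; set b := Num.sqrt (S + 1).
have a0 : 0 < a by rewrite sqrtr_gt0.
have b0 : 0 < b by rewrite sqrtr_gt0 addr_gt0.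
have a2 : a ^+ 2 = S by rewrite sqr_sqrtr// ltW.
have b2 : b ^+ 2 = S + 1 by rewrite sqr_sqrtr// ltW// addr_gt0.
have ab : 0 < a / b by rewrite divr_gt0.
rewrite -[RHS](integral_normal_pdf (S * y / (S + 1)) (a / b)).
apply: eq_integral => x _; rewrite -!EFinM; congr EFin.
have S1 : S + 1 != 0 by rewrite gt_eqF// addr_gt0.
suff key : normal_pdf x 1 y * normal_pdf 0 a x =
    normal_pdf (S * y / (S + 1)) (a / b) x * normal_pdf 0 b y.
  rewrite mulrAC key mulfK// gt_eqF// (normal_pdf_pos _ _ b0).
  by rewrite mulr_gt0 ?expR_gt0// divr_gt0// normal_peak1_gt0.
rewrite (normal_pdf_pos _ _ ltr01) (normal_pdf_pos _ _ a0) (normal_pdf_pos _ _ b0)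
  (normal_pdf_pos _ _ ab).
rewrite mulrACA -expRD [in RHS]mulrACA -expRD; congr (_ * expR _).
  by field; rewrite !gt_eqF.
rewrite expr_div_n a2 b2; field.
by rewrite S1 gt_eqF.
Qed.

Let DI (F : R * R -> \bar R) := (\int[leb]_x \int[leb]_y F (x, y))%E.

Let L (a b a' b' : R) (p : R * R) : R * R := (a * p.1 + b * p.2, a' * p.1 + b' * p.2).

Let mL (a b a' b' : R) : measurable_fun setT (L a b a' b').
Proof.
by apply: measurable_fun_pair; apply: measurable_funD; exact: measurable_funM.
Qed.

Let DI_shear2 (F : R * R -> \bar R) (t : R) :
  measurable_fun setT F -> (forall p, (0 <= F p)%E) ->
  DI (F \o L 1 0 t 1) = DI F.
Proof.
move=> mF F0; rewrite /DI; apply: eq_integral => x _ /=.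
rewrite -(@lebesgue_integral_shift _ (fun y => F (x, y)) (t * x))//; last first.
  exact: measurable_fun_pair2.
by apply: eq_integral => y _; congr (F (_, _)) => /=; ring.
Qed.

Let DI_swap (F : R * R -> \bar R) :
  measurable_fun setT F -> (forall p, (0 <= F p)%E) ->
  DI (F \o L 0 1 1 0) = DI F.
Proof.
move=> mF F0; rewrite /DI.
rewrite [RHS](fubini_tonelli (m1 := leb) (m2 := leb) F mF F0).
apply: eq_integral => x _; apply: eq_integral => y _.
by congr (F (_, _)) => /=; ring.
Qed.

(** The horizontal shear is the vertical one conjugated by the exchange of coordinates. *)
Let DI_shear1 (F : R * R -> \bar R) (t : R) :
  measurable_fun setT F -> (forall p, (0 <= F p)%E) ->
  DI (F \o L 1 t 0 1) = DI F.
Proof.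
move=> mF F0.
have mS := measurableT_comp mF (mL 0 1 1 0).
rewrite -(DI_swap mF F0) -(DI_shear2 t mS (fun p => F0 _)).
rewrite -(DI_swap (measurableT_comp mF (mL 1 t 0 1)) (fun p => F0 _)).
apply: eq_integral => x _; apply: eq_integral => y _.
by congr (F (_, _)) => /=; ring.
Qed.

Let gau2_DI (f : R * R -> \bar R) :
  measurable_fun setT f -> (forall p, (0 <= f p)%E) ->
  (\int[gau 1]_x \int[gau 1]_y f (x, y))%E =
  DI (fun p => f p * (normal_pdf 0 1 p.1 * normal_pdf 0 1 p.2)%:E)%E.
Proof.
move=> mf f0.
have mp : measurable_fun setT (fun x : R => (normal_pdf 0 1 x)%:E).
  by apply/measurable_EFinP; exact: measurable_normal_pdf.
rewrite integral_gau//; last 2 first.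
- exact: (measurable_fun_fubini_tonelli_F (m2 := gau 1)).
- by move=> x; exact: integral_ge0.
apply: eq_integral => x _.
have mfx : measurable_fun setT (fun y => f (x, y)) by exact: measurable_fun_pair2.
rewrite integral_gau// -ge0_integralZr//; last 3 first.
- exact: emeasurable_funM.
- by move=> y _; rewrite mule_ge0// lee_fin normal_pdf_ge0.
- by rewrite lee_fin normal_pdf_ge0.
by apply: eq_integral => y _ /=; rewrite -muleA -EFinM (mulrC (normal_pdf _ _ y)).
Qed.

(* Lebesgue measure on the plane is invariant under shears, and a rotation other
   than the half-turn is a product of three of them. *)
Lemma gau2_rotate (c s : R) (f : R * R -> \bar R) : c != -1 ->
  c ^+ 2 + s ^+ 2 = 1 ->
  measurable_fun setT f -> (forall p, (0 <= f p)%E) ->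
  (\int[gau 1]_x \int[gau 1]_y f (c * x - s * y, s * x + c * y)%R =
   \int[gau 1]_x \int[gau 1]_y f (x, y))%E.
Proof.
move=> c1 cs mf f0.
pose F (p : R * R) := (f p * (normal_pdf 0 1 p.1 * normal_pdf 0 1 p.2)%:E)%E.
have mp : measurable_fun setT (fun x : R => normal_pdf 0 1 x).
  exact: measurable_normal_pdf.
have mF : measurable_fun setT F.
  apply: emeasurable_funM => //; apply/measurable_EFinP.
  by apply: measurable_funM; apply: measurableT_comp.
have F0 p : (0 <= F p)%E.
  by rewrite mule_ge0// lee_fin mulr_ge0// normal_pdf_ge0.
rewrite [RHS](gau2_DI mf f0) -/F.
pose t := s / (1 + c).
have c1' : 1 + c != 0 by rewrite addrC addr_eq0.
have ts : t * s = 1 - c.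
  apply: (mulIf c1'); rewrite /t mulrAC divfK//.
  by rewrite -expr2; have -> : s ^+ 2 = 1 - c ^+ 2 by [lra]; ring.
have tc : t * (1 + c) = s by rewrite /t divfK.
have mF1 := measurableT_comp mF (mL 1 (- t) 0 1).
have mF2 := measurableT_comp mF1 (mL 1 0 s 1).
rewrite -(DI_shear1 (- t) mF F0) -(DI_shear2 s mF1 (fun p => F0 _)).
rewrite -(DI_shear1 (- t) mF2 (fun p => F0 _)).
transitivity (\int[gau 1]_x \int[gau 1]_y (f \o L c (- s) s c) (x, y))%E.
  apply: eq_integral => x _; apply: eq_integral => y _.
  by rewrite /= /L /= mulNr.
rewrite (gau2_DI (measurableT_comp mf (mL c (- s) s c)) (fun p => f0 _)).
apply: eq_integral => x _; apply: eq_integral => y _.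
have E : L 1 (- t) 0 1 (L 1 0 s 1 (L 1 (- t) 0 1 (x, y))) = L c (- s) s c (x, y).
  rewrite /L /=; congr (_, _).
    transitivity ((1 - t * s) * x - (t + t * (1 - t * s)) * y); first by ring.
    by rewrite ts -tc; ring.
  transitivity (s * x + (1 - t * s) * y); first by ring.
  by rewrite ts; ring.
rewrite -[RHS]/(F (L 1 (- t) 0 1 (L 1 0 s 1 (L 1 (- t) 0 1 (x, y))))) E /F.
congr (_ * _%:E)%E.
(* The joint density depends on x^2 + y^2 only, which the rotation preserves. *)
rewrite !(normal_pdf_pos _ _ ltr01) /L /=.
rewrite mulrACA -expRD [in RHS]mulrACA -expRD; congr (_ * expR _).
rewrite !subr0 expr1n !mulr1 -!mulrDl; congr (_ / _).
transitivity (- ((c ^+ 2 + s ^+ 2) * (x ^+ 2 + y ^+ 2))); last by ring.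
by rewrite cs; ring.
Qed.

End gaussian_integrals.

Lemma integral_prob_cst d (T : measurableType d) (R : realType)
    (P : probability T R) (c : \bar R) : (\int[P]_x c = c)%E.
Proof.
transitivity (c * P setT)%E; first exact: integral_cst.
by rewrite probability_setT mule1.
Qed.

(** * The normal distribution function *)

Section Phi_facts.
Context {R : realType}.
Local Notation leb := (@lebesgue_measure R).

Lemma PhiE (x : R) : (Phi x)%:E = gau 1 `]-oo, x]%classic.
Proof. by rewrite /Phi gauE fineK// fin_num_measure. Qed.

(** A quarter turn sends (x, y) to (-y, x); it is applied to a function of the first coordinate. *)
Lemma integral_gauN (f : R -> \bar R) :
  measurable_fun setT f -> (forall x, (0 <= f x)%E) ->
  (\int[gau 1]_x f (- x)%R = \int[gau 1]_x f x)%E.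
Proof.
move=> mf f0.
have mf1 : measurable_fun setT (fun p : R * R => f p.1).
  exact: (measurableT_comp mf measurable_fst).
have h : (0 : R) != -1 by rewrite eq_sym oppr_eq0 oner_eq0.
have := @gau2_rotate R 0 1 (fun p => f p.1) h _ mf1 (fun p => f0 _).
rewrite expr1n expr0n add0r => /(_ erefl) H.
transitivity (\int[gau 1]_x \int[gau 1]_y f (- y)%R)%E.
  by rewrite integral_prob_cst.
transitivity (\int[gau 1]_x \int[gau 1]_y f x)%E; last first.
  by apply: eq_integral => x _; rewrite integral_prob_cst.
rewrite -H; apply: eq_integral => x _; apply: eq_integral => y _ /=.
by rewrite mul0r add0r mul1r.
Qed.

Lemma Phi0_ge : 1 / 2 <= Phi (0 : R).
Proof.
rewrite -lee_fin PhiE.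
have sym : gau 1 `]-oo, (0:R)]%classic = gau 1 `[(0:R), +oo[%classic.
  have m1 : measurable_fun setT (fun x : R => (\1_(`[(0:R), +oo[%classic) x : R)%:E).
    by apply/measurable_EFinP; exact: measurable_indic.
  have p1 (x : R) : (0 <= (\1_(`[(0:R), +oo[%classic) x : R)%:E)%E by rewrite lee_fin.
  have := integral_gauN m1 p1.
  rewrite [X in _ = X]integral_indic// setIT => <-.
  transitivity (\int[gau 1]_x (\1_(`]-oo, (0:R)]%classic) x : R)%:E)%E.
    by rewrite integral_indic// setIT.
  apply: eq_integral => x _.
  by rewrite !indicE !mem_setE !in_itv/= andbT oppr_ge0.
have : (1 <= gau 1 `]-oo, 0%R]%classic + gau 1 `[0%R : R, +oo[%classic)%E.
  rewrite -(@probability_setT _ _ _ (gau (1:R))).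
  have -> : [set: R] = `]-oo, (0:R)]%classic `|` `[(0:R), +oo[%classic.
    apply/esym/seteqP; split=> // x _ /=; rewrite !in_itv/= andbT.
    by case: (lerP x 0) => [|/ltW]; [left|right].
  exact: measureU2.
rewrite -sym -PhiE -EFinD !lee_fin; lra.
Qed.

Lemma Phi_diff (a b : R) : a <= b -> (Phi b - Phi a)%:E = gau 1 `]a, b]%classic.
Proof.
move=> ab.
have -> : (Phi b - Phi a)%:E = ((Phi b)%:E - (Phi a)%:E)%E by [].
suff -> : (Phi b)%:E = ((Phi a)%:E + gau 1 `]a, b]%classic)%E by rewrite addeAC subee// add0e.
rewrite !PhiE.
rewrite (_ : `]-oo, b]%classic = `]-oo, a]%classic `|` `]a, b]%classic); last first.
  apply/seteqP; split=> x /=; rewrite !in_itv/=.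
    by case: (lerP x a) => xa xb; [left|right].
  by case=> [xa|/andP[]//]; exact: le_trans ab.
rewrite measureU//.
  apply/seteqP; split=> x //= []; rewrite !in_itv/= => xa /andP[ax _].
  by move: (lt_le_trans ax xa); rewrite ltxx.
Qed.

Lemma Phi_le (a b : R) : a <= b -> Phi a <= Phi b.
Proof. by move=> ab; rewrite -subr_ge0 -lee_fin Phi_diff. Qed.

Lemma Phi_diff_le (a b : R) : a <= b -> Phi b - Phi a <= normal_peak 1 * (b - a).
Proof.
move=> ab; rewrite -lee_fin Phi_diff// gauE /normal_prob.
apply: (@le_trans _ _ (\int[leb]_(x in `]a, b]) (normal_peak 1)%:E)%E).
  apply: ge0_le_integral => //=.
  - by move=> x _; rewrite lee_fin normal_pdf_ge0.
  - by apply/measurable_funTS/measurable_EFinP; exact: measurable_normal_pdf.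
  - by move=> x _; rewrite lee_fin normal_pdf_ub// oner_eq0.
rewrite integral_cst//= lebesgue_measure_itv/= lte_fin.
case: ltrP => h; first by rewrite -EFinD -EFinM.
by rewrite mule0 lee_fin mulr_ge0// ?subr_ge0// normal_peak_ge0.
Qed.

(** The density decreases in |x|, so on the interval it is at least its value at [c]. This converts
    a loss of probability into a shift of the quantile in [PhiInv_backoff]. *)
Lemma Phi_diff_ge (a b c : R) : a <= b -> (forall x, a < x <= b -> `|x| <= c) ->
  normal_pdf 0 1 c * (b - a) <= Phi b - Phi a.
Proof.
move=> ab abc; rewrite -lee_fin Phi_diff// gauE /normal_prob.
apply: (@le_trans _ _ (\int[leb]_(x in `]a, b]) (normal_pdf 0 1 c)%:E)%E); last first.
  apply: ge0_le_integral => //=.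
  - by move=> x _; rewrite lee_fin normal_pdf_ge0.
  - by apply/measurable_funTS/measurable_EFinP; exact: measurable_normal_pdf.
  - move=> x; rewrite /= in_itv/= => /abc xc; rewrite lee_fin.
    rewrite !(normal_pdf_pos _ _ ltr01) ler_pM2l ?divr_gt0 ?normal_peak1_gt0//.
    rewrite ler_expR !mulNr lerN2 ler_pM2r ?invr_gt0 ?expr1n ?mulr1//.
    by rewrite !subr0 -[leLHS]real_normK ?num_real// lerXn2r// nnegrE (le_trans _ xc).
rewrite integral_cst//= lebesgue_measure_itv/= lte_fin.
case: ltrP => h; first by rewrite -EFinD -EFinM.
by rewrite mule0 lee_fin mulr_ge0_le0// ?subr_le0// normal_pdf_ge0.
Qed.

Lemma Phi_small (e : R) : 0 < e -> exists a, Phi a < e.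
Proof.
move=> e0.
pose X : {RV (gau (1:R)) >-> R} := [the {mfun R >-> R} of mfun_Sub (mem_set (@measurable_id _ R setT))].
have H := @cvg_cdfNy0 _ _ _ (gau (1:R)) X.
have : nbhs (0%E : \bar R) [set y | (y < e%:E)%E].
  by apply: open_nbhs_nbhs; split; [exact: open_ereal_lt_ereal|rewrite /= lte_fin].
move=> h; have /filter_ex[a ha] : \forall x \near -oo%R, (cdf X x < e%:E)%E by exact: (H _ h).
exists a.
by rewrite -lte_fin PhiE.
Qed.

Lemma Phi_lipschitz (x y : R) : `|Phi x - Phi y| <= normal_peak 1 * `|x - y|.
Proof.
wlog xy : x y / x <= y.
  move=> H; have [xy|/ltW yx] := leP x y; first exact: H.
  by rewrite distrC [X in _ * X]distrC; exact: H.
rewrite distrC [X in _ * X]distrC !ger0_norm ?subr_ge0 ?Phi_le//.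
exact: Phi_diff_le.
Qed.

Lemma continuous_Phi : continuous (Phi : R -> R).
Proof.
have p0 := @normal_peak1_gt0 R.
move=> x; apply/cvgrPdist_le => e e0; near=> y.
apply: (le_trans (Phi_lipschitz x y)); rewrite mulrC -ler_pdivlMr//.
near: y; exists (e / normal_peak 1); rewrite /= ?divr_gt0// => z /= /ltW; exact.
Unshelve. all: by end_near. Qed.

(** [pinv] is a right inverse only on the range of [Phi], so a preimage must be exhibited: [Phi] is
    continuous, falls below p far to the left, and is at least 1/2 at 0. Monotonicity then gives the
    sign. *)
Lemma PhiInvK (p : R) : 0 < p -> p < 1 / 2 -> Phi (PhiInv p) = p /\ PhiInv p < 0.
Proof.
move=> p0 p2.
have [a ap] := Phi_small p0.
have Phi0 := Phi0_ge.
have a0 : a <= 0.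
  by rewrite leNgt; apply/negP => /ltW/Phi_le; lra.
have [q _ Pq] : exists2 q, q \in `[a, 0] & Phi q = p.
  apply: IVT => //; first exact/continuous_subspaceT/continuous_Phi.
  rewrite ge_min le_max; apply/andP; split; apply/orP; [left|right]; lra.
have PP : Phi (PhiInv p) = p.
  by rewrite /PhiInv; apply: pinvK; rewrite inE; exists q.
split=> //; rewrite ltNge; apply/negP => /Phi_le; lra.
Qed.

End Phi_facts.

(** * Information density *)

Section gaussian_channel.
Context {R : realType}.
Variable S : R.
Hypothesis S0 : 0 < S.
Local Notation s1 := (Num.sqrt S).

(** The information density at input [x] and output [x + z] (see [infodE]). Written through the
    noise, it is a constant plus a quadratic form in independent normals. *)
Definition infod (x z : R) : R :=
  2^-1 * ln (1 + S) + ((x + z) ^+ 2 / (2 * (S + 1)) - z ^+ 2 / 2).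

Definition capac : R := 2^-1 * ln (1 + S).
(** The standard deviation of one information density, since a product of two independent standard
    normals has variance 1. *)
Definition sdev : R := Num.sqrt S / Num.sqrt (S + 1).

Lemma sdev_gt0 : 0 < sdev.
Proof. by rewrite divr_gt0 ?sqrtr_gt0 ?addr_gt0. Qed.

Lemma infodE (x z : R) :
  ln (gauss_density x 1 (x + z) / gauss_density 0 (S + 1) (x + z)) = infod x z.
Proof.
rewrite /gauss_density sqrtr1 /infod.
set b := Num.sqrt (S + 1).
have S1 : 0 < S + 1 by rewrite addr_gt0.
have b0 : 0 < b by rewrite sqrtr_gt0.
have b2 : b ^+ 2 = S + 1 by rewrite sqr_sqrtr// ltW.
have p0 := @normal_peak1_gt0 R.
rewrite (normal_pdf_pos _ _ ltr01) (normal_pdf_pos _ _ b0) b2.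
set e1 := - (_ - x) ^+ 2 / _; set e2 := - _ / _.
have -> : normal_peak 1 / 1 * expR e1 / (normal_peak 1 / b * expR e2) =
   b * expR (e1 - e2).
  by rewrite expRD expRN; field; rewrite !gt_eqF ?expR_gt0.
rewrite lnM ?posrE ?expR_gt0// expRK; congr (_ + _).
  by rewrite (addrC 1) -b2 lnXn// -[X in _ = _ * X]mulr_natl mulrA mulVf// mul1r.
by rewrite /e1 /e2; field; rewrite gt_eqF.
Qed.

Lemma measurable_infod : measurable_fun setT (fun p : R * R => infod p.1 p.2).
Proof.
apply: measurable_funD => //; apply: measurable_funB.
  apply: measurable_funM => //; apply: measurable_funX.
  exact: measurable_funD.
by apply: measurable_funM => //; exact: measurable_funX.
Qed.

(* The quadratic part of the information density, as a form in the two
   underlying standard normals, has trace zero; a rotation therefore brings it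
   to a multiple of u v. *)
Lemma hyperbolic_rotation : exists c s : R, [/\ c != -1, c ^+ 2 + s ^+ 2 = 1
  & forall u v, infod (s1 * (c * u - s * v)) (s * u + c * v) = capac + sdev * (u * v)].
Proof.
have S1 : 0 < S + 1 by rewrite addr_gt0.
set a : R := Num.sqrt (S + 1).
have a0 : 0 < a by rewrite sqrtr_gt0.
have a2 : a ^+ 2 = S + 1 by rewrite sqr_sqrtr// ltW.
have r0 : 0 < s1 by rewrite sqrtr_gt0.
have r2 : s1 ^+ 2 = S by rewrite sqr_sqrtr// ltW.
have a1 : 1 <= a.
  have : (1 : R) ^+ 2 <= a ^+ 2 by rewrite expr1n a2 lerDr ltW.
  by rewrite ler_pXn2r// nnegrE// ltW.
have ia1 : a^-1 <= 1 by rewrite invf_le1.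
have ia0 : 0 < a^-1 by rewrite invr_gt0.
(* Half-angle formulas for the angle of cosine 1 / a and sine [s1 / a]: this angle makes the
   coefficient of u^2 - v^2 vanish. *)
pose c := Num.sqrt ((1 + a^-1) / 2); pose s' := Num.sqrt ((1 - a^-1) / 2).
have c2 : c ^+ 2 = (1 + a^-1) / 2 by rewrite sqr_sqrtr//; lra.
have s2 : s' ^+ 2 = (1 - a^-1) / 2 by rewrite sqr_sqrtr//; lra.
have c0 : 0 <= c by rewrite sqrtr_ge0.
have s0 : 0 <= s' by rewrite sqrtr_ge0.
have cs : 2 * c * s' = s1 / a.
  have p1 : 0 <= 2 * c * s' by rewrite !mulr_ge0.
  have p2 : 0 <= s1 / a by rewrite ltW// divr_gt0.
  apply/eqP; rewrite -(@eqrXn2 _ 2)//; apply/eqP.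
  rewrite !exprMn c2 s2 r2 exprVn a2.
  have -> : 2 ^+ 2 * ((1 + a^-1) / 2) * ((1 - a^-1) / 2) = 1 - (a ^+ 2)^-1.
    by field; rewrite gt_eqF.
  by rewrite a2; field; rewrite gt_eqF.
exists c, (- s'); split.
- by rewrite gt_eqF// (lt_le_trans _ c0)//; lra.
- by rewrite sqrrN c2 s2; field; rewrite gt_eqF.
move=> u v; rewrite /infod -/capac; congr (_ + _).
have -> : (s1 * (c * u - - s' * v) + (- s' * u + c * v)) ^+ 2 / (2 * (S + 1))
    - (- s' * u + c * v) ^+ 2 / 2 =
   ( (S * (c ^+ 2 - s' ^+ 2) - s1 * (2 * c * s')) * (u ^+ 2 - v ^+ 2)
   + (2 * S * (2 * c * s') + 2 * s1 * (c ^+ 2 - s' ^+ 2)) * (u * v)) / (2 * (S + 1)).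
  set A := c * u - - s' * v; set z := - s' * u + c * v.
  transitivity ((s1 ^+ 2 * A ^+ 2 + 2 * s1 * A * z - S * z ^+ 2) / (2 * (S + 1))).
    by field; rewrite gt_eqF.
  by rewrite r2 /A /z; congr (_ / _); ring.
rewrite c2 s2 cs /sdev -/a.
have -> : (1 + a^-1) / 2 - (1 - a^-1) / 2 = a^-1 by field; rewrite gt_eqF.
have -> : S * a^-1 - s1 * (s1 / a) = 0 by rewrite mulrA -expr2 r2 subrr.
rewrite -a2.
rewrite mul0r add0r.
have -> : 2 * S * (s1 / a) + 2 * s1 / a = 2 * s1 / a * a ^+ 2 by rewrite a2; ring.
by field; rewrite gt_eqF.
Qed.

(** The Markov operator of the random walk whose increments are information densities. Its iterates
    replace the law of the sum. *)
Definition step (h : R -> \bar R) (s : R) : \bar R :=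
  (\int[gau 1]_x \int[gau 1]_z h (s + infod (s1 * x) z)%R)%E.

Lemma step_ge0 h : (forall x, (0 <= h x)%E) -> forall s, (0 <= step h s)%E.
Proof. by move=> h0 s; apply: integral_ge0 => x _; exact: integral_ge0. Qed.

Lemma measurable_step h : measurable_fun setT h -> (forall x, (0 <= h x)%E) ->
  measurable_fun setT (step h).
Proof.
move=> mh h0.
have mg : measurable_fun setT (fun q : (R * R) * R => h (q.1.1 + infod (s1 * q.1.2) q.2)).
  apply: (measurableT_comp mh); apply: measurable_funD.
    exact: (measurableT_comp measurable_fst measurable_fst).
  have m2 : measurable_fun setT (fun q : (R * R) * R => (s1 * q.1.2, q.2)).
    apply: measurable_fun_pair; last exact: measurable_snd.
    apply: measurable_funM => //.
    exact: (measurableT_comp measurable_snd measurable_fst).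
  exact: (measurableT_comp measurable_infod m2).
have mG := measurable_fun_fubini_tonelli_F (m2 := gau 1) _ mg (fun _ => h0 _).
have G0 (p : R * R) : (0 <= fubini_F (gau 1)
    (fun q : (R * R) * R => h (q.1.1 + infod (s1 * q.1.2) q.2)%R) p)%E.
  exact: integral_ge0.
exact: (measurable_fun_fubini_tonelli_F (m2 := gau 1) _ mG G0).
Qed.

Lemma iter_step_ge0 h N : (forall x, (0 <= h x)%E) ->
  forall s, (0 <= iter N step h s)%E.
Proof. by move=> h0; elim: N => //= N IH s; exact: step_ge0. Qed.

Lemma measurable_iter_step h N : measurable_fun setT h ->
  (forall x, (0 <= h x)%E) -> measurable_fun setT (iter N step h).
Proof.
move=> mh h0; elim: N => //= N IH; apply: measurable_step => //.
exact: iter_step_ge0.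
Qed.

Lemma measurable_affine (a b : R) : measurable_fun setT (fun x : R => a + b * x).
Proof. by apply: measurable_funD => //; exact: measurable_mull. Qed.

(** The rotation of [hyperbolic_rotation] preserves the pair of standard normals. The variable [v]
    is outermost because, for fixed [v], the increment is normal in [u]. *)
Lemma stepE h : measurable_fun setT h -> (forall x, (0 <= h x)%E) ->
  forall s, (step h s =
    \int[gau 1]_v \int[gau 1]_u h (s + (capac + sdev * (u * v)))%R)%E.
Proof.
move=> mh h0 s.
have [c [s' [c1 cs E]]] := hyperbolic_rotation.
pose f (p : R * R) := h (s + infod (s1 * p.1) p.2).
have mf : measurable_fun setT f.
  apply: (measurableT_comp mh); apply: measurable_funD => //.
  have m2 : measurable_fun setT (fun q : R * R => (s1 * q.1, q.2)).
    by apply: measurable_fun_pair => //; exact: measurable_funM.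
  exact: (measurableT_comp measurable_infod m2).
rewrite /step -(gau2_rotate c1 cs mf (fun p => h0 _)).
apply: eq_integral => u _; apply: eq_integral => v _.
by rewrite /f E [v * u]mulrC.
Qed.

(** Rotating the direction (a, v) onto the first axis makes the integrand independent of the second
    coordinate. The sign of [a] keeps the rotation away from the half-turn; a zero vector has no
    direction and is treated apart. *)
Lemma gau_combine (f : R -> \bar R) (b a v : R) :
  measurable_fun setT f -> (forall x, (0 <= f x)%E) -> 0 <= a ->
  (\int[gau 1]_x \int[gau 1]_y f (b + (a * x + v * y))%R =
   \int[gau 1]_x f (b + Num.sqrt (a ^+ 2 + v ^+ 2) * x)%R)%E.
Proof.
move=> mf f0 a0; set r := Num.sqrt _.
have r2 : r ^+ 2 = a ^+ 2 + v ^+ 2 by rewrite sqr_sqrtr// addr_ge0 ?sqr_ge0.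
have [rE|rne] := eqVneq r 0.
  have /eqP : a ^+ 2 + v ^+ 2 = 0 by rewrite -r2 rE expr0n.
  rewrite paddr_eq0 ?sqr_ge0// !sqrf_eq0 => /andP[/eqP -> /eqP ->].
  apply: eq_integral => x _; rewrite rE !mul0r.
  rewrite -[RHS](integral_prob_cst (gau 1)); apply: eq_integral => y _.
  by rewrite mul0r addr0.
have rgt0 : 0 < r by rewrite lt_neqAle eq_sym rne sqrtr_ge0.
pose g (p : R * R) := f (b + r * p.1).
have mg : measurable_fun setT g.
  apply: (measurableT_comp mf).
  exact: (measurableT_comp (measurable_affine b r) measurable_fst).
have c1 : a / r != -1.
  by rewrite gt_eqF// (lt_le_trans (ltrN10 _))// divr_ge0// ltW.
have cs : (a / r) ^+ 2 + (- (v / r)) ^+ 2 = 1.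
  rewrite sqrrN !expr_div_n -mulrDl -r2 divff// sqrf_eq0//.
transitivity (\int[gau 1]_x \int[gau 1]_y g (x, y))%E.
  rewrite -(gau2_rotate c1 cs mg (fun p => f0 _)).
  apply: eq_integral => x _; apply: eq_integral => y _.
  by rewrite /g /=; congr (f (_ + _)); field.
by apply: eq_integral => x _; exact: (integral_prob_cst (gau 1) (f (b + r * x))).
Qed.

(* By stepE, N steps add N * capac + sdev * sum of u_j v_j: given the v_j this is
   normal with variance sdev^2 times sum of v_j^2. The induction carries the part
   r of that sum already seen, and either r ends below rmax, giving Phi, or
   Chernoff's bound for the sum of the v_j^2 applies. *)
Lemma below_step_tail (t rmax l k : R) (N : nat) : 0 < rmax -> 0 <= l -> 0 <= k ->
  (\int[gau 1]_x (expR (l * x ^+ 2))%:E <= k%:E)%E ->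
  forall s r, 0 <= r -> t - s - N%:R * capac < 0 ->
  (\int[gau 1]_x iter N step (fun y => (\1_(`]-oo, t[%classic) y)%:E)
      (s + sdev * Num.sqrt r * x)%R <=
   (Phi ((t - s - N%:R * capac) / (sdev * Num.sqrt rmax)))%:E
   + (k ^+ N * expR (l * (r - rmax)))%:E)%E.
Proof.
move=> rm0 l0 k0 hk.
have sd0 := sdev_gt0.
set h := (fun y => (\1_(`]-oo, t[%classic) y)%:E).
have mh : measurable_fun setT h by apply/measurable_EFinP; exact: measurable_indic.
have h0 x : (0 <= h x)%E by rewrite lee_fin.
elim: N => [|N IH] s r r0 ts.
  rewrite mul0r subr0 in ts *; rewrite expr0 mul1r.
  set tau := (t - s) / _.
  have mi : measurable_fun setT (fun x : R => (\1_(`]-oo, tau]%classic) x : R)%:E).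
    by apply/measurable_EFinP; exact: measurable_indic.
  apply: (@le_trans _ _ (\int[gau 1]_x ((\1_(`]-oo, tau]%classic) x)%:E
      + (expR (l * (r - rmax)))%:E))%E).
    apply: ge0_le_integral => //.
    - exact: (measurableT_comp mh (measurable_affine _ _)).
    - exact: emeasurable_funD.
    - move=> x _; rewrite /= /h -EFinD lee_fin !indicE !mem_setE !in_itv/=.
      (* If r exceeds rmax, the exponential alone is at least 1. Otherwise t - s < 0 forces x < 0 on
         the event, and for negative x raising r to rmax only lowers the left side, so the event is
         contained in the one for rmax. *)
      have [rr|rr] := ltrP rmax r.
        apply: (@le_trans _ _ 1); first by case: (_ < _).
        rewrite -[leLHS]add0r lerD// ?ler0n// -expR0 ler_expR mulr_ge0//; lra.
      case: ltrP => [xt|_]; last by rewrite addr_ge0// expR_ge0.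
      have sr : sdev * Num.sqrt r * x < t - s by lra.
      have xneg : x < 0.
        rewrite ltNge; apply/negP => x0.
        have : 0 <= sdev * Num.sqrt r * x by rewrite !mulr_ge0// ?sqrtr_ge0// ltW.
        lra.
      have -> : x <= tau; last by rewrite lerDl expR_ge0.
      have dn : 0 < sdev * Num.sqrt rmax by apply: mulr_gt0; rewrite ?sqrtr_gt0.
      rewrite /tau ler_pdivlMr//.
      apply: (le_trans _ (ltW sr)); rewrite mulrC; apply: (ler_wnM2r (ltW xneg)).
      by rewrite ler_pM2l// ler_sqrt// ltW.
  rewrite ge0_integralD//.
  rewrite integral_indic// setIT integral_prob_cst PhiE; exact: lexx.
rewrite iterS.
set f := iter N step h.
have mf : measurable_fun setT f by exact: measurable_iter_step.
have f0 x : (0 <= f x)%E by exact: iter_step_ge0.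
set D := (t - s - _).
have DE : D = t - (s + capac) - N%:R * capac by rewrite /D -natr1; ring.
under eq_integral do rewrite stepE//.
(* The integrals are exchanged to put [v] outermost: for fixed [v] the normal accumulated so far and
   the new one merge by [gau_combine], which turns r into r + v^2. *)
pose G (q : (R * R) * R) := f (s + sdev * Num.sqrt r * q.1.1
    + (capac + sdev * (q.2 * q.1.2)))%R.
have mG : measurable_fun setT G.
  apply: (measurableT_comp mf); apply: measurable_funD; last first.
    apply: measurable_funD => //; apply: measurable_funM => //.
    apply: measurable_funM; first exact: measurable_snd.
    exact: (measurableT_comp measurable_snd measurable_fst).
  apply: (measurableT_comp (measurable_affine _ _)).
  exact: (measurableT_comp measurable_fst measurable_fst).
have mF := measurable_fun_fubini_tonelli_F (m2 := gau 1) _ mG (fun _ => f0 _).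
have F0 (p : R * R) : (0 <= fubini_F (gau 1) G p)%E.
  by apply: integral_ge0 => y _; exact: f0.
rewrite (fubini_tonelli (m1 := gau 1) (m2 := gau 1) _ mF F0).
rewrite /fubini_F /G /=.
set P := Phi _.
have kE := expR_ge0 (l * (r - rmax)).
have mexp : measurable_fun setT (fun x : R => (expR (l * x ^+ 2))%:E).
  apply/measurable_EFinP; apply: measurableT_comp => //.
  by apply: measurable_funM => //; exact: measurable_funX.
apply: (@le_trans _ _ (\int[gau 1]_v (P%:E
    + (k ^+ N * expR (l * (r - rmax)))%:E * (expR (l * v ^+ 2))%:E)))%E.
  apply: ge0_le_integral => //.
  - by move=> v _; apply: integral_ge0 => g _; exact: integral_ge0.
  - exact: (measurable_fun_fubini_tonelli_G (m1 := gau 1) _ mF F0).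
  - apply: emeasurable_funD => //; exact: emeasurable_funM.
  - move=> v _.
    have -> : (\int[gau 1]_x \int[gau 1]_y f (s + sdev * Num.sqrt r * x
         + (capac + sdev * (y * v)))%R =
       \int[gau 1]_x f ((s + capac) + sdev * Num.sqrt (r + v ^+ 2) * x)%R)%E.
      have sr0 : 0 <= sdev * Num.sqrt r by rewrite mulr_ge0 ?sqrtr_ge0 ?ltW.
      have := gau_combine (s + capac) (sdev * v) mf f0 sr0.
      have key (w : R) : 0 < w -> Num.sqrt ((w * Num.sqrt r) ^+ 2 + (w * v) ^+ 2) =
          w * Num.sqrt (r + v ^+ 2).
        move=> w0; rewrite !exprMn sqr_sqrtr// -mulrDr sqrtrM ?sqr_ge0//.
        by rewrite sqrtr_sqr gtr0_norm.
      rewrite (key _ sd0) => <-; apply: eq_integral => x _; apply: eq_integral => y _.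
      by congr f; ring.
    have r' : 0 <= r + v ^+ 2 by rewrite addr_ge0// sqr_ge0.
    apply: (le_trans (IH (s + capac) _ r' _)); first by rewrite -DE.
    rewrite -DE -/P leeD2l// -EFinM lee_fin -mulrA -expRD.
    by rewrite (_ : l * (r + v ^+ 2 - rmax) = l * (r - rmax) + l * v ^+ 2)//; ring.
have kN0 : 0 <= k ^+ N * expR (l * (r - rmax)) by rewrite mulr_ge0// exprn_ge0.
rewrite ge0_integralD//; last 3 first.
- by move=> v _; rewrite PhiE.
- by move=> v _; rewrite -EFinM lee_fin mulr_ge0// expR_ge0.
- exact: emeasurable_funM.
rewrite integral_prob_cst leeD2l//.
rewrite ge0_integralZl//.
apply: (@le_trans _ _ ((k ^+ N * expR (l * (r - rmax)))%:E * k%:E)%E).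
  by rewrite lee_wpmul2l.
by rewrite -EFinM lee_fin exprS mulrC mulrA.
Qed.

End gaussian_channel.

(** * Information sums and likelihood ratios over independent coordinates *)

Section independent_coordinates.
Context {R : realType} {I : finType}.
Variables (nu : I -> probability R R) (Q : probability (prodspace R I) R).
Hypothesis HQ : product_law nu Q.

Lemma measurable_resample (i : I) (F : prodspace R I -> \bar R) :
  measurable_fun [set: prodspace R I] F -> (forall w, (0 <= F w)%E) ->
  measurable_fun [set: prodspace R I] (fun w => \int[nu i]_v F (upd w i v))%E.
Proof.
move=> mF F0; have mG := measurableT_comp mF (measurable_upd i).
exact: (measurable_fun_fubini_tonelli_F (m2 := nu i) _ mG (fun _ => F0 _)).
Qed.

Lemma integral_resample_le (i : I) (F G : prodspace R I -> \bar R) :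
  measurable_fun [set: prodspace R I] F -> (forall w, (0 <= F w)%E) ->
  measurable_fun [set: prodspace R I] G ->
  (forall w, \int[nu i]_v F (upd w i v) <= G w)%E ->
  (\int[Q]_w F w <= \int[Q]_w G w)%E.
Proof.
move=> mF F0 mG FG; rewrite (integral_resample HQ i mF F0).
apply: ge0_le_integral => //.
  by move=> w _; exact: integral_ge0.
exact: measurable_resample.
Qed.

Lemma integral_same_law (i : I) (P : probability R R) (f : R -> \bar R) :
  (forall A, measurable A -> nu i A = P A) ->
  (\int[nu i]_x f x = \int[P]_x f x)%E.
Proof. by move=> h; apply: eq_measure_integral => A mA _; exact: h. Qed.

Section information_sum.
Variable S : R.
Hypothesis S0 : 0 < S.

(** The two coordinates of the last term occur in no other term, so integrating them applies [step]
    to [h] and leaves a sum of length N. *)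
Lemma information_sum_law N (ix iz : nat -> I) (h : R -> \bar R) (s : R) :
  (forall j, (j < N)%N -> forall A, measurable A ->
    nu (ix j) A = gau (Num.sqrt S) A) ->
  (forall j, (j < N)%N -> forall A, measurable A -> nu (iz j) A = gau 1 A) ->
  (forall j k, (j < k < N)%N -> ix j != ix k) ->
  (forall j k, (j < k < N)%N -> iz j != iz k) ->
  (forall j k, (j < N)%N -> (k < N)%N -> ix j != iz k) ->
  measurable_fun setT h -> (forall x, (0 <= h x)%E) ->
  (\int[Q]_w h (s + \sum_(j < N) infod S (w (ix j)) (w (iz j)))%R = iter N (step S) h s)%E.
Proof.
elim: N h => [|N IH] h lx lz ix_inj iz_inj ixz mh h0.
  rewrite -[RHS](integral_prob_cst Q); apply: eq_integral => w _.
  by rewrite big_ord0 addr0.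
pose X w := \sum_(j < N) infod S (w (ix j)) (w (iz j)).
have mi j : measurable_fun setT (fun w : prodspace R I => infod S (w (ix j)) (w (iz j))).
  have m2 : measurable_fun setT (fun w : prodspace R I => (w (ix j), w (iz j))).
    by apply: measurable_fun_pair; exact: measurable_coord.
  exact: (measurableT_comp (measurable_infod S) m2).
have mX : measurable_fun setT (X : prodspace R I -> R).
  by apply: measurable_sum.
pose F (w : prodspace R I) := h (s + (X w + infod S (w (ix N)) (w (iz N)))).
have mF : measurable_fun setT F.
  apply: (measurableT_comp mh); apply: measurable_funD => //.
  exact: measurable_funD.
have F0 w : (0 <= F w)%E by exact: h0.
transitivity (\int[Q]_w F w)%E.
  by apply: eq_integral => w _; rewrite big_ord_recr.
rewrite (integral_resample HQ (iz N) mF F0).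
rewrite (integral_resample HQ (ix N) (measurable_resample _ mF F0)); last first.
  by move=> w; exact: integral_ge0.
have mst := measurable_step S mh h0.
transitivity (\int[Q]_w step S h (s + X w)%R)%E; last first.
  rewrite iterSr; apply: IH => //.
  - by move=> j jN; apply: lx; exact: ltnW.
  - by move=> j jN; apply: lz; exact: ltnW.
  - by move=> j k /andP[jk kN]; apply: ix_inj; rewrite jk ltnW.
  - by move=> j k /andP[jk kN]; apply: iz_inj; rewrite jk ltnW.
  - by move=> j k jN kN; apply: ixz; exact: ltnW.
  - exact: step_ge0.
apply: eq_integral => w _.
have mhx (x : R) : measurable_fun setT (fun z => h (s + X w + infod S x z)).
  apply: (measurableT_comp mh); apply: measurable_funD => //.
  exact: (measurable_fun_pair2 _ (measurable_infod S)).
have mhh : measurable_fun setT (fun x => \int[gau 1]_z h (s + X w + infod S x z)%R)%E.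
  have m2 : measurable_fun setT (fun p : R * R => h (s + X w + infod S p.1 p.2)).
    apply: (measurableT_comp mh); apply: measurable_funD => //.
    exact: (measurable_infod S).
  exact: (measurable_fun_fubini_tonelli_F (m2 := gau 1) _ m2 (fun _ => h0 _)).
transitivity (\int[gau (Num.sqrt S)]_x \int[gau 1]_z h (s + X w + infod S x z)%R)%E.
  rewrite -(integral_same_law _ (lx N (ltnSn N))).
  apply: eq_integral => x _.
  rewrite -(integral_same_law _ (lz N (ltnSn N))).
  apply: eq_integral => z _; rewrite /F.
  have xz := ixz N N (ltnSn N) (ltnSn N).
  rewrite upd_eq (upd_neq _ _ xz) upd_eq addrA; congr (h (s + _ + _)).
  apply: eq_bigr => j _; have jN := ltn_ord j.
  rewrite !upd_neq//.
  - by rewrite eq_sym ixz// ltnW.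
  - by rewrite iz_inj// jN ltnSn.
  - by rewrite ix_inj// jN ltnSn.
  - by rewrite ixz// ltnW.
by rewrite gau_scale ?sqrtr_gt0// => x; exact: integral_ge0.
Qed.

Lemma information_sum_tail N (ix iz : nat -> I) (t rmax l k : R) :
  (forall j, (j < N)%N -> forall A, measurable A ->
    nu (ix j) A = gau (Num.sqrt S) A) ->
  (forall j, (j < N)%N -> forall A, measurable A -> nu (iz j) A = gau 1 A) ->
  (forall j k, (j < k < N)%N -> ix j != ix k) ->
  (forall j k, (j < k < N)%N -> iz j != iz k) ->
  (forall j k, (j < N)%N -> (k < N)%N -> ix j != iz k) ->
  0 < rmax -> 0 <= l -> 0 <= k ->
  (\int[gau 1]_x (expR (l * x ^+ 2))%:E <= k%:E)%E ->
  t - N%:R * capac S < 0 ->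
  (Q [set w | (\sum_(j < N) infod S (w (ix j)) (w (iz j)) < t)%R] <=
    (Phi ((t - N%:R * capac S) / (sdev S * Num.sqrt rmax)))%:E
    + (k ^+ N * expR (- (l * rmax)))%:E)%E.
Proof.
move=> lx lz ix_inj iz_inj ixz rm0 l0 k0 hk ht.
pose h (y : R) : \bar R := (\1_(`]-oo, t[%classic) y)%:E.
have mh : measurable_fun setT h by apply/measurable_EFinP; exact: measurable_indic.
have h0 (x : R) : (0 <= h x)%E by rewrite lee_fin.
(* At r = 0 the accumulated normal is degenerate, and its integral reduces to the value at 0. *)
have := below_step_tail S0 (N := N) rm0 l0 k0 hk (lexx 0) (s := 0) (t := t).
rewrite subr0 => /(_ ht); rewrite sub0r mulrN; apply: le_trans.
rewrite -/h; have -> : (\int[gau 1]_x iter N (step S) h (0 + sdev S * Num.sqrt 0 * x)%R =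
   iter N (step S) h 0%R)%E.
  rewrite -[RHS](integral_prob_cst (gau 1)); apply: eq_integral => x _.
  by rewrite sqrtr0 mulr0 mul0r addr0.
rewrite -(information_sum_law 0 lx lz ix_inj iz_inj ixz mh h0).
have mi j : measurable_fun setT (fun w : prodspace R I => infod S (w (ix j)) (w (iz j))).
  have m2 : measurable_fun setT (fun w : prodspace R I => (w (ix j), w (iz j))).
    by apply: measurable_fun_pair; exact: measurable_coord.
  exact: (measurableT_comp (measurable_infod S) m2).
have mX : measurable_fun setT (fun w : prodspace R I => \sum_(j < N) infod S (w (ix j)) (w (iz j))).
  by apply: measurable_sum.
set A := [set w | _].
have mA : measurable (A : set (prodspace R I)).
  rewrite (_ : A = (fun w : prodspace R I => \sum_(j < N) infod S (w (ix j)) (w (iz j))) @^-1` `]-oo, t[%classic).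
    by rewrite -[X in measurable X]setTI; exact: mX.
  by apply/seteqP; split=> w; rewrite /A /= in_itv.
have -> : Q A = (\int[Q]_w (\1_A w)%:E)%E by rewrite integral_indic// setIT.
have m1 : measurable_fun setT (fun w : prodspace R I => (\1_A w : R)%:E).
  by apply/measurable_EFinP; exact: measurable_indic.
have m2 := measurableT_comp mh (measurable_funD (measurable_cst (0 : R)) mX).
apply: ge0_le_integral => //.
move=> w _; rewrite /h lee_fin !indicE add0r.
case: (boolP (w \in A)) => // /set_mem wA.
by rewrite mem_set//= in_itv.
Qed.

Definition lratio (x y : R) : R := gauss_density x 1 y / gauss_density 0 (S + 1) y.

Lemma ln_prod_ord N (f : nat -> R) : (forall j, 0 < f j) ->
  ln (\prod_(j < N) f j) = \sum_(j < N) ln (f j).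
Proof.
move=> f0; elim: N => [|N IH]; first by rewrite !big_ord0 ln1.
by rewrite !big_ord_recr lnM ?IH// posrE// prodr_gt0.
Qed.

Lemma lratio_gt0 x y : 0 < lratio x y.
Proof.
have S1 : 0 < Num.sqrt (S + 1) by rewrite sqrtr_gt0 addr_gt0.
rewrite /lratio /gauss_density sqrtr1 (normal_pdf_pos _ _ ltr01) (normal_pdf_pos _ _ S1).
by rewrite !(divr_gt0, mulr_gt0) ?expR_gt0 ?normal_peak1_gt0.
Qed.

Lemma measurable_lratio : measurable_fun setT (fun p : R * R => lratio p.1 p.2).
Proof.
apply: measurable_funM.
  rewrite (_ : (fun _ => _) = (fun p : R * R => normal_pdf 0 1 (p.2 - p.1))).
    apply: measurableT_comp; first exact: measurable_normal_pdf.
    exact: measurable_funB.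
  apply/funext => p; rewrite /gauss_density sqrtr1.
  by rewrite !(normal_pdf_pos _ _ ltr01) subr0.
have S1 : 0 < Num.sqrt (S + 1) by rewrite sqrtr_gt0 addr_gt0.
rewrite (_ : (fun _ => _) = (fun p : R * R => (normal_peak 1 / Num.sqrt (S + 1))^-1
   * expR ((p.2 - 0) ^+ 2 / (2 * Num.sqrt (S + 1) ^+ 2)))).
  apply: measurable_funM => //; apply: measurableT_comp => //.
  apply: measurable_funM => //; apply: measurable_funX.
  exact: measurable_funB.
apply/funext => p; rewrite /gauss_density (normal_pdf_pos _ _ S1) invfM -expRN.
by rewrite -mulNr opprK.
Qed.

(** The outputs do not depend on the coordinates of the codeword being tested, so these can be
    integrated one at a time, each factor giving 1 by [gau_likelihood_ratio]. No assumption on the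
    law of the outputs enters, so dropped symbols do no harm. *)
Lemma likelihood_ratio_mean N (ix : nat -> I) (y : nat -> prodspace R I -> R) :
  (forall j, (j < N)%N -> forall A, measurable A ->
    nu (ix j) A = gau (Num.sqrt S) A) ->
  (forall j k, (j < k < N)%N -> ix j != ix k) ->
  (forall j, (j < N)%N -> measurable_fun setT (y j)) ->
  (forall j k w v, (j < N)%N -> (k < N)%N -> y j (upd w (ix k) v) = y j w) ->
  (\int[Q]_w (\prod_(j < N) lratio (w (ix j)) (y j w))%:E = 1)%E.
Proof.
elim: N => [|N IH] lx ix_inj my yindep.
  rewrite -[RHS](integral_prob_cst Q); apply: eq_integral => w _.
  by rewrite big_ord0.
have mr j : (j < N.+1)%N -> measurable_fun setT (fun w : prodspace R I => lratio (w (ix j)) (y j w)).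
  move=> jN.
  have m2 : measurable_fun setT (fun w : prodspace R I => (w (ix j), y j w)).
    by apply: measurable_fun_pair; [exact: measurable_coord|exact: my].
  exact: (measurableT_comp measurable_lratio m2).
pose P (w : prodspace R I) := \prod_(j < N) lratio (w (ix j)) (y j w).
have mP : measurable_fun setT P.
  rewrite /P; apply: measurable_prod => j _; apply: mr.
  by rewrite ltnW// ltnS ltn_ord.
have P0 w : 0 <= P w by apply: prodr_ge0 => j _; exact/ltW/lratio_gt0.
have mPr : measurable_fun setT (fun w => (P w * lratio (w (ix N)) (y N w))%:E).
  by apply/measurable_EFinP; apply: measurable_funM => //; exact: mr.
transitivity (\int[Q]_w (P w * lratio (w (ix N)) (y N w))%:E)%E.
  by apply: eq_integral => w _; rewrite big_ord_recr.
rewrite (integral_resample HQ (ix N) mPr); last first.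
  by move=> w; rewrite lee_fin mulr_ge0// ltW// lratio_gt0.
rewrite -[RHS]IH; first last.
- by move=> j k w v jN kN; apply: yindep; exact: ltnW.
- by move=> j jN; apply: my; exact: ltnW.
- by move=> j k /andP[jk kN]; apply: ix_inj; rewrite jk ltnW.
- by move=> j jN; apply: lx; exact: ltnW.
apply: eq_integral => w _.
transitivity (\int[nu (ix N)]_v ((P w)%:E * (lratio v (y N w))%:E))%E.
  apply: eq_integral => v _; rewrite -EFinM yindep// upd_eq; congr (_ * _)%:E.
  apply: eq_bigr => j _; have jN := ltn_ord j.
  by rewrite yindep ?upd_neq//; [rewrite ix_inj// jN ltnSn|exact: ltnW].
have mv : measurable_fun setT (fun v => (lratio v (y N w))%:E).
  by apply/measurable_EFinP; exact: (measurable_fun_pair1 _ measurable_lratio).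
rewrite ge0_integralZl//; last 2 first.
- by move=> v _; rewrite lee_fin ltW// lratio_gt0.
- by rewrite lee_fin.
rewrite (integral_same_law _ (lx N (ltnSn N))).
rewrite -[X in (_ = X%:E)%E]mulr1 EFinM; congr (_ * _)%E.
rewrite -[RHS](gau_likelihood_ratio (y N w) S0).
by apply: eq_integral => v _; rewrite /lratio /gauss_density sqrtr1.
Qed.

Lemma wrong_codeword_tail N (ix : nat -> I) (y : nat -> prodspace R I -> R) (xi : R) :
  0 < xi ->
  (forall j, (j < N)%N -> forall A, measurable A ->
    nu (ix j) A = gau (Num.sqrt S) A) ->
  (forall j k, (j < k < N)%N -> ix j != ix k) ->
  (forall j, (j < N)%N -> measurable_fun setT (y j)) ->
  (forall j k w v, (j < N)%N -> (k < N)%N -> y j (upd w (ix k) v) = y j w) ->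
  (Q [set w | (ln xi <= \sum_(j < N) ln (lratio (w (ix j)) (y j w)))%R] <= (xi^-1)%:E)%E.
Proof.
move=> xi0 lx ix_inj my yindep.
have mr j : (j < N)%N -> measurable_fun setT (fun w : prodspace R I => lratio (w (ix j)) (y j w)).
  move=> jN.
  have m2 : measurable_fun setT (fun w : prodspace R I => (w (ix j), y j w)).
    by apply: measurable_fun_pair; [exact: measurable_coord|exact: my].
  exact: (measurableT_comp measurable_lratio m2).
pose P (w : prodspace R I) := \prod_(j < N) lratio (w (ix j)) (y j w).
have mP : measurable_fun setT P.
  by rewrite /P; apply: measurable_prod => j _; apply: mr.
have P0 w : 0 < P w by apply: prodr_gt0 => j _; exact/lratio_gt0.
set A := [set w | _].
have AE : A = P @^-1` `[xi, +oo[%classic.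
  apply/seteqP; split=> w; rewrite /A /= in_itv/= andbT.
    rewrite -(ln_prod_ord _ (fun j => lratio_gt0 (w (ix j)) (y j w))).
    by rewrite ler_ln ?posrE//; exact: P0.
  rewrite -(ln_prod_ord _ (fun j => lratio_gt0 (w (ix j)) (y j w))).
  by rewrite ler_ln ?posrE//; exact: P0.
have mA : measurable (A : set (prodspace R I)).
  by rewrite AE -[X in measurable X]setTI; exact: mP.
have -> : Q A = (\int[Q]_w (\1_A w)%:E)%E by rewrite integral_indic// setIT.
have mE : measurable_fun setT (fun w => (P w)%:E) by exact/measurable_EFinP.
have m1 : measurable_fun setT (fun w : prodspace R I => (\1_A w : R)%:E).
  by apply/measurable_EFinP; exact: measurable_indic.
have m2 : measurable_fun setT (fun w : prodspace R I => (xi^-1)%:E * (P w)%:E)%E.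
  exact: emeasurable_funM.
apply: (@le_trans _ _ (\int[Q]_w ((xi^-1)%:E * (P w)%:E))%E).
  apply: ge0_le_integral => //.
  move=> w _; rewrite -EFinM lee_fin indicE.
  case: (boolP (w \in A)) => [/set_mem|_]; last first.
    by rewrite mulr_ge0// ?invr_ge0 ltW.
  by rewrite AE /= in_itv/= andbT mulrC ler_pdivlMr// mul1r.
rewrite ge0_integralZl//; last 2 first.
- by move=> w _; rewrite lee_fin ltW.
- by rewrite lee_fin invr_ge0 ltW.
by rewrite (likelihood_ratio_mean lx ix_inj my yindep) mule1.
Qed.

End information_sum.

End independent_coordinates.

(** * Energy shortage *)

Section energy_outage.
Context {R : realType} {I : finType}.
Variables (nu : I -> probability R R) (Q : probability (prodspace R I) R).
Hypothesis HQ : product_law nu Q.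
Variables (ix ie : nat -> I) (m : nat) (lam : R).
Implicit Types w : I -> R.

(** The desired symbols are counted, not those actually sent, so that the increments are
    independent. The arrival of a slot may be spent in that slot, so a shortage in slot j is a
    positive value at [j.+1]. *)
Definition deficit (k : nat) w : R :=
  \sum_(m <= j < k) w (ix j) ^+ 2 - \sum_(j < k) w (ie j).

Definition deficit_step (k : nat) w : R :=
  (if (m <= k)%N then w (ix k) ^+ 2 else 0) - w (ie k).

Fixpoint outage (k : nat) w : bool :=
  if k is j.+1 then outage j w || ((m <= j)%N && (0 < deficit j.+1 w)) else false.

(* A supermartingale once k >= m, when lam balances the exponential moments of
   arrivals and symbols: see transmission_step. *)
Fixpoint stopped (k : nat) w : R :=
  if k is j.+1 then
    stopped j w * (if outage j w then 1 else expR (lam * deficit_step j w))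
  else 1.

Lemma deficitS k w : deficit k.+1 w = deficit k w + deficit_step k w.
Proof.
rewrite /deficit /deficit_step big_ord_recr /=; case: leqP => mk.
  by rewrite big_nat_recr//=; ring.
by rewrite !big_geq//; [ring|exact: ltnW].
Qed.

Lemma outageP k w : reflect (exists2 j, (m <= j < k)%N & 0 < deficit j.+1 w) (outage k w).
Proof.
elim: k => [|k IH] /=; first by constructor => -[j]; rewrite ltn0 andbF.
apply: (iffP orP) => [[/IH[j /andP[mj jk] h]|/andP[mk h]]|[j /andP[mj]]].
- by exists j => //; rewrite mj ltnW.
- by exists k => //; rewrite mk ltnSn.
rewrite ltnS leq_eqVlt => /orP[/eqP jk|jk] h; first by right; rewrite -jk mj.
by left; apply/IH; exists j => //; rewrite mj.
Qed.

Lemma stopped_gt0 k w : 0 < stopped k w.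
Proof.
by elim: k => //= k IH; rewrite mulr_gt0//; case: ifP => // _; exact: expR_gt0.
Qed.

Hypothesis lam0 : 0 <= lam.

(** At the first shortage the exponent is positive, and the value is frozen from then on. A bound on
    the mean at the final time therefore controls a shortage at any time. *)
Lemma stopped_outage k w :
  (outage k w -> 1 <= stopped k w) /\
  (~~ outage k w -> stopped k w = expR (lam * deficit k w)).
Proof.
elim: k => [|k [IH1 IH2]] /=.
  by split=> // _; rewrite /deficit big_geq// big_ord0 subrr mulr0 expR0.
have [ok|nok] := boolP (outage k w); first by rewrite mulr1; split=> // _; exact: IH1.
rewrite IH2// -expRD -mulrDr -deficitS; split=> //= /andP[_ d0].
by rewrite -expR0 ler_expR mulr_ge0// ltW.
Qed.

Lemma measurable_deficit k : measurable_fun setT (deficit k : prodspace R I -> R).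
Proof.
apply: measurable_funB; apply: measurable_sum => j; last exact: measurable_coord.
by apply: measurable_funX; exact: measurable_coord.
Qed.

Lemma measurable_deficit_step k : measurable_fun setT (deficit_step k : prodspace R I -> R).
Proof.
apply: measurable_funB; last exact: measurable_coord.
case: (m <= k)%N; last exact: measurable_cst.
by apply: measurable_funX; exact: measurable_coord.
Qed.

Lemma measurable_outage k : measurable_fun setT (outage k : prodspace R I -> bool).
Proof.
elim: k => [|k IH] /=; first exact: measurable_cst.
apply: measurable_or => //; apply: measurable_and; first exact: measurable_cst.
apply: measurable_fun_ltr; first exact: measurable_cst.
exact: measurable_deficit.
Qed.

Lemma measurable_stopped k : measurable_fun setT (stopped k : prodspace R I -> R).
Proof.
elim: k => [|k IH] /=; first exact: measurable_cst.
apply: measurable_funM => //; apply: measurable_fun_ifT.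
- exact: measurable_outage.
- exact: measurable_cst.
apply: (measurableT_comp (@measurable_expR R)).
by apply: measurable_funM; [exact: measurable_cst|exact: measurable_deficit_step].
Qed.

Variable n : nat.
Hypothesis ix_inj : forall j k, (j < k < n)%N -> ix j != ix k.
Hypothesis ie_inj : forall j k, (j < k < n)%N -> ie j != ie k.
Hypothesis ixe : forall j k, (j < n)%N -> (k < n)%N -> ix j != ie k.

Lemma deficit_upd k w i v : (forall j, (j < k)%N -> ix j != i) ->
  (forall j, (j < k)%N -> ie j != i) -> deficit k (upd w i v) = deficit k w.
Proof.
move=> hx he; rewrite /deficit; congr (_ - _).
  by apply: eq_big_nat => j /andP[_ jk]; rewrite upd_neq// hx.
by apply: eq_bigr => j _; rewrite upd_neq// he.
Qed.

Lemma outage_upd k w i v : (forall j, (j < k)%N -> ix j != i) ->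
  (forall j, (j < k)%N -> ie j != i) -> outage k (upd w i v) = outage k w.
Proof.
elim: k => //= k IH hx he; rewrite deficit_upd// IH//.
- by move=> j jk; apply: hx; exact: ltnW.
- by move=> j jk; apply: he; exact: ltnW.
Qed.

Lemma stopped_upd k w i v : (forall j, (j < k)%N -> ix j != i) ->
  (forall j, (j < k)%N -> ie j != i) -> stopped k (upd w i v) = stopped k w.
Proof.
elim: k => //= k IH hx he.
rewrite outage_upd; first last.
- by move=> j jk; apply: he; exact: ltnW.
- by move=> j jk; apply: hx; exact: ltnW.
rewrite IH; first last.
- by move=> j jk; apply: he; exact: ltnW.
- by move=> j jk; apply: hx; exact: ltnW.
by rewrite /deficit_step !upd_neq ?hx ?he.
Qed.

Variable theta : R.
Hypothesis theta0 : 0 <= theta.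
Hypothesis theta_ie : forall k, (k < n)%N ->
  (\int[nu (ie k)]_e (expR (- (lam * e)))%:E <= theta%:E)%E.
Hypothesis theta_ix : forall k, (k < n)%N ->
  (\int[nu (ix k)]_x (expR (lam * x ^+ 2))%:E * theta%:E <= 1)%E.

Let ie_fresh k : (k < n)%N -> (forall j, (j < k)%N -> ix j != ie k) /\
  (forall j, (j < k)%N -> ie j != ie k).
Proof.
move=> kn; split=> j jk; first by rewrite ixe// (ltn_trans jk).
by rewrite ie_inj// jk.
Qed.

Let ix_fresh k : (k < n)%N -> (forall j, (j < k)%N -> ix j != ix k) /\
  (forall j, (j < k)%N -> ie j != ix k).
Proof.
move=> kn; split=> j jk; first by rewrite ix_inj// jk.
by rewrite eq_sym ixe// (ltn_trans jk).
Qed.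

Let mE k : measurable_fun [set: prodspace R I] (fun w => (stopped k w)%:E).
Proof. by apply/measurable_EFinP; exact: measurable_stopped. Qed.

Let stopped_ge0 k w : (0 <= (stopped k w)%:E)%E.
Proof. by rewrite lee_fin ltW// stopped_gt0. Qed.

Let mexpN : measurable_fun setT (fun e : R => (expR (- (lam * e)))%:E).
Proof.
apply/measurable_EFinP; apply: (measurableT_comp (@measurable_expR R)).
by apply: measurableT_comp => //; exact: measurable_mull.
Qed.

Let mexpX : measurable_fun setT (fun e : R => (expR (lam * e ^+ 2))%:E).
Proof.
apply/measurable_EFinP; apply: (measurableT_comp (@measurable_expR R)).
by apply: measurable_funM => //; exact: measurable_funX.
Qed.

(** In the saving phase nothing is spent and no shortage is recorded, so slot k only contributes the
    transform of its arrival. *)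
Lemma saving_step k : (k < m)%N -> (k < n)%N ->
  (\int[Q]_w (stopped k.+1 w)%:E <= theta%:E * \int[Q]_w (stopped k w)%:E)%E.
Proof.
move=> km kn; have [fx fe] := ie_fresh kn.
rewrite -ge0_integralZl//.
have mG : measurable_fun [set: prodspace R I] (fun w => theta%:E * (stopped k w)%:E)%E.
  exact: emeasurable_funM.
apply: (integral_resample_le HQ (i := ie k)) => // w.
have nout : outage k w = false.
  by apply/outageP => -[j /andP[mj jk]]; move: (leq_trans (leq_ltn_trans mj jk) (ltnW km)); rewrite ltnn.
apply: (@le_trans _ _ (\int[nu (ie k)]_e ((stopped k w)%:E * (expR (- (lam * e)))%:E))%E).
  rewrite le_eqVlt; apply/orP; left; apply/eqP; apply: eq_integral => e _.
  rewrite /= stopped_upd// outage_upd// nout /deficit_step leqNgt km /= upd_eq sub0r.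
  by rewrite mulrN EFinM.
rewrite ge0_integralZl//.
by rewrite muleC lee_wpmul2r// theta_ie.
Qed.

Lemma transmission_step k : (m <= k)%N -> (k < n)%N ->
  (\int[Q]_w (stopped k.+1 w)%:E <= \int[Q]_w (stopped k w)%:E)%E.
Proof.
move=> mk kn; have [fx fe] := ie_fresh kn; have [gx ge] := ix_fresh kn.
have xek := ixe kn kn.
(* The bound once the arrival of slot k is integrated; the symbol comes second, and its exponential
   moment cancels [theta]. After a shortage the multiplier is 1 throughout. *)
pose G w := (stopped k w * (if outage k w then 1 else expR (lam * w (ix k) ^+ 2) * theta))%:E.
have mG : measurable_fun [set: prodspace R I] G.
  apply/measurable_EFinP; apply: measurable_funM; first exact: measurable_stopped.
  apply: measurable_fun_ifT; [exact: measurable_outage|exact: measurable_cst|].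
  apply: measurable_funM => //; apply: (measurableT_comp (@measurable_expR R)).
  by apply: measurable_funM => //; apply: measurable_funX; exact: measurable_coord.
have G0 w : (0 <= G w)%E.
  rewrite lee_fin mulr_ge0// ?(ltW (stopped_gt0 _ _))//; case: ifP => // _.
  by rewrite mulr_ge0// expR_ge0.
apply: (@le_trans _ _ (\int[Q]_w G w)%E).
  apply: (integral_resample_le HQ (i := ie k)) => // w.
  have [out|nout] := boolP (outage k w).
    rewrite -[leRHS](integral_prob_cst (nu (ie k))) le_eqVlt; apply/orP; left.
    apply/eqP/eq_integral => e _.
    by rewrite /G /= stopped_upd// outage_upd// out.
  apply: (@le_trans _ _ (\int[nu (ie k)]_e ((stopped k w * expR (lam * w (ix k) ^+ 2))%:E
      * (expR (- (lam * e)))%:E))%E).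
    rewrite le_eqVlt; apply/orP; left; apply/eqP; apply: eq_integral => e _.
    rewrite /= stopped_upd// outage_upd// (negbTE nout) /deficit_step mk upd_eq upd_neq//.
    by rewrite mulrBr expRD -EFinM mulrA.
  have c0 : (0 <= (stopped k w * expR (lam * w (ix k) ^+ 2))%:E)%E.
    by rewrite lee_fin mulr_ge0// ?expR_ge0// ltW// stopped_gt0.
  rewrite ge0_integralZl//.
  rewrite /G (negbTE nout) mulrA [in leRHS]EFinM lee_wpmul2l//.
  exact: theta_ie.
apply: (integral_resample_le HQ (i := ix k)) => // w.
have [out|nout] := boolP (outage k w).
  rewrite -[leRHS](integral_prob_cst (nu (ix k))) le_eqVlt; apply/orP; left.
  apply/eqP/eq_integral => e _.
  by rewrite /G /= stopped_upd// outage_upd// out mulr1.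
apply: (@le_trans _ _ (\int[nu (ix k)]_x ((stopped k w * theta)%:E
    * (expR (lam * x ^+ 2))%:E))%E).
  rewrite le_eqVlt; apply/orP; left; apply/eqP; apply: eq_integral => e _.
  rewrite /G stopped_upd// outage_upd// (negbTE nout) upd_eq -EFinM; congr EFin; ring.
have c0 : (0 <= (stopped k w * theta)%:E)%E.
  by rewrite lee_fin mulr_ge0// ltW// stopped_gt0.
rewrite ge0_integralZl//.
rewrite EFinM -muleA [X in (_ * X)%E]muleC -[leRHS]mule1 lee_wpmul2l//.
exact: theta_ix.
Qed.

Lemma outage_bound : (m <= n)%N -> (Q [set w | outage n w] <= (theta ^+ m)%:E)%E.
Proof.
move=> mn.
have hm k : (k <= m)%N -> (\int[Q]_w (stopped k w)%:E <= (theta ^+ k)%:E)%E.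
  elim: k => [|k IH] km.
    by rewrite /= integral_prob_cst expr0.
  apply: (le_trans (saving_step km (leq_trans km mn))).
  by rewrite exprS EFinM lee_wpmul2l ?lee_fin// IH// ltnW.
have hn k : (m <= k <= n)%N -> (\int[Q]_w (stopped k w)%:E <= (theta ^+ m)%:E)%E.
  elim: k => [|k IH]; first by rewrite leqn0 andbT => /eqP m0; have := hm 0%N (leq0n _); rewrite m0.
  case/andP; rewrite leq_eqVlt => /orP[/eqP mk1 _|].
    by have -> : theta ^+ m = theta ^+ k.+1 by [congr (_ ^+ _)]; apply: hm; rewrite -mk1.
  rewrite ltnS => mk kn; apply: (le_trans (transmission_step mk kn)).
  by apply: IH; rewrite mk ltnW.
apply: (le_trans _ (hn n _)); last by rewrite mn leqnn.
set A := [set w | _].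
have mA : measurable (A : set (prodspace R I)).
  rewrite (_ : A = (outage n : prodspace R I -> bool) @^-1` [set true]).
    by rewrite -[X in measurable X]setTI; exact: measurable_outage.
  by apply/seteqP; split=> w.
have -> : Q A = (\int[Q]_w (\1_A w)%:E)%E by rewrite integral_indic// setIT.
have m1 : measurable_fun setT (fun w : prodspace R I => (\1_A w : R)%:E).
  by apply/measurable_EFinP; exact: measurable_indic.
apply: ge0_le_integral => //.
move=> w _; rewrite lee_fin indicE.
have [wA|wA] := boolP (w \in A); last exact/ltW/stopped_gt0.
have [h _] := stopped_outage n w.
by apply: h; move/set_mem: wA.
Qed.

End energy_outage.

(** * Error probability of the code *)

Lemma indic_iff (R : realType) (X Y : Type) (A : set X) (B : set Y) x y :
  (A x <-> B y) -> \1_A x = \1_B y :> R.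
Proof.
move=> AB; rewrite !indicE; congr (nat_of_bool _)%:R.
by apply/idP/idP => /set_mem h; apply/mem_set; apply/AB.
Qed.

Lemma measure_big_setU_le d (T : measurableType d) (R : realType)
    (P : probability T R) (J : Type) (r : seq J) (p : pred J) (F : J -> set T) :
  (forall j, p j -> measurable (F j)) ->
  (P (\big[setU/set0]_(j <- r | p j) F j) <= \sum_(j <- r | p j) P (F j))%E.
Proof.
move=> mF; elim: r => [|j r IH]; first by rewrite !big_nil measure0.
rewrite !big_cons; case: ifP => // pj.
apply: (le_trans (measureU2 _ _ _)) => //; first exact: mF.
  exact: bigsetU_measurable.
by rewrite leeD2l.
Qed.

Lemma shift_lt (i m n : nat) : (i < n - m)%N -> (i + m < n)%N.
Proof. by rewrite ltn_subRL addnC. Qed.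

Lemma shift_lt2 (i j m n : nat) : (i < j < n - m)%N -> (i + m < j + m < n)%N.
Proof. by move=> /andP[ij /shift_lt jn]; rewrite ltn_add2r ij. Qed.

(** The decision of [st_decoder] with the threshold tests abstracted into [f], so that two decisions
    can be compared through their test outcomes. *)
Definition unique_or {M : nat} (f : 'I_M -> bool) (u : 'I_M) : 'I_M :=
  if [pick j | [forall j', f j' == (j' == j)]] is Some j then j else u.

Section save_and_transmit_symbols.
Context {R : realType}.
Implicit Types (x e y : nat -> R).

Lemma st_storedE (m : nat) x e k :
  st_stored m x e k = \sum_(i < k) (e i - st_symbol m x e i ^+ 2).
Proof.
elim: k => [|k IH]; first by rewrite big_ord0.
by rewrite big_ord_recr/= -IH.
Qed.

Lemma st_stored_ext (m : nat) x e x' e' k : (forall i, (i < k)%N -> x i = x' i) ->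
  (forall i, (i < k)%N -> e i = e' i) -> st_stored m x e k = st_stored m x' e' k.
Proof.
elim: k => //= k IH hx he; rewrite /st_send hx// he// IH// => i ik.
- by apply: hx; exact: ltnW.
- by apply: he; exact: ltnW.
Qed.

Lemma st_symbol_ext (m : nat) x e x' e' k : (forall i, (i <= k)%N -> x i = x' i) ->
  (forall i, (i <= k)%N -> e i = e' i) -> st_symbol m x e k = st_symbol m x' e' k.
Proof.
move=> hx he; rewrite /st_symbol /st_send (st_stored_ext m (x' := x') (e' := e')).
- by rewrite hx// he.
- by move=> i /ltnW; exact: hx.
- by move=> i /ltnW; exact: he.
Qed.

Lemma st_stored_ge0 (m : nat) x e n k : (forall i, (i < n)%N -> 0 <= e i) ->
  (k <= n)%N -> 0 <= st_stored m x e k.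
Proof.
move=> e0; elim: k => //= k IH kn; have sk := IH (ltnW kn); have ek := e0 _ kn.
rewrite /st_send; case: ifP => [/andP[_ h]|_]; last by rewrite expr0n subr0 addr_ge0.
lra.
Qed.

Lemma st_symbol_energy (m : nat) x e n k : (forall i, (i < n)%N -> 0 <= e i) ->
  (k <= n)%N -> \sum_(i < k) st_symbol m x e i ^+ 2 <= \sum_(i < k) e i.
Proof.
move=> e0 kn; rewrite -subr_ge0 -sumrB -st_storedE.
exact: st_stored_ge0 kn.
Qed.

(** By induction the stored energy is the arrivals minus the energy of the desired symbols. The test
    of the recursion is then the assumed inequality for that slot, so every symbol is sent. *)
Lemma st_symbol_no_outage (m n : nat) x e :
  (forall j, (m <= j < n)%N ->
     \sum_(m <= i < j.+1) x i ^+ 2 <= \sum_(i < j.+1) e i) ->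
  forall k, (m <= k < n)%N -> st_symbol m x e k = x k.
Proof.
move=> h.
have stE k : (k <= n)%N ->
    st_stored m x e k = \sum_(i < k) e i - \sum_(m <= i < k) x i ^+ 2.
  elim: k => [|k IH] kn /=; first by rewrite big_ord0 big_geq// subrr.
  rewrite IH 1?ltnW// big_ord_recr/= /st_send.
  case: (leqP m k) => mk /=; last by rewrite !big_geq//; [ring|exact: ltnW].
  have := h k; rewrite mk kn => /(_ isT); rewrite big_nat_recr//= big_ord_recr/= => hk.
  have hb : x k ^+ 2 <= e k + (\sum_(i < k) e i - \sum_(m <= i < k) x i ^+ 2) by lra.
  by rewrite hb; ring.
move=> k /andP[mk kn]; rewrite /st_symbol /st_send mk stE 1?ltnW//=.
have := h k; rewrite mk kn => /(_ isT); rewrite big_nat_recr//= big_ord_recr/= => hk.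
by rewrite ifT//; lra.
Qed.

End save_and_transmit_symbols.

Section model_on_product_space.
Context {R : realType} {dE : measure_display} {TE : measurableType dE}.
Variables (mu : probability TE R) (E : {RV mu >-> R}).
Variables (n M : nat) (S : R).
Context {d : measure_display} {T : measurableType d} {Pr : probability T R}.
Variable c : st_model E n M S Pr.
Hypothesis S0 : 0 < S.

Definition slots : finType := ('I_n + 'I_M * 'I_n + 'I_n + bool)%type.

(** Messages are embedded in the reals so that all slots share one product space. *)
Definition coded (f : T -> 'I_M) (t : T) : R := (f t : nat)%:R.

Lemma measurable_coded (f : T -> 'I_M) : (forall j, measurable (f @^-1` [set j])) ->
  measurable_fun setT (coded f).
Proof.
move=> mf _ Y mY; rewrite setTI.
rewrite (_ : _ @^-1` _ = \bigcup_(j in [set j : 'I_M | Y (j : nat)%:R]) (f @^-1` [set j])).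
  by apply: fin_bigcup_measurable => //; exact: finite_finset.
apply/seteqP; split=> t; first by move=> h; exists (f t).
by move=> [j /= h fj]; rewrite /coded fj.
Qed.

Definition mcode : {RV Pr >-> R} :=
  [the {mfun _ >-> _} of mfun_Sub (mem_set (measurable_coded (message_law c).1))].
Definition ucode : {RV Pr >-> R} :=
  [the {mfun _ >-> _} of mfun_Sub (mem_set (measurable_coded (tiebreak_law c).1))].

Definition slotRV (i : slots) : {RV Pr >-> R} :=
  match i with
  | inl (inl (inl k)) => arrival c k
  | inl (inl (inr (w, k))) => codeword c w k
  | inl (inr k) => noise c k
  | inr true => mcode
  | inr false => ucode
  end.

Definition slot_law (i : slots) : probability R R := distribution Pr (slotRV i).

Definition joint (t : T) : prodspace R slots := fun i => slotRV i t.

Lemma measurable_joint : measurable_fun setT joint.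
Proof. by apply: measurable_to_prodspace => i; exact: measurable_funPT. Qed.

Definition jointRV : {RV Pr >-> prodspace R slots} :=
  [the {mfun _ >-> _} of mfun_Sub (mem_set measurable_joint)].

Definition joint_law : probability (prodspace R slots) R := distribution Pr jointRV.

Lemma joint_lawE (A : set (prodspace R slots)) : joint_law A = Pr (joint @^-1` A).
Proof. by []. Qed.

Lemma joint_product_law : product_law slot_law joint_law.
Proof.
move=> B mB; rewrite joint_lawE.
have := @st_independent _ _ _ _ _ _ _ _ _ _ _ c [set: slots]%SET (fun i => slotRV i @^-1` B i).
rewrite (_ : \bigcap_(i in _) _ = joint @^-1` box B); last first.
  apply/seteqP; split=> t /= h i; first by apply: h; rewrite /= inE.
  by move=> _; exact: h.
move=> -> ; last first.
  move=> [[[k|[w k]]|k]|[]] _ /=.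
  - by exists (B (inl (inl (inl k)))) => //; rewrite setTI.
  - by exists (B (inl (inl (inr (w, k))))) => //; rewrite setTI.
  - by exists (B (inl (inr k))) => //; rewrite setTI.
  - by exists [set j : 'I_M | B (inr true) (j : nat)%:R] => //; rewrite setTI.
  - by exists [set j : 'I_M | B (inr false) (j : nat)%:R] => //; rewrite setTI.
by apply: eq_bigl => i; rewrite inE.
Qed.

(* Time indices k >= n, which no statement below depends on, are sent to an
   unrelated coordinate. *)
Definition ie (k : nat) : slots := if insub k is Some i then inl (inl (inl i)) else inr false.
Definition ix (w : 'I_M) (k : nat) : slots :=
  if insub k is Some i then inl (inl (inr (w, i))) else inr false.
Definition iz (k : nat) : slots := if insub k is Some i then inl (inr i) else inr false.
Definition iW : slots := inr true.

Lemma ieW k : ie k != iW. Proof. by rewrite /ie; case: insub. Qed.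
Lemma ixW w k : ix w k != iW. Proof. by rewrite /ix; case: insub. Qed.
Lemma izW k : iz k != iW. Proof. by rewrite /iz; case: insub. Qed.
Lemma ixe w j k : (j < n)%N -> ix w j != ie k.
Proof. by move=> jn; rewrite /ix /ie (insubT (fun k => k < n)%N jn); case: insub. Qed.
Lemma ixz w j k : (j < n)%N -> ix w j != iz k.
Proof. by move=> jn; rewrite /ix /iz (insubT (fun k => k < n)%N jn); case: insub. Qed.
Lemma ixx w w' j k : (j < n)%N -> w != w' -> ix w j != ix w' k.
Proof.
move=> jn ww; rewrite /ix (insubT (fun k => k < n)%N jn); case: insub => // i.
by apply/eqP => -[/eqP]; rewrite (negbTE ww).
Qed.
Lemma ix_inj w j k : (j < k < n)%N -> ix w j != ix w k.
Proof.
move=> /andP[jk kn]; have jn := ltn_trans jk kn.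
rewrite /ix (insubT (fun k => k < n)%N jn) (insubT (fun k => k < n)%N kn).
by apply/eqP => -[/eqP]; rewrite ltn_eqF.
Qed.
Lemma ie_inj j k : (j < k < n)%N -> ie j != ie k.
Proof.
move=> /andP[jk kn]; have jn := ltn_trans jk kn.
rewrite /ie (insubT (fun k => k < n)%N jn) (insubT (fun k => k < n)%N kn).
by apply/eqP => -[/eqP]; rewrite ltn_eqF.
Qed.
Lemma iz_inj j k : (j < k < n)%N -> iz j != iz k.
Proof.
move=> /andP[jk kn]; have jn := ltn_trans jk kn.
rewrite /iz (insubT (fun k => k < n)%N jn) (insubT (fun k => k < n)%N kn).
by apply/eqP => -[/eqP]; rewrite ltn_eqF.
Qed.

Lemma joint_ie t k : (k < n)%N -> joint t (ie k) = arrival c k t.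
Proof. by move=> kn; rewrite /joint /ie (insubT (fun k => k < n)%N kn). Qed.
Lemma joint_ix t w k : (k < n)%N -> joint t (ix w k) = codeword c w k t.
Proof. by move=> kn; rewrite /joint /ix (insubT (fun k => k < n)%N kn). Qed.
Lemma joint_iz t k : (k < n)%N -> joint t (iz k) = noise c k t.
Proof. by move=> kn; rewrite /joint /iz (insubT (fun k => k < n)%N kn). Qed.

Lemma law_ie k : (k < n)%N -> forall A, measurable A ->
  slot_law (ie k) A = distribution mu E A.
Proof.
move=> kn A mA; rewrite /slot_law /ie (insubT (fun k => k < n)%N kn) /=.
exact: (arrival_law c kn).
Qed.
Lemma law_ix w k : (k < n)%N -> forall A, measurable A ->
  slot_law (ix w k) A = gau (Num.sqrt S) A.
Proof.
move=> kn A mA; rewrite /slot_law /ix (insubT (fun k => k < n)%N kn) /=.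
exact: (codeword_law c w kn mA).
Qed.
Lemma law_iz k : (k < n)%N -> forall A, measurable A ->
  slot_law (iz k) A = gau 1 A.
Proof.
move=> kn A mA; rewrite /slot_law /iz (insubT (fun k => k < n)%N kn) /=.
have := noise_law c kn mA; rewrite /gauss_law sqrtr1; exact.
Qed.

(* The message is independent of the other coordinates, so an event avoiding its
   coordinate has the same probability given any message. *)
Definition ignores_message (B : set (prodspace R slots)) :=
  forall w v, B (upd w iW v) = B w.

Lemma message_independent (w : 'I_M) (B : set (prodspace R slots)) :
  measurable B -> ignores_message B ->
  Pr (message c @^-1` [set w] `&` joint @^-1` B) = ((M%:R^-1)%:E * Pr (joint @^-1` B))%E.
Proof.
move=> mB hB.
pose A := [set s : prodspace R slots | s iW = (w : nat)%:R].
have mA : measurable A.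
  rewrite (_ : A = (fun s : prodspace R slots => s iW) @^-1` [set (w : nat)%:R]); last by [].
  by rewrite -[X in measurable X]setTI; exact: measurable_coord.
have AE : joint @^-1` A = message c @^-1` [set w].
  apply/seteqP; split=> t /=.
    rewrite /A /joint /= /coded => /eqP; rewrite eqr_nat => /eqP h; exact: val_inj.
  by move=> h; rewrite /A /joint /= /coded h.
rewrite -AE -preimage_setI -!joint_lawE.
have mAB : measurable (A `&` B) by exact: measurableI.
transitivity (\int[joint_law]_s (\1_(A `&` B) s : R)%:E)%E.
  by rewrite integral_indic// setIT.
have mi : measurable_fun setT (fun s : prodspace R slots => (\1_(A `&` B) s : R)%:E).
  by apply/measurable_EFinP; exact: measurable_indic.
rewrite (integral_resample joint_product_law iW mi); last by move=> s; rewrite lee_fin.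
have miA : measurable_fun setT (fun v : R => (\1_[set (w : nat)%:R : R] v : R)%:E).
  by apply/measurable_EFinP; exact: measurable_indic.
have miB : measurable_fun setT (fun s : prodspace R slots => (\1_B s : R)%:E).
  by apply/measurable_EFinP; exact: measurable_indic.
transitivity (\int[joint_law]_s ((M%:R^-1)%:E * (\1_B s : R)%:E))%E; last first.
  rewrite ge0_integralZl//.
  by rewrite integral_indic// setIT.
apply: eq_integral => s _.
transitivity (\int[slot_law iW]_v ((\1_[set (w : nat)%:R : R] v : R)%:E * (\1_B s : R)%:E))%E.
  apply: eq_integral => v _; rewrite indicI -EFinM; congr (_ * _)%:E.
  by apply: indic_iff; rewrite hB.
rewrite ge0_integralZr//.
rewrite integral_indic// setIT; congr (_ * _)%E.
rewrite -((message_law c).2 w) -AE.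
by [].
Qed.

(** The sent codeword has a random index, whereas the estimates concern a fixed one. Splitting by
    the message gives M terms of at most b / M each. *)
Lemma message_union_bound (D : set T) (B : 'I_M -> set (prodspace R slots)) (b : R) :
  measurable D -> (0 < M)%N -> (forall w, measurable (B w)) ->
  (forall w, ignores_message (B w)) ->
  (forall t, D t -> B (message c t) (joint t)) ->
  (forall w, joint_law (B w) <= b%:E)%E ->
  (Pr D <= b%:E)%E.
Proof.
move=> mD M0 mB iB DB Bb.
have mW := (message_law c).1.
pose F (w : 'I_M) := message c @^-1` [set w] `&` joint @^-1` (B w).
have mF w : measurable (F w).
  apply: measurableI; first exact: mW.
  by rewrite -[X in measurable X]setTI; apply: measurable_joint => //; exact: mB.
have DF : D `<=` \big[setU/set0]_w F w.
  move=> t Dt; rewrite (bigD1 (message c t))//=; left; split=> //.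
  exact: DB.
apply: (@le_trans _ _ (Pr (\big[setU/set0]_w F w))).
  by apply: le_measure => //; rewrite inE//; exact: bigsetU_measurable.
apply: (le_trans (measure_big_setU_le _ _ _)) => //.
apply: (@le_trans _ _ (\sum_(w < M) (M%:R^-1 * b)%:E)%E).
  apply: lee_sum => w _; rewrite message_independent// EFinM lee_wpmul2l//.
  exact: Bb.
have bE : \sum_(w < M) (M%:R^-1 * b) = b.
  by rewrite sumr_const card_ord -[(_ * _) *+ _]mulr_natl mulrA divff ?mul1r// pnatr_eq0 -lt0n.
by rewrite sumEFin bE.
Qed.

Variables (m : nat) (xi : R).

(** The message is now a parameter [w], so this and the events below do not read the coordinate
    [iW], as [message_union_bound] requires. *)
Definition outputs (w : 'I_M) (k : nat) (s : prodspace R slots) : R :=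
  st_symbol m (fun j => s (ix w j)) (fun j => s (ie j)) k + s (iz k).

Definition score (w j : 'I_M) (s : prodspace R slots) : R :=
  \sum_(i < n - m) ln (lratio S (s (ix j (i + m)%N)) (outputs w (i + m)%N s)).

Definition outage_set (w : 'I_M) : set (prodspace R slots) :=
  [set s | outage (ix w) ie m n s].

Definition atypical_set (w : 'I_M) : set (prodspace R slots) :=
  [set s | \sum_(i < n - m) infod S (s (ix w (i + m)%N)) (s (iz (i + m)%N)) < ln xi].

Definition confusion_set (w j : 'I_M) : set (prodspace R slots) :=
  [set s | ln xi <= score w j s].

Lemma measurable_stored (w : 'I_M) k : measurable_fun [set: prodspace R slots]
  (fun s => st_stored m (fun j => s (ix w j)) (fun j => s (ie j)) k).
Proof.
elim: k => [|k IH] /=; first exact: measurable_cst.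
apply: measurable_funD => //; apply: measurable_funB; first exact: measurable_coord.
apply: measurable_funX; apply: measurable_fun_ifT; last exact: measurable_cst.
  apply: measurable_and; first exact: measurable_cst.
  apply: measurable_fun_ler; first by apply: measurable_funX; exact: measurable_coord.
  by apply: measurable_funD => //; exact: measurable_coord.
exact: measurable_coord.
Qed.

Lemma measurable_outputs (w : 'I_M) k : measurable_fun setT (outputs w k).
Proof.
apply: measurable_funD; last exact: measurable_coord.
apply: measurable_fun_ifT; last exact: measurable_cst.
  apply: measurable_and; first exact: measurable_cst.
  apply: measurable_fun_ler; first by apply: measurable_funX; exact: measurable_coord.
  by apply: measurable_funD; [exact: measurable_coord|exact: measurable_stored].
exact: measurable_coord.
Qed.

Lemma measurable_score (w j : 'I_M) : measurable_fun setT (score w j).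
Proof.
apply: measurable_sum => i; apply: (measurableT_comp (@measurable_ln R)).
have m2 : measurable_fun setT
    (fun s : prodspace R slots => (s (ix j (i + m)%N), outputs w (i + m)%N s)).
  by apply: measurable_fun_pair; [exact: measurable_coord|exact: measurable_outputs].
exact: (measurableT_comp (measurable_lratio S0) m2).
Qed.

Lemma measurable_outage_set w : measurable (outage_set w).
Proof.
rewrite (_ : outage_set w = (outage (ix w) ie m n : prodspace R slots -> bool) @^-1` [set true]).
  by rewrite -[X in measurable X]setTI; exact: measurable_outage.
by apply/seteqP; split=> s.
Qed.

Lemma measurable_atypical_set w : measurable (atypical_set w).
Proof.
have mX : measurable_fun [set: prodspace R slots]
    (fun s => \sum_(i < n - m) infod S (s (ix w (i + m)%N)) (s (iz (i + m)%N))).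
  apply: measurable_sum => i.
  have m2 : measurable_fun setT
      (fun s : prodspace R slots => (s (ix w (i + m)%N), s (iz (i + m)%N))).
    by apply: measurable_fun_pair; exact: measurable_coord.
  exact: (measurableT_comp (measurable_infod S) m2).
rewrite (_ : atypical_set w = (fun s : prodspace R slots =>
    \sum_(i < n - m) infod S (s (ix w (i + m)%N)) (s (iz (i + m)%N))) @^-1` `]-oo, ln xi[%classic).
  by rewrite -[X in measurable X]setTI; exact: mX.
by apply/seteqP; split=> s; rewrite /atypical_set /= in_itv.
Qed.

Lemma measurable_confusion_set w j : measurable (confusion_set w j).
Proof.
rewrite (_ : confusion_set w j = score w j @^-1` `[ln xi, +oo[%classic).
  by rewrite -[X in measurable X]setTI; exact: measurable_score.
by apply/seteqP; split=> s; rewrite /confusion_set /= in_itv/= andbT.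
Qed.

Lemma upd_ix (s : slots -> R) v w : (fun k => upd s iW v (ix w k)) = (fun k => s (ix w k)).
Proof. by apply/funext => k; rewrite upd_neq ?ixW. Qed.

Lemma upd_ie (s : slots -> R) v : (fun k => upd s iW v (ie k)) = (fun k => s (ie k)).
Proof. by apply/funext => k; rewrite upd_neq ?ieW. Qed.

Lemma outputs_message w k s v : outputs w k (upd s iW v) = outputs w k s.
Proof. by rewrite /outputs upd_ix upd_ie upd_neq ?izW. Qed.

Lemma ignores_outage w : ignores_message (outage_set w).
Proof.
move=> s v; rewrite /outage_set /= outage_upd// => j _; [exact: ixW|exact: ieW].
Qed.

Lemma ignores_atypical w : ignores_message (atypical_set w).
Proof.
move=> s v; rewrite /atypical_set /=; congr (is_true (_ < _)).
by apply: eq_bigr => i _; rewrite !upd_neq ?ixW ?izW.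
Qed.

Lemma ignores_confusion w j : ignores_message (confusion_set w j).
Proof.
move=> s v; rewrite /confusion_set /= /score; congr (is_true (_ <= _)).
by apply: eq_bigr => i _; rewrite outputs_message upd_neq ?ixW.
Qed.

Let input (t : T) := fun k => codeword c (message c t) k t.
Let received (t : T) := fun k =>
  st_symbol m (input t) (fun j => arrival c j t) k + noise c k t.

Lemma received_joint t k : (k < n)%N -> received t k = outputs (message c t) k (joint t).
Proof.
move=> kn; rewrite /received /outputs joint_iz//; congr (_ + _).
apply: st_symbol_ext => i ik; have iN := leq_ltn_trans ik kn.
  by rewrite joint_ix.
by rewrite joint_ie.
Qed.

Lemma score_joint t j :
  st_score n m S (fun k => codeword c j k t) (received t) = score (message c t) j (joint t).
Proof.
rewrite /st_score /score -[X in \sum_(X <= _ < _) _]add0n big_addn big_mkord; apply: eq_bigr => i _.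
have iN := shift_lt (ltn_ord i).
by rewrite received_joint// joint_ix.
Qed.

(** Without a shortage the output is codeword plus noise from slot m on, so the score of the sent
    message is its information sum and passes the threshold. It is then the only one to pass, and
    the tie-break is never consulted. *)
Lemma message_decodes t : ~ outage_set (message c t) (joint t) ->
  ~ atypical_set (message c t) (joint t) ->
  (forall j, j != message c t -> ~ confusion_set (message c t) j (joint t)) ->
  forall u, st_decoder n m S xi (fun j k => codeword c j k t) u (received t) = message c t.
Proof.
set w := message c t => hout hatyp hconf u.
have hsym k : (m <= k < n)%N -> st_symbol m (fun j => joint t (ix w j))
    (fun j => joint t (ie j)) k = joint t (ix w k).
  apply: st_symbol_no_outage => j jn; rewrite leNgt; apply/negP => h; apply: hout.
  by apply/outageP; exists j => //; rewrite /deficit subr_gt0.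
have hw : ln xi <= score w w (joint t).
  rewrite leNgt; apply/negP => h; apply: hatyp; rewrite /atypical_set /=.
  apply: le_lt_trans h; rewrite le_eqVlt; apply/orP; left; apply/eqP.
  apply: eq_bigr => i _.
  have iN := shift_lt (ltn_ord i).
  by rewrite /outputs hsym ?infodE// iN leq_addl.
have hb j : (ln xi <= st_score n m S (fun k => codeword c j k t) (received t)) = (j == w).
  rewrite score_joint -/w; have [->//|jw] := eqVneq j w.
  by apply/negbTE/negP => h; exact: (hconf j jw).
rewrite /st_decoder; case: pickP => [j /forallP/(_ w)|/(_ w)/negbT/forallPn[j]].
  by rewrite hb eqxx => /eqP/esym/eqP.
by rewrite hb eqxx.
Qed.

Lemma mismatchE : mismatch m c = [set t | outage_set (message c t) (joint t)].
Proof.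
apply/seteqP; split=> t /=.
  move=> [j /= /andP[mj jn] h]; apply/outageP; exists j; first by rewrite mj.
  rewrite /deficit subr_gt0; move: h; congr (is_true (_ < _)).
    by apply: eq_bigr => i _; rewrite joint_ie// (leq_trans (ltn_ord i)).
  by apply: eq_big_nat => i /andP[_ ij]; rewrite joint_ix// (leq_trans ij).
move/outageP => [j /andP[mj jn]]; rewrite /deficit subr_gt0 => h; exists j => /=.
  by rewrite mj.
move: h; congr (is_true (_ < _)).
  by apply: eq_bigr => i _; rewrite joint_ie// (leq_trans (ltn_ord i)).
by apply: eq_big_nat => i /andP[_ ij]; rewrite joint_ix// (leq_trans ij).
Qed.

Lemma measurable_message_set (B : 'I_M -> set (prodspace R slots)) :
  (forall w, measurable (B w)) -> measurable [set t | B (message c t) (joint t)].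
Proof.
move=> mB.
rewrite (_ : [set t | _] = \bigcup_(w in [set: 'I_M]) (message c @^-1` [set w] `&` joint @^-1` (B w))).
  apply: fin_bigcup_measurable => // w _; apply: measurableI; first exact: (message_law c).1.
  by rewrite -[X in measurable X]setTI; exact: measurable_joint.
apply/seteqP; split=> t /=; first by move=> h; exists (message c t).
by move=> [w _ [/= <-]].
Qed.

Let err : set T := [set t |
  st_decoder n m S xi (fun j k => codeword c j k t) (tiebreak c t) (received t) <> message c t].

(** The error depends only on the vector of test outcomes, the tie-break and the message, so it is a
    finite union of measurable events. *)
Lemma measurable_err : measurable err.
Proof.
pose F (q : {ffun 'I_M -> bool} * 'I_M * 'I_M) : set T :=
  [set t | forall j, (ln xi <= score q.2 j (joint t)) = q.1.1 j] `&`
  (tiebreak c @^-1` [set q.1.2] `&` message c @^-1` [set q.2]).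
have -> : err = \bigcup_(q in [set q : {ffun 'I_M -> bool} * 'I_M * 'I_M |
    unique_or (q.1.1 : 'I_M -> bool) q.1.2 <> q.2]) F q.
  have decE t (f : {ffun 'I_M -> bool}) : (forall j, (ln xi <= score (message c t) j (joint t)) = f j) ->
      st_decoder n m S xi (fun j k => codeword c j k t) (tiebreak c t) (received t) =
      unique_or f (tiebreak c t).
    move=> hf; rewrite -[LHS]/(unique_or (fun j =>
      ln xi <= st_score n m S (fun k => codeword c j k t) (received t)) (tiebreak c t)).
    by congr (unique_or _ _); apply/funext => j; rewrite score_joint hf.
  apply/seteqP; split=> t.
    move=> h; exists ([ffun j => ln xi <= score (message c t) j (joint t)], tiebreak c t, message c t).
      rewrite /= -decE//; by move=> j; rewrite ffunE.
    by split=> // j /=; rewrite ffunE.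
  move=> [[[f u] w] /= hd [/= hf [hu hw]]]; rewrite /err /=.
  by rewrite (decE t f) ?hu ?hw// -hw.
apply: fin_bigcup_measurable; first exact: finite_finset.
move=> q _; apply: measurableI; last first.
  by apply: measurableI; [exact: (tiebreak_law c).1|exact: (message_law c).1].
rewrite (_ : [set t | _] = \bigcap_(j in [set: 'I_M]) [set t | (ln xi <= score q.2 j (joint t)) = q.1.1 j]).
  apply: fin_bigcap_measurable => // j _.
  have mb : measurable_fun setT (fun t => ln xi <= score q.2 j (joint t)).
    apply: measurable_fun_ler; first exact: measurable_cst.
    exact: (measurableT_comp (measurable_score q.2 j) measurable_joint).
  rewrite (_ : [set t | _] = (fun t => ln xi <= score q.2 j (joint t)) @^-1` [set q.1.1 j]); last by [].
  by rewrite -[X in measurable X]setTI; exact: mb.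
by apply/seteqP; split=> t /= h j; [move=> _; exact: h|exact: h].
Qed.

Hypothesis E_ge0 : {ae mu, forall t, 0 <= E t}.

(** Only the law of an arrival is known, so the null event [E < 0] is carried over through the law,
    slot by slot. *)
Lemma arrivals_ge0 : {ae Pr, forall t, forall k, (k < n)%N -> 0 <= arrival c k t}.
Proof.
have h (k : 'I_n) : {ae Pr, forall t, 0 <= arrival c k t}.
  have mneg : measurable (`]-oo, (0:R)[%classic : set R) by [].
  have e0 : mu (E @^-1` `]-oo, (0:R)[%classic) = 0%E.
    apply: (measure_negligible (mu := mu)).
      by rewrite -[X in measurable X]setTI; exact: measurable_funPT.
    apply: negligibleS E_ge0 => t /=; rewrite in_itv/= => Et; apply/negP.
    by rewrite -ltNge.
  exists (arrival c k @^-1` `]-oo, (0:R)[%classic); split.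
  - by rewrite -[X in measurable X]setTI; exact: measurable_funPT.
  - rewrite -[LHS]/(distribution Pr (arrival c k) _) (arrival_law c (ltn_ord k))//.
  - by move=> t /= /negP; rewrite -ltNge in_itv.
have FF : Filter (almost_everywhere Pr) by exact: ae_filter_ringOfSetsType.
have := @filter_forall _ _ (fun (k : 'I_n) t => 0 <= arrival c k t) _ FF h.
apply: filterS => t ht k kn.
exact: (ht (Ordinal kn)).
Qed.

Variables (lam theta rmax l kap b eps2 eps : R).
Hypothesis xi0 : 0 < xi.
Hypothesis M0 : (0 < M)%N.
Hypothesis mn : (m <= n)%N.
Hypothesis lam0 : 0 <= lam.
Hypothesis theta0 : 0 <= theta.
Hypothesis theta_E : (\int[distribution mu E]_e (expR (- (lam * e)))%:E <= theta%:E)%E.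
Hypothesis theta_X :
  (\int[gau (Num.sqrt S)]_x (expR (lam * x ^+ 2))%:E * theta%:E <= 1)%E.
Hypothesis theta_m : theta ^+ m <= eps2.
Hypothesis rmax0 : 0 < rmax.
Hypothesis l0 : 0 <= l.
Hypothesis kap0 : 0 <= kap.
Hypothesis kapE : (\int[gau 1]_x (expR (l * x ^+ 2))%:E <= kap%:E)%E.
Hypothesis xi_capac : ln xi - (n - m)%:R * capac S < 0.
Hypothesis b_bound : Phi ((ln xi - (n - m)%:R * capac S) / (sdev S * Num.sqrt rmax))
  + kap ^+ (n - m) * expR (- (l * rmax)) <= b.
Hypothesis eps_bound : eps2 + b + (M.-1)%:R / xi <= eps.

Lemma outage_set_bound w : (joint_law (outage_set w) <= eps2%:E)%E.
Proof.
apply: (@le_trans _ _ (theta ^+ m)%:E); last by rewrite lee_fin.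
apply: (outage_bound joint_product_law lam0 (n := n)) => //.
- by move=> j k; exact: ix_inj.
- by move=> j k; exact: ie_inj.
- by move=> j k jn _; exact: ixe.
- by move=> k kn; rewrite (integral_same_law _ (law_ie kn)).
- by move=> k kn; rewrite (integral_same_law _ (law_ix w kn)).
Qed.

Lemma atypical_set_bound w : (joint_law (atypical_set w) <= b%:E)%E.
Proof.
apply: (@le_trans _ _ (Phi ((ln xi - (n - m)%:R * capac S) / (sdev S * Num.sqrt rmax))
  + kap ^+ (n - m) * expR (- (l * rmax)))%:E); last by rewrite lee_fin.
apply: (information_sum_tail joint_product_law S0 (N := n - m)
  (ix := fun i => ix w (i + m)%N) (iz := fun i => iz (i + m)%N)) => //.
- by move=> j jN; apply: law_ix; exact: shift_lt.
- by move=> j jN; apply: law_iz; exact: shift_lt.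
- by move=> j k /shift_lt2; exact: ix_inj.
- by move=> j k /shift_lt2; exact: iz_inj.
- by move=> j k /shift_lt jN _; exact: ixz.
Qed.

Lemma confusion_set_bound w j : j != w -> (joint_law (confusion_set w j) <= (xi^-1)%:E)%E.
Proof.
move=> jw.
apply: (wrong_codeword_tail joint_product_law S0 (N := n - m) (xi := xi)
  (ix := fun i => ix j (i + m)%N) (y := fun i => outputs w (i + m)%N)) => //.
- by move=> i iN; apply: law_ix; exact: shift_lt.
- by move=> i k /shift_lt2; exact: ix_inj.
- by move=> i iN; exact: measurable_outputs.
(* The outputs are built from codeword [w], the arrivals and the noise, none of which is a
   coordinate of codeword [j]. *)
- move=> i k s v iN /shift_lt kN; rewrite /outputs; congr (_ + _).
    by apply: st_symbol_ext => a _; rewrite upd_neq// eq_sym; [exact: ixx|exact: ixe].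
  by rewrite upd_neq// eq_sym; exact: ixz.
Qed.

Lemma mismatch_bound : (Pr (mismatch m c) <= eps2%:E)%E.
Proof.
rewrite mismatchE; apply: (message_union_bound (B := outage_set)) => //.
- by apply: measurable_message_set => w; exact: measurable_outage_set.
- exact: measurable_outage_set.
- exact: ignores_outage.
- exact: outage_set_bound.
Qed.

Lemma st_code_correct : is_st_code m xi eps c.
Proof.
split.
- exact: message_law.
- by move=> cb w e e' k h; apply: st_symbol_ext.
- move=> cb u y y' h; rewrite /st_decoder.
  have sE j : st_score n m S (cb j) y = st_score n m S (cb j) y'.
    by apply: eq_big_nat => k /andP[_ kn]; rewrite h.
  rewrite -[LHS]/(unique_or (fun j => ln xi <= st_score n m S (cb j) y) u).
  rewrite -[RHS]/(unique_or (fun j => ln xi <= st_score n m S (cb j) y') u).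
  by congr (unique_or _ u); apply/funext => j; rewrite sE.
- apply: filterS arrivals_ge0 => t ht k kn.
  exact: (@st_symbol_energy _ m (fun j => codeword c (message c t) j t)
    (fun j => arrival c j t) n k.+1 ht kn).
(* For a fixed message the union bound gives [eps2], [b], and at most 1 / xi for each of the M - 1
   wrong codewords. *)
- pose B w := outage_set w `|` (atypical_set w `|`
    \big[setU/set0]_(j | j != w) confusion_set w j).
  apply: (message_union_bound (D := err) (B := B)) => //.
  + exact: measurable_err.
  + move=> w; apply: measurableU; first exact: measurable_outage_set.
    apply: measurableU; first exact: measurable_atypical_set.
    by apply: bigsetU_measurable => j _; exact: measurable_confusion_set.
  + move=> w s v; rewrite /B /=; have e1 := ignores_outage w s v.
    have e2 := ignores_atypical w s v.
    have e3 : (\big[setU/set0]_(j | j != w) confusion_set w j) (upd s iW v) =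
        (\big[setU/set0]_(j | j != w) confusion_set w j) s.
      apply: (big_ind (fun A : set (prodspace R slots) => A (upd s iW v) = A s)) => //.
        by move=> A1 A2 h1 h2; rewrite /setU /mkset h1 h2.
      by move=> j _; exact: ignores_confusion.
    by rewrite /setU /mkset e1 e2 e3.
  + move=> t et; apply: contrapT => nB; apply: et; apply: message_decodes.
    * by move=> h; apply: nB; left.
    * by move=> h; apply: nB; right; left.
    * move=> j jw h; apply: nB; right; right.
      by rewrite (bigD1 j)//=; left.
  + move=> w.
    have mC j : measurable (confusion_set w j) by exact: measurable_confusion_set.
    have mCU : measurable (\big[setU/set0]_(j | j != w) confusion_set w j).
      exact: bigsetU_measurable.
    have mA := measurable_atypical_set w; have mO := measurable_outage_set w.
    apply: (le_trans (measureU2 _ mO (measurableU _ _ mA mCU))).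
    apply: (@le_trans _ _ (eps2%:E + (b%:E + (M.-1%:R / xi)%:E))%E); last first.
      by rewrite -!EFinD lee_fin addrA.
    apply: leeD; first exact: outage_set_bound.
    apply: (le_trans (measureU2 _ mA mCU)); apply: leeD; first exact: atypical_set_bound.
    apply: (le_trans (measure_big_setU_le _ _ _)) => //.
    apply: (@le_trans _ _ (\sum_(j | j != w) (xi^-1)%:E)%E).
      by apply: lee_sum => j jw; exact: confusion_set_bound.
    have cE : #|(fun i : 'I_M => i != w)| = M.-1 by have := cardC1 w; rewrite card_ord.
    by rewrite sumEFin lee_fin sumr_const cE -[xi^-1 *+ _]mulr_natl.
Qed.

End model_on_product_space.

(** * Existence of models *)

Section independent_family.
Context {R : realType}.

(** Iterated binary products: each step multiplies the space by one more real line. For N = 0 any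
    space will do. *)
Lemma exists_independent_sequence (N : nat) (nu : nat -> probability R R) :
  exists (d : measure_display) (T : measurableType d) (Pr : probability T R)
    (X : nat -> {RV Pr >-> R}),
  forall B : nat -> set R, (forall k, measurable (B k)) ->
    Pr [set t | forall k, (k < N)%N -> B k (X k t)] = (\prod_(k < N) nu k (B k))%E.
Proof.
elim: N => [|N [d [T [Pr [X HX]]]]].
  exists _, R, (nu 0%N), (fun=> [the {mfun _ >-> _} of mfun_Sub (mem_set (@measurable_id _ R setT))]).
  move=> B mB; rewrite big_ord0 -(@probability_setT _ _ _ (nu 0%N)).
  by congr (nu 0%N _); apply/seteqP; split.
pose f k (p : T * R) : R := if (k < N)%N then X k p.1 else p.2.
have mf k : measurable_fun setT (f k).
  rewrite /f; case: (k < N)%N; last exact: measurable_snd.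
  exact: (measurableT_comp (measurable_funPT (X k)) measurable_fst).
pose Y k : {RV (Pr \x nu N)%E >-> R} := [the {mfun _ >-> _} of mfun_Sub (mem_set (mf k))].
exists _, (T * R)%type, [the probability _ R of (Pr \x nu N)%E], Y.
move=> B mB.
pose C := [set t | forall k, (k < N)%N -> B k (X k t)].
have mC : measurable C.
  rewrite (_ : C = \bigcap_(k in `I_N) (X k @^-1` B k)); last first.
    by apply/seteqP; split=> t h k kN; exact: h.
  apply: fin_bigcap_measurable; first exact: finite_II.
  by move=> k _; rewrite -[X in measurable X]setTI; exact: measurable_funPT.
rewrite big_ord_recr /= -HX// -(product_measure1E Pr (nu N) mC (mB N)).
congr (product_measure1 _ _ _); apply/seteqP; split=> -[t x] /=.
  move=> h; split; last by have := h N (ltnSn N); rewrite /f ltnn.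
  by move=> k kN; have := h k (ltnW kN); rewrite /f kN.
move=> [h hx] k; rewrite ltnS leq_eqVlt /f => /orP[/eqP ->|kN]; first by rewrite ltnn.
by rewrite kN; exact: h.
Qed.

Lemma exists_independent_family (I : finType) (nu : I -> probability R R) :
  exists (d : measure_display) (T : measurableType d) (Pr : probability T R)
    (X : I -> {RV Pr >-> R}),
  forall B : I -> set R, (forall i, measurable (B i)) ->
    Pr [set t | forall i, B i (X i t)] = (\prod_i nu i (B i))%E.
Proof.
have [i0 _|I0] := pickP I; last first.
  exists _, R, (gau 1), (fun=> [the {mfun _ >-> _} of mfun_Sub (mem_set (@measurable_id _ R setT))]).
  move=> B mB; rewrite big_pred0; last by move=> i; have := I0 i.
  rewrite -(@probability_setT _ _ _ (gau (1:R))).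
  by congr (gau 1 _); apply/seteqP; split=> // t _ i; have := I0 i.
pose sel (k : nat) : I := if insub k is Some j then enum_val (j : 'I_#|I|) else i0.
have selK (i : I) : sel (enum_rank i) = i by rewrite /sel valK enum_rankK.
have [d [T [Pr [X HX]]]] := exists_independent_sequence #|I| (fun k => nu (sel k)).
exists d, T, Pr, (fun i => X (enum_rank i)) => B mB.
have := HX (fun k => B (sel k)) (fun k => mB _).
have -> : [set t | forall k, (k < #|I|)%N -> B (sel k) (X k t)] =
    [set t | forall i, B i (X (enum_rank i) t)].
  apply/seteqP; split=> t /= h.
    by move=> i; have := h _ (ltn_ord (enum_rank i)); rewrite selK.
  move=> k kI; pose j := Ordinal kI.
  have -> : k = enum_rank (enum_val j) by rewrite enum_valK.
  by rewrite selK; exact: h.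
move=> ->; rewrite [RHS](reindex (fun j : 'I_#|I| => enum_val j)); last first.
  by apply: onW_bij; exact: enum_val_bij.
by apply: eq_bigr => j _; rewrite -[in RHS](selK (enum_val j)) enum_valK.
Qed.

(** A normalized sum of Dirac masses at 0, ..., M - 1, so that message and tie-break can be drawn as
    real variables and read off by [dec], which sends every other real to [ord0]. *)
Lemma exists_uniform_law (M : nat) : (0 < M)%N ->
  exists (nu : probability R R) (dec : R -> 'I_M),
  (forall D : set 'I_M, measurable (dec @^-1` D)) /\
  (forall j, nu (dec @^-1` [set j]) = (M%:R^-1)%:E).
Proof.
case: M => // M _.
pose dec (r : R) : 'I_M.+1 := if [pick j : 'I_M.+1 | r == (j : nat)%:R] is Some j then j else ord0.
have decK (j : 'I_M.+1) : dec (j : nat)%:R = j.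
  rewrite /dec; case: pickP => [k|/(_ j)]; last by rewrite eqxx.
  by rewrite eqr_nat => /eqP jk; exact/val_inj/esym.
pose nat_set := \bigcup_(j in [set: 'I_M.+1]) [set (j : nat)%:R : R].
have mnat (D : set 'I_M.+1) : measurable (\bigcup_(j in D) [set (j : nat)%:R : R]).
  by apply: fin_bigcup_measurable => //; exact: finite_finset.
have mdec (D : set 'I_M.+1) : measurable (dec @^-1` D).
  have decN r : ~ nat_set r -> dec r = ord0.
    move=> nr; rewrite /dec; case: pickP => // j /eqP rj; exfalso; apply: nr.
    by exists j.
  have [D0|D0] := pselect (D ord0).
    rewrite (_ : dec @^-1` D = (\bigcup_(j in D) [set (j : nat)%:R]) `|` ~` nat_set).
      by apply: measurableU => //; apply: measurableC; exact: mnat.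
    apply/seteqP; split=> r /=.
      move=> Dr; have [[j _ /= rj]|nr] := pselect (nat_set r); last by right.
      by left; exists j => //; move: Dr; rewrite rj decK.
    by move=> [[j Dj /= ->]|nr]; rewrite ?decK// decN.
  rewrite (_ : dec @^-1` D = (\bigcup_(j in D) [set (j : nat)%:R])); first exact: mnat.
  apply/seteqP; split=> r /=; last by move=> [j Dj /= ->]; rewrite decK.
  move=> Dr; have [[j _ /= rj]|nr] := pselect (nat_set r).
    by exists j => //; move: Dr; rewrite rj decK.
  by move: Dr; rewrite decN.
pose del (k : nat) : {measure set R -> \bar R} := dirac (k%:R : R).
pose ms : {measure set R -> \bar R} := msum del M.+1.
have msE A : measurable A -> ms A = (\sum_(k < M.+1) \d_(k%:R : R) A)%E by [].
have msT : ms setT = (M.+1%:R)%:E.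
  rewrite msE// (eq_bigr (fun=> 1%:E)); last by move=> k _; rewrite diracT.
  by rewrite sumEFin sumr_const card_ord.
(* [gau 1] is only the fallback of [mnormalize] for a null or infinite mass; here the mass is M. *)
exists [the probability R R of mnormalize ms (gau 1)], dec; split=> // j.
rewrite -[LHS]/(mnormalize ms (gau 1) _) /mnormalize msT /= eqe pnatr_eq0 /= msE//.
rewrite (bigD1 j)//= big1 ?adde0; last first.
  move=> k kj; rewrite diracE memNset//= decK; exact/eqP.
by rewrite diracE mem_set ?mul1e//= decK.
Qed.

End independent_family.

(** This keeps the guarantees, which are stated for every model, from being vacuous. *)
Lemma exists_st_model (R : realType) (dE : measure_display) (TE : measurableType dE)
    (mu : probability TE R) (E : {RV mu >-> R}) (n M : nat) (S : R) : (0 < M)%N ->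
  exists (d : measure_display) (T : measurableType d) (Pr : probability T R),
    inhabited (st_model E n M S Pr).
Proof.
move=> M0.
have [nuW [dec [mdec nuWE]]] := @exists_uniform_law R M M0.
pose nu (i : slots n M) : probability R R :=
  match i with
  | inl (inl (inl _)) => distribution mu E
  | inl (inl (inr _)) => gau (Num.sqrt S)
  | inl (inr _) => gau 1
  | inr _ => nuW
  end.
have [d [T [Pr [X HX]]]] := exists_independent_family nu.
exists d, T, Pr.
have lawX i A : measurable A -> Pr (X i @^-1` A) = nu i A.
  move=> mA; have := HX (fun j => if j == i then A else setT).
  rewrite (bigD1 i)//= eqxx big1 ?mule1; last first.
    by move=> j /negbTE ->; exact: probability_setT.
  move=> <-; last by move=> j; case: ifP.
  congr (Pr _); apply/seteqP; split=> t /=; last by move/(_ i); rewrite eqxx.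
  by move=> h j; case: eqP => [->|].
have unif (b : bool) : is_uniform Pr (fun t => dec (X (inr b) t)).
  split=> j; last first.
    rewrite -[LHS]/(Pr (X (inr b) @^-1` (dec @^-1` [set j]))) lawX//.
  rewrite -[X in measurable X]/(X (inr b) @^-1` (dec @^-1` [set j])).
  by rewrite -[X in measurable X]setTI; exact: measurable_funPT.
constructor.
refine (@StModel R dE TE mu E n M S d T Pr (fun k => X (ie n M k)) (fun w k => X (ix n w k))
  (fun k => X (iz n M k)) (fun t => dec (X (inr true) t)) (fun t => dec (X (inr false) t))
  _ _ _ (unif true) (unif false) _).
- move=> k kn A mA; rewrite -[LHS]/(Pr (X (ie n M k) @^-1` A)) lawX//.
  by rewrite /ie (insubT (fun k => k < n)%N kn).
- move=> w k kn A mA; rewrite -[LHS]/(Pr (X (ix n w k) @^-1` A)) lawX//.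
  by rewrite /ix (insubT (fun k => k < n)%N kn).
- move=> k kn A mA; rewrite -[LHS]/(Pr (X (iz n M k) @^-1` A)) lawX//.
  by rewrite /iz (insubT (fun k => k < n)%N kn) /gauss_law sqrtr1.
- move=> J A hA.
(* Independence is asked for any subfamily [J]; slots outside it get the full line, which
   contributes a factor 1. *)
have hC (i : slots n M) : exists C : set R, measurable C /\
    (i \in J -> A i = X i @^-1` C) /\ (i \notin J -> C = setT).
  have [iJ|iJ] := boolP (i \in J); last by exists setT.
  have := hA i iJ; case: i iJ => [[[k|[w k]]|k]|[]] iJ /=.
  - move=> [C mC <-]; exists C; split=> //; split=> // _.
    by rewrite setTI /ie valK.
  - move=> [C mC <-]; exists C; split=> //; split=> // _.
    by rewrite setTI /ix valK.
  - move=> [C mC <-]; exists C; split=> //; split=> // _.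
    by rewrite setTI /iz valK.
  - move=> [D _ <-]; exists (dec @^-1` D); split=> //; split=> // _.
    by rewrite setTI.
  - move=> [D _ <-]; exists (dec @^-1` D); split=> //; split=> // _.
    by rewrite setTI.
have {hC} [C hC] := choice hC.
transitivity (Pr [set t | forall i, C i (X i t)]).
  congr (Pr _); apply/seteqP; split=> t /= h i.
    have [_ [h1 h2]] := hC i; have [iJ|iJ] := boolP (i \in J); last by rewrite h2.
    by have := h i iJ; rewrite h1.
  by move=> iJ; have [_ [h1 _]] := hC i; rewrite h1//; exact: h.
rewrite HX; last by move=> i; case: (hC i).
rewrite (bigID (fun i => i \in J))/= [X in (_ * X)%E]big1 ?mule1; last first.
  by move=> i iJ; have [_ [_ ->]] := hC i; rewrite ?probability_setT.
apply: eq_bigr => i iJ; have [mC [h1 _]] := hC i.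
by rewrite h1// lawX.
Qed.

(** * Parameter estimates *)

Section exponential_inequalities.
Context {R : realType}.
Implicit Types x y : R.

Lemma expR_ge1Dx2 x : 0 <= x -> 1 + x + x ^+ 2 / 2 <= expR x.
Proof.
move=> x0.
pose f (t : R) : R := expR t - (1 + t + t ^+ 2 / 2).
pose df (t : R) : R := expR t - (1 + t).
have dfP (t : R) : t \in `]0, x[%R -> is_derive t 1 f (df t).
  move=> _; rewrite /f.
  apply: is_derive_eq; rewrite /df /GRing.scale/= ?mulr1 ?mul1r; lra.
have cf : {within `[0, x], continuous f}.
  apply: continuous_subspaceT => t.
  apply: differentiable_continuous; apply/derivable1_diffP.
  by rewrite /f.
have [c cx e] := MVT_segment x0 dfP cf.
have : 0 <= f x - f 0.
  by rewrite e subr0 mulr_ge0// /df subr_ge0 expR_ge1Dx.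
rewrite /f expR0 expr0n/= mul0r !addr0 subrr subr0 => h; lra.
Qed.

(** Multiplying by the lower bound for exp(x) gives (1 - x + x^2/2) (1 + x + x^2/2) = 1 + x^4/4,
    which is at least 1. *)
Lemma expRN_le1Bx2 x : 0 <= x -> expR (- x) <= 1 - x + x ^+ 2 / 2.
Proof.
move=> x0; have e := expR_ge1Dx2 x0.
have q0 : 0 <= 1 - x + x ^+ 2 / 2.
  have := sqr_ge0 (x - 1); rewrite sqrrB expr1n mulr1; nra.
rewrite expRN -[leLHS]mul1r ler_pdivrMr ?expR_gt0//.
apply: (le_trans _ (ler_wpM2l q0 e)).
have -> : (1 - x + x ^+ 2 / 2) * (1 + x + x ^+ 2 / 2) = 1 + x ^+ 4 / 4 by field.
by rewrite lerDl divr_ge0// exprn_even_ge0.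
Qed.

(** The exponent is the start of the series of -log(1 - y), with the cubic coefficient raised from
    1/3 to 1 to absorb the rest. It serves every lower bound on 1 - y below: square roots in
    Gaussian transforms and the capacity. *)
Lemma expRN_cubic_le y : 0 <= y -> y <= 1 / 3 ->
  expR (- (y + y ^+ 2 / 2 + y ^+ 3)) <= 1 - y.
Proof.
move=> y0 y1; set z := y + y ^+ 2 / 2 + y ^+ 3.
have z0 : 0 <= z by rewrite !addr_ge0 ?divr_ge0 ?exprn_ge0.
apply: (le_trans (expRN_le1Bx2 z0)).
have y2 : 0 <= y ^+ 2 by exact: sqr_ge0.
rewrite -subr_ge0.
have -> : 1 - y - (1 - z + z ^+ 2 / 2) =
    y ^+ 3 * (1 / 2 - 9 / 8 * y - y ^+ 2 / 2 - y ^+ 3 / 2) by rewrite /z; field.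
rewrite mulr_ge0 ?exprn_ge0//.
have h2 : y ^+ 2 <= 1 / 9 by rewrite expr2; nra.
have h3 : y ^+ 3 <= 1 / 27 by rewrite exprS; nra.
lra.
Qed.

End exponential_inequalities.

Section energy_transform.
Context {R : realType} {d : measure_display} {T : measurableType d}.
Variables (mu : probability T R) (E : {RV mu >-> R}) (P E2 lam : R).
Hypothesis E_ge0 : {ae mu, forall t, 0 <= E t}.
Hypothesis E_mean : 'E_mu[E]%E = P%:E.
Hypothesis E_moment2 : 'E_mu[fun t => (E t ^+ 2)%R]%E = E2%:E.
Lemma moment2_ge0 : 0 <= E2.
Proof.
rewrite -lee_fin -E_moment2 unlock integral_ge0// => t _.
by rewrite lee_fin sqr_ge0.
Qed.

Hypothesis lam0 : 0 <= lam.

Lemma energy_transform :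
  (\int[distribution mu E]_e (expR (- (lam * e)))%:E <=
    (expR (- lam * P + lam ^+ 2 * E2 / 2))%:E)%E.
Proof.
have mE : measurable_fun setT (E : T -> R) by exact: measurable_funPT.
have mexp : measurable_fun setT (fun e : R => (expR (- (lam * e)))%:E).
  apply/measurable_EFinP; apply: measurableT_comp => //.
  by apply: measurableT_comp => //; exact: measurable_funM.
have mf : measurable_fun setT (fun t => (expR (- (lam * E t)))%:E).
  exact: (measurableT_comp mexp mE).
have mg : measurable_fun setT (fun t => (lam * `|E t|)%:E).
  apply/measurable_EFinP; apply: measurable_funM => //.
  exact: (measurableT_comp (@normr_measurable _ _) mE).
have mh : measurable_fun setT (fun t => (lam ^+ 2 / 2 * E t ^+ 2)%:E).
  apply/measurable_EFinP; apply: measurable_funM => //.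
  exact: measurable_funX.
have f0 t : setT t -> (0 <= (expR (- (lam * E t)))%:E)%E.
  by rewrite lee_fin expR_ge0.
have g0 t : setT t -> (0 <= (lam * `|E t|)%:E)%E.
  by rewrite lee_fin mulr_ge0.
have h0 t : setT t -> (0 <= (lam ^+ 2 / 2 * E t ^+ 2)%:E)%E.
  by rewrite lee_fin mulr_ge0 ?sqr_ge0// divr_ge0 ?sqr_ge0.
have := E_mean; rewrite expectation_def => e1.
have := E_moment2; rewrite unlock => e2.
have ge : (\int[mu]_t (lam * `|E t|)%:E = (lam * P)%:E)%E.
  under eq_integral do rewrite EFinM.
  have mn : measurable_fun setT (fun t => `|E t|%:E).
    apply/measurable_EFinP.
    exact: (measurableT_comp (@normr_measurable _ _) mE).
  have n0 t : setT t -> (0 <= `|E t|%:E)%E by rewrite lee_fin.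
  have l0 : (0 <= lam%:E)%E by rewrite lee_fin.
  rewrite (ge0_integralZl mu measurableT mn n0 l0).
  rewrite [RHS]EFinM -e1; congr (_ * _)%E.
  apply: ae_eq_integral => //; first exact/measurable_EFinP.
  by apply: filterS E_ge0 => t t0 _; rewrite ger0_norm.
have he : (\int[mu]_t (lam ^+ 2 / 2 * E t ^+ 2)%:E = (lam ^+ 2 / 2 * E2)%:E)%E.
  under eq_integral do rewrite EFinM.
  have mn : measurable_fun setT (fun t => (E t ^+ 2)%:E).
    by apply/measurable_EFinP; exact: measurable_funX.
  have n0 t : setT t -> (0 <= (E t ^+ 2)%:E)%E by rewrite lee_fin sqr_ge0.
  have l0 : (0 <= (lam ^+ 2 / 2)%:E)%E by rewrite lee_fin divr_ge0 ?sqr_ge0.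
  by rewrite (ge0_integralZl mu measurableT mn n0 l0) [RHS]EFinM -e2.
rewrite ge0_integral_distribution//.
set I := (X in (X <= _)%E).
(* The inequality exp(-x) <= 1 - x + x^2/2 is integrated with x moved to the left, so that all
   integrands are nonnegative; the absolute value in the linear term serves the same purpose. *)
have key : (I + (lam * P)%:E <= 1 + (lam ^+ 2 / 2 * E2)%:E)%E.
  rewrite -ge -he -(@integral_prob_cst _ _ _ mu 1%E) -!ge0_integralD//.
  apply: ae_ge0_le_integral => //.
  - by move=> t tT; apply: adde_ge0; [exact: f0|exact: g0].
  - exact: emeasurable_funD.
  - by move=> t tT; apply: adde_ge0 => //; exact: h0.
  - exact: emeasurable_funD.
  apply: filterS E_ge0 => t t0 _; rewrite -!EFinD lee_fin ger0_norm//=.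
  have := expRN_le1Bx2 (mulr_ge0 lam0 t0); rewrite exprMn; lra.
have le1 : (I <= (1 + lam ^+ 2 / 2 * E2 - lam * P)%:E)%E.
  by rewrite EFinB leeBrDr.
apply: (le_trans le1); rewrite lee_fin.
apply: (le_trans _ (expR_ge1Dx _)); lra.
Qed.

End energy_transform.

(** * Tilting exponent and saving length *)

Section backoff_parameters.
Context {R : realType}.
Variables (P E2 l r S al be : R) (m : nat).
Hypotheses (P0 : 0 < P) (E20 : 0 <= E2) (l0 : 0 < l).
Hypotheses (r0 : 0 < r) (r_small : r <= 1 / 64) (rE2 : r * E2 <= P ^+ 2 / 5).
Hypothesis SE : S = (1 - r) * P.
Hypothesis al_def : al = 2 * r * P / (E2 + 3 * S ^+ 2).
Hypothesis be_def : be = al / (1 + 63 * al * S).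
Hypothesis m_def : m = `|Num.ceil (l / (P * be + al ^+ 2 * E2 / 2))|%N.

(* Slightly larger than alpha: large enough for tilted_energy_pow to absorb the
   second order terms, small enough for tilt_balance. *)
Definition tilt : R := 2 * r * P / (E2 + 5 / 2 * S ^+ 2).
Definition tilted_energy : R := expR (- tilt * P + tilt ^+ 2 * E2 / 2).

Lemma st_power_gt0 : 0 < S.
Proof. by rewrite SE mulr_gt0// subr_gt0 (le_lt_trans r_small)//; lra. Qed.

Lemma st_power_ge : 63 / 64 * P <= S.
Proof. by rewrite SE ler_wpM2r// ?(ltW P0)//; have := r_small; lra. Qed.

Lemma st_power_lt : S < P.
Proof. by rewrite SE gtr_pMl// ltrBlDr ltrDl. Qed.

Lemma st_power2_gt0 : 0 < S ^+ 2.
Proof. by rewrite exprn_gt0// st_power_gt0. Qed.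

Lemma st_power2_ge : 24 / 25 * P ^+ 2 <= S ^+ 2.
Proof.
have h : (63 / 64 * P) ^+ 2 <= S ^+ 2.
  by rewrite ler_pXn2r ?nnegrE ?(ltW st_power_gt0)// ?st_power_ge// mulr_ge0// ltW.
apply: (le_trans _ h); rewrite exprMn ler_wpM2r ?sqr_ge0//; lra.
Qed.

Lemma st_power2_le : S ^+ 2 <= P ^+ 2.
Proof. by rewrite ler_pXn2r ?nnegrE ?ltW ?st_power_gt0 ?st_power_lt. Qed.

Lemma tilt_den_gt0 : 0 < E2 + 5 / 2 * S ^+ 2.
Proof. by have := st_power2_gt0; have := E20; lra. Qed.

Lemma alpha_den_gt0 : 0 < E2 + 3 * S ^+ 2.
Proof. by have := st_power2_gt0; have := E20; lra. Qed.

Lemma tilt_gt0 : 0 < tilt.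
Proof. by rewrite /tilt divr_gt0 ?tilt_den_gt0 ?alpha_den_gt0// !mulr_gt0. Qed.

Lemma tiltE : tilt * (E2 + 5 / 2 * S ^+ 2) = 2 * r * P.
Proof. by rewrite ?al_def /tilt divfK// gt_eqF ?tilt_den_gt0 ?alpha_den_gt0. Qed.

Lemma tilt_power_le : tilt * S <= 1 / 32.
Proof.
have t0 := tilt_gt0.
have h : tilt * (5 / 2 * S ^+ 2) <= 2 * r * P.
  by rewrite -tiltE ler_pM2l// lerDr E20.
have S0 := st_power_gt0; have Sg := st_power_ge.
rewrite -(ler_pM2r S0) -mulrA -expr2.
have rP : r * P <= 1 / 64 * P by rewrite ler_pM2r.
lra.
Qed.

Lemma tilt_small : 2 * tilt * S < 1.
Proof. by have := tilt_power_le; lra. Qed.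

(** Squaring and applying [expRN_cubic_le] at y = 2 tilt S, then using P - S = r P, leaves tilt (E2
    + 2 S^2 + 8 tilt S^3) <= 2 r P. The right side is tilt (E2 + 5/2 S^2), and the spare S^2/2
    covers 8 tilt S^3 because tilt S <= 1/32. *)
Lemma tilt_balance : (Num.sqrt (1 - 2 * tilt * S))^-1 * tilted_energy <= 1.
Proof.
have t0 := tilt_gt0.
set y := 2 * tilt * S.
have y0 : 0 < y by apply: mulr_gt0; [exact: mulr_gt0|exact: st_power_gt0].
have ty : tilt * S = y / 2 by rewrite /y; field.
have y1 : y <= 1 / 16 by rewrite /y; have := tilt_power_le; lra.
have q0 : 0 < Num.sqrt (1 - y) by rewrite sqrtr_gt0; lra.
rewrite mulrC ler_pdivrMr// mul1r.
have e0 : 0 <= tilted_energy by rewrite expR_ge0.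
rewrite -(@ler_pXn2r _ 2) ?nnegrE ?(ltW q0)//.
rewrite sqr_sqrtr; last lra.
apply: le_trans (expRN_cubic_le (ltW y0) _); last lra.
rewrite /tilted_energy -expRM_natl ler_expR.
rewrite -subr_ge0.
have -> : - (y + y ^+ 2 / 2 + y ^+ 3) - 2%:R * (- tilt * P + tilt ^+ 2 * E2 / 2) =
  tilt * (2 * r * P - tilt * (E2 + 2 * S ^+ 2 + 8 * tilt * S ^+ 3)).
  have -> : - (y + y ^+ 2 / 2 + y ^+ 3) - 2%:R * (- tilt * P + tilt ^+ 2 * E2 / 2) =
    tilt * (2 * (P - S) - tilt * (E2 + 2 * S ^+ 2 + 8 * tilt * S ^+ 3)).
    by rewrite /y; field.
  by congr (_ * (_ - _)); rewrite SE; ring.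
rewrite mulr_ge0 ?(ltW t0)// -tiltE -mulrBr mulr_ge0 ?(ltW t0)//.
have -> : E2 + 5 / 2 * S ^+ 2 - (E2 + 2 * S ^+ 2 + 8 * tilt * S ^+ 3) =
   S ^+ 2 * (1 / 2 - 8 * (tilt * S)) by field.
by rewrite mulr_ge0 ?(ltW st_power2_gt0)//; have := tilt_power_le; lra.
Qed.

Lemma alpha_gt0 : 0 < al.
Proof. by rewrite al_def divr_gt0 ?tilt_den_gt0 ?alpha_den_gt0// !mulr_gt0. Qed.

Lemma alphaE : al * (E2 + 3 * S ^+ 2) = 2 * r * P.
Proof. by rewrite ?al_def /tilt divfK// gt_eqF ?tilt_den_gt0 ?alpha_den_gt0. Qed.

Lemma alpha_le : al <= r / P.
Proof.
rewrite ler_pdivlMr// -(ler_pM2r alpha_den_gt0) mulrAC alphaE.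
have -> : 2 * r * P * P = r * (2 * P ^+ 2) by ring.
by rewrite ler_wpM2l ?(ltW r0)//; have := st_power2_ge; have := E20; have := sqr_ge0 P; lra.
Qed.

Lemma beta_den_gt0 : 0 < 1 + 63 * al * S.
Proof. by rewrite addr_gt0// !mulr_gt0 ?alpha_gt0 ?st_power_gt0. Qed.

Lemma beta_gt0 : 0 < be.
Proof. by rewrite be_def divr_gt0 ?alpha_gt0 ?beta_den_gt0. Qed.

Lemma beta_le : be <= al.
Proof.
have a0 := alpha_gt0; have d0 := beta_den_gt0.
have S0 := st_power_gt0.
rewrite be_def ler_pdivrMr// mulrDr mulr1 lerDl.
by rewrite !mulr_ge0// ltW.
Qed.

Lemma saving_den_gt0 : 0 < P * be + al ^+ 2 * E2 / 2.
Proof.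
by rewrite ltr_wpDr ?mulr_gt0 ?beta_gt0// divr_ge0// mulr_ge0// sqr_ge0.
Qed.

Lemma saving_lengthE : m%:R = (Num.ceil (l / (P * be + al ^+ 2 * E2 / 2)))%:~R :> R.
Proof.
have a0 := saving_den_gt0.
rewrite m_def natr_absz ger0_norm//.
by rewrite -(ler_int R) (le_trans _ (ceil_ge _))// divr_ge0 ?ltW.
Qed.

Lemma saving_length_ge : l / (P * be + al ^+ 2 * E2 / 2) <= m%:R.
Proof. by rewrite saving_lengthE ceil_ge. Qed.

(** The difference tilt - al equals tilt S^2 / (2 (E2 + 3 S^2)), of first order in r, while the left
    side is of second order; [rE2] says that r is small enough for the comparison. *)
Lemma tilt_gap : tilt ^+ 2 * E2 <= P * (tilt - al).
Proof.
have t0 := tilt_gt0.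
have e : (tilt - al) * (E2 + 3 * S ^+ 2) = tilt * S ^+ 2 / 2.
  by rewrite mulrBl alphaE -tiltE; field.
have S0 := st_power2_gt0; have Sg := st_power2_ge.
have F0 := tilt_den_gt0; have G0 := alpha_den_gt0.
rewrite -(ler_pM2r G0) -[leRHS]mulrA e -(ler_pM2r F0).
have -> : tilt ^+ 2 * E2 * (E2 + 3 * S ^+ 2) * (E2 + 5 / 2 * S ^+ 2) =
   (tilt * (E2 + 5 / 2 * S ^+ 2)) * (tilt * E2 * (E2 + 3 * S ^+ 2)) by ring.
rewrite tiltE.
have -> : 2 * r * P * (tilt * E2 * (E2 + 3 * S ^+ 2)) =
   (tilt * P) * (2 * (r * E2) * (E2 + 3 * S ^+ 2)) by ring.
have -> : P * (tilt * S ^+ 2 / 2) * (E2 + 5 / 2 * S ^+ 2) =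
   (tilt * P) * (S ^+ 2 / 2 * (E2 + 5 / 2 * S ^+ 2)) by ring.
have tP : 0 < tilt * P by exact: mulr_gt0.
rewrite ler_pM2l//.
have h : 2 * (r * E2) * (E2 + 3 * S ^+ 2) <= 2 / 5 * P ^+ 2 * (E2 + 3 * S ^+ 2).
  by rewrite ler_pM2r//; have := rE2; lra.
apply: (le_trans h).
have h2 : 2 / 5 * P ^+ 2 <= 5 / 12 * S ^+ 2 by lra.
have h3 : 2 / 5 * P ^+ 2 * (E2 + 3 * S ^+ 2) <= 5 / 12 * S ^+ 2 * (E2 + 3 * S ^+ 2).
  by rewrite ler_pM2r.
apply: (le_trans h3).
have -> : 5 / 12 * S ^+ 2 * (E2 + 3 * S ^+ 2) = S ^+ 2 / 2 * (5 / 6 * E2 + 5 / 2 * S ^+ 2).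
  by field.
by rewrite ler_pM2l ?divr_gt0//; have := E20; lra.
Qed.

(** By [tilt_gap], tilt P - tilt^2 E2/2 is at least al P + tilt^2 E2/2, hence at least the
    denominator P be + al^2 E2/2 in the definition of m, as be <= al <= tilt. *)
Lemma tilted_energy_pow : tilted_energy ^+ m <= expR (- l).
Proof.
have a0 := alpha_gt0; have ra0 := saving_den_gt0; have mg := saving_length_ge.
rewrite /tilted_energy -expRM_natl ler_expR -lerN2 opprK.
have h : l <= m%:R * (P * be + al ^+ 2 * E2 / 2) by rewrite -ler_pdivrMr.
apply: (le_trans h); rewrite -mulrN ler_wpM2l//.
have g := tilt_gap.
have Pb : P * be <= P * al by rewrite ler_pM2l// beta_le.
have t0 := tilt_gt0.
have at_ : al <= tilt.
  have : 0 <= P * (tilt - al) by apply: (le_trans _ g); rewrite mulr_ge0 ?sqr_ge0.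
  by rewrite pmulr_rge0// subr_ge0.
have a2 : al ^+ 2 * E2 <= tilt ^+ 2 * E2.
  by rewrite ler_wpM2r// ler_pXn2r ?nnegrE ?(ltW a0) ?(ltW t0).
by move: g; rewrite mulrBr; lra.
Qed.

(** Since l / (P be) = l / (P al) + 63 l S / P, passing from al to be lengthens the saving phase by
    a bounded amount only; the leading term is l / (P al). *)
Lemma saving_le : m%:R <= 1 + 63 * l + l * (E2 + 3 * P ^+ 2) / (2 * P ^+ 2) / r.
Proof.
have a0 := alpha_gt0; have ra0 := saving_den_gt0; have b0 := beta_gt0; have S0 := st_power_gt0.
have d0 := beta_den_gt0; have G0 := alpha_den_gt0; have S1 := ltW st_power_lt.
rewrite saving_lengthE.
have c1 : (Num.ceil (l / (P * be + al ^+ 2 * E2 / 2)))%:~R <=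
  l / (P * be + al ^+ 2 * E2 / 2) + 1 :> R.
  have := @ceilB1_lt R (l / (P * be + al ^+ 2 * E2 / 2)).
  by rewrite intrB ltrBlDr => /ltW.
apply: (le_trans c1).
have c2 : l / (P * be + al ^+ 2 * E2 / 2) <= l / (P * be).
  rewrite ler_pM2l// lef_pV2 ?posrE// ?mulr_gt0// lerDl.
  by rewrite divr_ge0// mulr_ge0// sqr_ge0.
have c3 : l / (P * be) = l * (E2 + 3 * S ^+ 2) / (2 * P ^+ 2) / r + 63 * l * (S / P).
  have -> : l / (P * be) = l / P / al + 63 * l * (S / P).
    by rewrite be_def; field; rewrite !gt_eqF.
  congr (_ + _); rewrite al_def; field.
  by rewrite !gt_eqF.
have c4 : S / P <= 1 by rewrite ler_pdivrMr// mul1r.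
have c5 : l * (E2 + 3 * S ^+ 2) / (2 * P ^+ 2) / r <= l * (E2 + 3 * P ^+ 2) / (2 * P ^+ 2) / r.
  rewrite ler_pM2r ?invr_gt0// ler_pM2r ?invr_gt0 ?mulr_gt0 ?exprn_gt0//.
  by rewrite ler_pM2l// lerD2l ler_pM2l// st_power2_le.
have c6 : 63 * l * (S / P) <= 63 * l by rewrite ler_piMr// ?mulr_ge0// ltW.
by move: c2; rewrite c3; lra.
Qed.

Lemma saving_ge : l / 2 / r <= m%:R.
Proof.
have a0 := alpha_gt0; have ra0 := saving_den_gt0.
apply: (le_trans _ saving_length_ge); rewrite -mulrA -invfM ler_pM2l// lef_pV2 ?posrE ?mulr_gt0//.
have h1 : P * be <= r.
  apply: (@le_trans _ _ (P * al)); first by rewrite ler_pM2l// beta_le.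
  by rewrite mulrC -ler_pdivlMr// alpha_le.
have h2 : al ^+ 2 * E2 <= r / P * (r / P) * E2.
  rewrite ler_wpM2r// expr2.
  by apply: ler_pM; rewrite ?alpha_le// ltW.
have h3 : r / P * (r / P) * E2 <= r / 5.
  have -> : r / P * (r / P) * E2 = r * (r * E2) / P ^+ 2 by field; rewrite gt_eqF.
  rewrite ler_pdivrMr ?exprn_gt0//.
  have -> : r / 5 * P ^+ 2 = r * (P ^+ 2 / 5) by ring.
  by rewrite ler_pM2l.
by lra.
Qed.

End backoff_parameters.

Section threshold_choice.
Context {R : realType}.

(** The logarithm of (1 - 2 l)^(-1/2) is l + l^2 + ..., and a second l^2 absorbs the higher terms;
    1/6 is what [expRN_cubic_le] allows at y = 2 l. *)
Lemma gau_mgf_sq_le (l : R) : 0 <= l -> l <= 1 / 6 ->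
  (\int[gau 1]_x (expR (l * x ^+ 2))%:E <= (expR (l + 2 * l ^+ 2))%:E)%E.
Proof.
move=> l0 l1; rewrite gau_mgf_sq// expr1n mulr1; last lra.
have q0 : 0 < Num.sqrt (1 - 2 * l) by rewrite sqrtr_gt0; lra.
rewrite lee_fin -[leLHS]mul1r ler_pdivrMr// -ler_pdivrMl ?expR_gt0// mulr1.
rewrite -expRN -(@ler_pXn2r _ 2) ?nnegrE ?(ltW q0) ?expR_ge0//.
rewrite sqr_sqrtr; last lra.
have l20 : 0 <= 2 * l by lra.
apply: le_trans (expRN_cubic_le l20 _); last lra.
rewrite -expRM_natl ler_expR -subr_ge0.
have -> : - (2 * l + (2 * l) ^+ 2 / 2 + (2 * l) ^+ 3) - 2%:R * - (l + 2 * l ^+ 2) =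
  l ^+ 2 * (2 - 8 * l) by field.
by rewrite mulr_ge0 ?sqr_ge0//; lra.
Qed.

(** On the unit interval ending at the negative quantile q, |x| is at most 1 - q, so [Phi] has slope
    at least the density c there, and K = b / c suffices. *)
Lemma PhiInv_backoff (p b : R) : 0 < p -> p < 1 / 2 -> 0 < b ->
  exists2 K : R, 0 < K & forall t : R, 0 < t -> K * t <= 1 ->
    Phi (PhiInv p - K * t) <= p - b * t.
Proof.
move=> p0 p1 b0; have [Pq q0] := PhiInvK p0 p1.
set q := PhiInv p in Pq q0 *.
set c : R := normal_pdf 0 1 (1 - q).
have c0 : 0 < c.
  by rewrite /c normal_pdf_pos// divr1 mulr_gt0 ?expR_gt0 ?normal_peak1_gt0.
exists (b / c) => [|t t0 Kt]; first by rewrite divr_gt0.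
have Kt0 : 0 < b / c * t by rewrite mulr_gt0// divr_gt0.
have h1 : q - b / c * t <= q by lra.
have h2 x : q - b / c * t < x <= q -> `|x| <= 1 - q.
  by case/andP => x1 x2; rewrite ler_norml; lra.
have := Phi_diff_ge h1 h2; rewrite -/c Pq.
have -> : c * (q - (q - b / c * t)) = b * t by field; rewrite gt_eqF.
lra.
Qed.

Lemma ln_le_2sqrt (x : R) : 0 < x -> ln x <= 2 * Num.sqrt x.
Proof.
move=> x0; have w0 : 0 < Num.sqrt x by rewrite sqrtr_gt0.
have {1}-> : x = Num.sqrt x ^+ 2 by rewrite sqr_sqrtr// ltW.
rewrite lnXn// -[_ *+ 2]mulr_natl ler_pM2l//.
exact/ltW/ln_sublinear.
Qed.

Lemma sdev_le (S P : R) : 0 < S -> S <= P -> sdev S <= sdev P.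
Proof.
move=> S0 SP; have P0 := lt_le_trans S0 SP.
rewrite /sdev.
have S1 : 0 <= S + 1 by lra.
have P1 : 0 <= P + 1 by lra.
rewrite -(sqrtrV S1) -(sqrtrV P1) -(sqrtrM _ (ltW S0)) -(sqrtrM _ (ltW P0)).
rewrite ler_sqrt; last by rewrite divr_ge0// ltW.
rewrite ler_pdivrMr ?addr_gt0// mulrAC ler_pdivlMr ?addr_gt0//; nra.
Qed.

(** Here 1 + (1 - r) P = (1 + P) (1 - y), and -log(1 - y) is at most y + y^2. *)
Lemma capac_ge (P r y : R) : 0 < P -> 0 <= r -> r <= 1 / 3 ->
  y = r * P / (1 + P) ->
  2^-1 * ln (1 + P) - (y + y ^+ 2) / 2 <= capac ((1 - r) * P).
Proof.
move=> P0 r0 r1 yE; rewrite /capac.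
have P1 : 0 < 1 + P by rewrite addr_gt0.
have y0 : 0 <= y by rewrite yE divr_ge0 ?mulr_ge0// ltW.
have y1 : y <= 1 / 3.
  rewrite yE ler_pdivrMr//; have := ler_wpM2r (ltW P0) r1; lra.
have -> : 1 + (1 - r) * P = (1 + P) * (1 - y) by rewrite yE; field; rewrite gt_eqF.
rewrite lnM ?posrE//; last lra.
rewrite mulrDr lerD2l.
have h : - (y + y ^+ 2) <= ln (1 - y).
  rewrite -ler_expR lnK ?posrE; last lra.
  apply: le_trans (expRN_cubic_le y0 y1); rewrite ler_expR lerN2.
  have -> : y ^+ 3 = y * y ^+ 2 by rewrite exprS.
  have := ler_wpM2r (sqr_ge0 y) y1; have := sqr_ge0 y; lra.
lra.
Qed.

Lemma capac_le (S P : R) : 0 < S -> S <= P -> capac S <= capac P.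
Proof.
move=> S0 SP; rewrite ler_pM2l ?invr_gt0// ler_ln ?posrE; lra.
Qed.

End threshold_choice.

(** * The code at a fixed blocklength *)

Section code_at_blocklength.
Context {R : realType} {dE : measure_display} {TE : measurableType dE}.
Variables (mu : probability TE R) (E : {RV mu >-> R}).
Variables (n m : nat) (S lam theta eps1 eps2 K : R).
Local Notation N := (n - m)%N.
Let s : R := Num.sqrt n%:R.
Let w : R := Num.sqrt s.
Let q : R := PhiInv eps1.

(* The slack w^-1 = n^(-1/4) makes the chi-square tail negligible at a cost of
   order n^(1/4) in the threshold, and the shift K / s of the quantile absorbs
   all error terms of order 1 / s. *)
Definition radius : R := N%:R * (1 + w^-1).
Definition threshold : R :=
  expR (N%:R * capac S + sdev S * Num.sqrt radius * (q - K * s^-1)).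
(** M - 1 <= threshold / s bounds the wrong-codeword term by 1 / s, and M > threshold / s serves the
    rate. *)
Definition num_messages : nat := (Num.truncn (threshold / s)).+1.

Hypotheses (S0 : 0 < S) (E_ge0 : {ae mu, forall t, 0 <= E t}).
Hypotheses (mn : (m <= n)%N) (lam0 : 0 <= lam) (theta0 : 0 <= theta).
Hypothesis theta_E :
  (\int[distribution mu E]_e (expR (- (lam * e)))%:E <= theta%:E)%E.
Hypothesis theta_X :
  (\int[gau (Num.sqrt S)]_x (expR (lam * x ^+ 2))%:E * theta%:E <= 1)%E.
Hypothesis theta_m : theta ^+ m <= eps2.
Hypotheses (q0 : q < 0) (K0 : 0 < K) (w2 : 2 <= w) (half : n%:R <= 2 * N%:R :> R).
Hypothesis Phi_q : Phi (q - K * s^-1) <= eps1 - 17 * s^-1.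

Lemma sqrt_sqrtE : s = w ^+ 2.
Proof. by rewrite /w sqr_sqrtr// sqrtr_ge0. Qed.

Lemma sqrt_ge4 : 4 <= s.
Proof. by rewrite sqrt_sqrtE expr2; have := w2; nra. Qed.

Lemma sqr_sqrtE : n%:R = s ^+ 2.
Proof. by rewrite /s sqr_sqrtr. Qed.

Lemma transmission_gt0 : 0 < N%:R :> R.
Proof.
have := half; rewrite sqr_sqrtE => h; have := sqrt_ge4 => s4.
have : 0 < s ^+ 2 by rewrite exprn_gt0//; lra.
lra.
Qed.

Lemma radius_gt0 : 0 < radius.
Proof.
by rewrite mulr_gt0 ?transmission_gt0// addr_gt0// invr_gt0; have := w2; lra.
Qed.

(** Chernoff with parameter t: the exponent N (2 t^2 - t / w) is least at t = 1 / (4 w), where it is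
    -N / (8 s), hence at most -s / 16; then exp(-x) <= 1 / x. *)
Lemma radius_tail :
  expR (w^-1 / 4 + 2 * (w^-1 / 4) ^+ 2) ^+ N * expR (- (w^-1 / 4 * radius))
    <= 16 * s^-1.
Proof.
have w0 : 0 < w by have := w2; lra.
have s0 : 0 < s by have := sqrt_ge4; lra.
rewrite -expRM_natl -expRD /radius.
have -> : N%:R * (w^-1 / 4 + 2 * (w^-1 / 4) ^+ 2) - w^-1 / 4 * (N%:R * (1 + w^-1))
  = - (N%:R * w ^- 2 / 8) by field; rewrite gt_eqF.
rewrite -sqrt_sqrtE.
have h : s / 16 <= N%:R * s^-1 / 8.
  rewrite mulrAC ler_pdivlMr// mulrAC -expr2 -sqr_sqrtE; have := half; lra.
rewrite expRN -[leRHS]invrK lef_pV2 ?posrE ?expR_gt0 ?invr_gt0 ?mulr_gt0 ?invr_gt0//.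
rewrite invfM invrK.
apply: (le_trans _ (expR_ge1Dx _)); lra.
Qed.

Lemma code_at_blocklength (d : measure_display) (T : measurableType d)
    (Pr : probability T R) (c : st_model E n num_messages S Pr) :
  is_st_code m threshold (eps1 + eps2) c.
Proof.
have w0 : 0 < w by have := w2; lra.
have s0 : 0 < s by have := sqrt_ge4; lra.
have r0 := radius_gt0.
have sd0 := sdev_gt0 S0.
have rt0 : 0 < Num.sqrt radius by rewrite sqrtr_gt0.
have wi : w^-1 <= 1 / 2.
  by rewrite div1r lef_pV2// posrE.
have wi0 : 0 < w^-1 by rewrite invr_gt0.
have qK : q - K * s^-1 < 0.
  by have : 0 < K * s^-1 by [rewrite mulr_gt0// invr_gt0]; have := q0; lra.
have lnE : ln threshold - N%:R * capac S = sdev S * Num.sqrt radius * (q - K * s^-1).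
  by rewrite /threshold expRK addrAC subrr add0r.
have th0 : 0 < threshold by rewrite expR_gt0.
apply: (@st_code_correct _ _ _ _ E _ _ _ _ _ _ c S0 m threshold E_ge0 lam theta
  radius (w^-1 / 4) (expR (w^-1 / 4 + 2 * (w^-1 / 4) ^+ 2)) (eps1 - s^-1) eps2) => //.
- by rewrite divr_ge0// ltW.
- by apply: gau_mgf_sq_le; lra.
- by rewrite lnE nmulr_llt0// mulr_gt0.
(* Of the reserve 17 / s, the chi-square tail takes 16 / s and the wrong codewords the last 1 /
   s. *)
- rewrite lnE mulrC mulKf; last by rewrite gt_eqF// mulr_gt0.
  have := radius_tail; have := Phi_q; lra.
have : (Num.truncn (threshold / s))%:R / threshold <= s^-1.
  have ts : 0 <= threshold / s by rewrite divr_ge0 ?ltW.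
  by rewrite ler_pdivrMr// [leRHS]mulrC truncn_le.
rewrite /num_messages /=; lra.
Qed.

(** The factor q - K / s is negative, so its multiplier is bounded above: [sdev] increases with the
    power and the root of [radius] is at most s + w. Dividing the threshold by s costs log s <= 2
    w. *)
Lemma ln_num_messages (P : R) : S <= P ->
  N%:R * capac S + sdev P * (s + w) * q - 2 * sdev P * K - 2 * w
    <= ln (num_messages%:R : R).
Proof.
move=> SP.
have w0 : 0 < w by have := w2; lra.
have s0 : 0 < s by have := sqrt_ge4; lra.
have th0 : 0 < threshold by rewrite expR_gt0.
have P0 := lt_le_trans S0 SP.
have wi : w^-1 <= 1 / 2.
  by rewrite div1r lef_pV2// posrE.
have wi0 : 0 < w^-1 by rewrite invr_gt0.
have Ks : 0 < K * s^-1 by rewrite mulr_gt0// invr_gt0.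
have h : ln (threshold / s) <= ln (num_messages%:R : R).
  rewrite ler_ln ?posrE ?divr_gt0// ?ltr0n//.
  by apply: ltW; exact: truncnS_gt.
apply: (le_trans _ h).
rewrite ln_div ?posrE// expRK.
have hs := ln_le_2sqrt s0; rewrite -/w in hs.
have sw : s * w^-1 = w by rewrite sqrt_sqrtE expr2 mulfK// gt_eqF.
have hr : sdev S * Num.sqrt radius <= sdev P * (s + w).
  apply: ler_pM; rewrite ?sqrtr_ge0 ?(ltW (sdev_gt0 S0)) ?sdev_le//.
  have Nn : N%:R <= n%:R :> R by rewrite ler_nat leq_subr.
  have -> : s + w = s * (1 + w^-1) by rewrite mulrDr mulr1 sw.
  rewrite -(@ler_pXn2r _ 2) ?nnegrE ?sqrtr_ge0//; last first.
    by rewrite mulr_ge0 ?addr_ge0// ltW.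
  rewrite sqr_sqrtr ?(ltW radius_gt0)// exprMn -sqr_sqrtE /radius.
  apply: ler_pM => //; first by rewrite addr_ge0// ltW.
  rewrite expr2 ler_pMr; lra.
have q1 := q0.
have h2 : sdev P * (s + w) * (q - K * s^-1) <= sdev S * Num.sqrt radius * (q - K * s^-1).
  by rewrite ler_wnM2r//; lra.
have e : sdev P * (s + w) * (q - K * s^-1) = sdev P * (s + w) * q -
    sdev P * K * (1 + w^-1).
  have e0 : (s + w) * s^-1 = 1 + w^-1.
    by rewrite mulrDl divff ?gt_eqF// -{1}sw mulrAC divff ?gt_eqF// mul1r.
  by rewrite -e0; ring.
have h3 : sdev P * K * (1 + w^-1) <= sdev P * K * 2.
  have sK : 0 < sdev P * K by apply: mulr_gt0 => //; exact: sdev_gt0.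
  by rewrite ler_pM2l//; lra.
lra.
Qed.

End code_at_blocklength.

(** * Orders of magnitude as n grows *)

Section asymptotics.
Context {R : realType}.
Variables (P E2 eps2 : R).
Local Notation F := (E2 + 3 * P ^+ 2).
Local Notation L := (ln (1 + P)).
Local Notation l := (ln (1 / eps2)).

(** This and the next two are the coefficients of n^(-1/2) in rho, of n^(-1/2) in the rate loss, and
    of n^(1/2) in the saving length. *)
Definition rho_coef : R :=
  Num.sqrt ((P + 1) * F * L * l) / (P * Num.sqrt (2 * P)).
Definition loss_coef : R := Num.sqrt (F * L * l / (2 * P * (P + 1))).
Definition saving_coef : R := l * F / (2 * P ^+ 2) / rho_coef.

Hypotheses (P0 : 0 < P) (E20 : 0 <= E2) (eps20 : 0 < eps2) (eps21 : eps2 < 1).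

Lemma moments_gt0 : 0 < F.
Proof. by have := exprn_gt0 2 P0; have := E20; lra. Qed.

Lemma ln_power_gt0 : 0 < L.
Proof. by rewrite ln_gt0// ltrDl. Qed.

Lemma ln_eps_gt0 : 0 < l.
Proof. by rewrite ln_gt0// div1r invf_gt1. Qed.

Lemma power1_gt0 : 0 < P + 1.
Proof. by rewrite addr_gt0. Qed.

Lemma rho_coef_gt0 : 0 < rho_coef.
Proof.
by rewrite divr_gt0 ?sqrtr_gt0 ?mulr_gt0 ?sqrtr_gt0 ?moments_gt0
  ?ln_power_gt0 ?ln_eps_gt0 ?power1_gt0 ?mulr_gt0.
Qed.

Lemma loss_coef_gt0 : 0 < loss_coef.
Proof. by rewrite sqrtr_gt0 divr_gt0 ?mulr_gt0 ?moments_gt0 ?ln_power_gt0 ?ln_eps_gt0 ?power1_gt0. Qed.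

Lemma loss_coef2 : loss_coef ^+ 2 = F * L * l / (2 * P * (P + 1)).
Proof.
by rewrite sqr_sqrtr// ltW// divr_gt0 ?mulr_gt0 ?moments_gt0 ?ln_power_gt0 ?ln_eps_gt0 ?power1_gt0.
Qed.

(** With [saving_lossE] this expresses the balance behind rho: reduced power and silent slots each
    cost loss_coef / (2 sqrt n) of rate to first order. *)
Lemma rho_lossE : rho_coef * P / (1 + P) = loss_coef.
Proof.
have c0 := loss_coef_gt0; have r0 := rho_coef_gt0; have p1 := power1_gt0.
have pos : 0 <= rho_coef * P / (1 + P).
  by apply: divr_ge0; [apply: mulr_ge0; exact: ltW|lra].
apply/eqP; rewrite -(@eqrXn2 _ 2)// ?(ltW c0)//; apply/eqP.
have r2 : rho_coef ^+ 2 = ((P + 1) * F * L * l) / (P ^+ 2 * (2 * P)).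
  rewrite /rho_coef expr_div_n exprMn !sqr_sqrtr//; first by rewrite mulr_ge0// ltW.
  by rewrite ltW// !mulr_gt0 ?moments_gt0 ?ln_power_gt0 ?ln_eps_gt0.
rewrite loss_coef2 expr_div_n exprMn r2.
by field; rewrite !gt_eqF//; lra.
Qed.

Lemma saving_lossE : saving_coef * L = loss_coef.
Proof.
have c0 := loss_coef_gt0; have p1 := power1_gt0.
have rE : rho_coef = loss_coef * (1 + P) / P.
  by rewrite -rho_lossE; field; rewrite !gt_eqF//; have := power1_gt0; lra.
have -> : saving_coef * L = loss_coef ^+ 2 / loss_coef.
  rewrite loss_coef2 /saving_coef rE; field.
  by rewrite !gt_eqF//; have := power1_gt0; lra.
by rewrite expr2 mulfK// gt_eqF.
Qed.

Lemma rhoE n : rho P E2 eps2 n = rho_coef / Num.sqrt n%:R.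
Proof.
rewrite /rho /rho_coef.
have -> : 2 * n%:R * P = (2 * P) * n%:R by ring.
have P2 : 0 <= 2 * P by rewrite mulr_ge0// ltW.
by rewrite (sqrtrM _ P2) -[RHS]mulrA -invfM [P * (_ * _)]mulrA.
Qed.

Lemma near_sqrt (a : R) : \forall n \near \oo, a <= Num.sqrt n%:R.
Proof.
apply: filterS (nbhs_infty_ger (a ^+ 2)) => n h.
by rewrite (le_trans (ler_norm a))// -sqrtr_sqr ler_sqrt.
Qed.

Lemma near_rho : \forall n \near \oo,
  [/\ 0 < rho P E2 eps2 n, rho P E2 eps2 n <= 1 / 64
    & rho P E2 eps2 n * E2 <= P ^+ 2 / 5].
Proof.
near=> n.
have s1 : 1 <= Num.sqrt n%:R :> R by near: n; exact: near_sqrt.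
have s0 : 0 < Num.sqrt n%:R :> R by rewrite (lt_le_trans _ s1).
have r0 := rho_coef_gt0.
split; rewrite rhoE.
- by rewrite divr_gt0.
- rewrite ler_pdivrMr// mulrC -ler_pdivrMr//; first by near: n; exact: near_sqrt.
- rewrite mulrAC ler_pdivrMr// -ler_pdivrMl ?divr_gt0 ?exprn_gt0//.
  by near: n; exact: near_sqrt.
Unshelve. all: by end_near. Qed.

Lemma rho_Theta : (rho P E2 eps2 : nat -> R^o)
  =Theta_eventually (fun n => 1 / Num.sqrt n%:R : R^o).
Proof.
have r0 := rho_coef_gt0.
rewrite eqThetaE; apply/asboolP.
exists (rho_coef, rho_coef); first by rewrite /= r0.
apply: nearW => n /=; rewrite rhoE mul1r.
have e : `|rho_coef / Num.sqrt n%:R| = rho_coef * `|(Num.sqrt n%:R)^-1| :> R.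
  by rewrite normrM (gtr0_norm r0).
change (rho_coef * `|(Num.sqrt n%:R)^-1 : R| <= `|rho_coef / Num.sqrt n%:R : R| /\
  `|rho_coef / Num.sqrt n%:R : R| <= rho_coef * `|(Num.sqrt n%:R)^-1 : R|).
by rewrite e.
Qed.

Lemma near_saving : \forall n \near \oo,
  l / 2 / rho_coef * Num.sqrt n%:R <= (saving_length P E2 eps2 n)%:R
    <= 1 + 63 * l + saving_coef * Num.sqrt n%:R.
Proof.
have r0 := rho_coef_gt0.
near=> n.
have s1 : 1 <= Num.sqrt n%:R :> R by near: n; exact: near_sqrt.
have s0 : 0 < Num.sqrt n%:R :> R by rewrite (lt_le_trans _ s1).
have [r1 r2 r3] : [/\ 0 < rho P E2 eps2 n, rho P E2 eps2 n <= 1 / 64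
    & rho P E2 eps2 n * E2 <= P ^+ 2 / 5] by near: n; exact: near_rho.
have h1 := saving_ge (S := st_power P E2 eps2 n) (al := alpha P E2 eps2 n)
  (be := beta P E2 eps2 n) (m := saving_length P E2 eps2 n)
  P0 E20 ln_eps_gt0 r1 r2 r3 erefl erefl erefl erefl.
have h2 := saving_le (S := st_power P E2 eps2 n) (al := alpha P E2 eps2 n)
  (be := beta P E2 eps2 n) (m := saving_length P E2 eps2 n)
  P0 E20 ln_eps_gt0 r1 r2 erefl erefl erefl erefl.
apply/andP; split.
  by apply: le_trans h1; rewrite rhoE [(rho_coef / _)^-1]invfM invrK mulrA.
apply: (le_trans h2).
by rewrite rhoE [(rho_coef / _)^-1]invfM invrK mulrA.
Unshelve. all: by end_near. Qed.

Lemma saving_coef_gt0 : 0 < saving_coef.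
Proof.
by rewrite divr_gt0 ?rho_coef_gt0// divr_gt0 ?mulr_gt0 ?exprn_gt0 ?moments_gt0 ?ln_eps_gt0.
Qed.

Lemma saving_Theta : (fun n => (saving_length P E2 eps2 n)%:R : R^o)
  =Theta_eventually (fun n => Num.sqrt n%:R : R^o).
Proof.
have r0 := rho_coef_gt0; have l1 := ln_eps_gt0; have k0 := saving_coef_gt0.
rewrite eqThetaE; apply/asboolP.
exists (l / 2 / rho_coef, 1 + 63 * l + saving_coef).
  by apply/andP; split; [rewrite /= divr_gt0// divr_gt0|rewrite /=; lra].
near=> n.
have s1 : 1 <= Num.sqrt n%:R :> R by near: n; exact: near_sqrt.
have /andP[h1 h2] : l / 2 / rho_coef * Num.sqrt n%:R <= (saving_length P E2 eps2 n)%:R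
    <= 1 + 63 * l + saving_coef * Num.sqrt n%:R by near: n; exact: near_saving.
change (l / 2 / rho_coef * `|Num.sqrt n%:R : R| <= `|(saving_length P E2 eps2 n)%:R : R| /\
  `|(saving_length P E2 eps2 n)%:R : R| <= (1 + 63 * l + saving_coef) * `|Num.sqrt n%:R : R|).
rewrite !ger0_norm ?sqrtr_ge0//; split => //.
have h3 : 1 + 63 * l <= (1 + 63 * l) * Num.sqrt n%:R by rewrite ler_peMr//; lra.
by apply: (le_trans h2); rewrite [leRHS]mulrDl; apply: lerD.
Unshelve. all: by end_near. Qed.

Lemma near_half : \forall n \near \oo, n%:R <= 2 * (n - saving_length P E2 eps2 n)%:R :> R
  /\ (saving_length P E2 eps2 n <= n)%N.
Proof.
have l1 := ln_eps_gt0; have k0 := saving_coef_gt0.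
near=> n.
have s1 : 1 <= Num.sqrt n%:R :> R by near: n; exact: near_sqrt.
have s2 : 2 * (1 + 63 * l + saving_coef) <= Num.sqrt n%:R.
  by near: n; exact: near_sqrt.
have /andP[_ h2] : l / 2 / rho_coef * Num.sqrt n%:R <= (saving_length P E2 eps2 n)%:R
    <= 1 + 63 * l + saving_coef * Num.sqrt n%:R by near: n; exact: near_saving.
set s : R := Num.sqrt n%:R in s1 s2 h2.
have nE : n%:R = s ^+ 2 :> R by rewrite sqr_sqrtr.
have h3 : 2 * (1 + 63 * l + saving_coef) * s <= s ^+ 2.
  by rewrite expr2 ler_pM2r//; lra.
have h4 : 1 + 63 * l <= (1 + 63 * l) * s by rewrite ler_peMr//; lra.
have h5 : 2 * (saving_length P E2 eps2 n)%:R <= n%:R :> R by rewrite nE; lra.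
have mn : (saving_length P E2 eps2 n <= n)%N.
  rewrite -(ler_nat R); have : 0 <= (saving_length P E2 eps2 n)%:R :> R by []; lra.
by split=> //; rewrite natrB//; lra.
Unshelve. all: by end_near. Qed.

End asymptotics.

Lemma powR34 {R : realType} (x : R) : 0 < x ->
  x `^ (3 / 4) = Num.sqrt x * Num.sqrt (Num.sqrt x).
Proof.
move=> x0; have -> : 3 / 4 = 2^-1 + 2^-1 * 2^-1 :> R by field.
rewrite powRD; last by rewrite (gt_eqF x0) implybT.
by rewrite powRrM !powR12_sqrt ?sqrtr_ge0// ltW.
Qed.

(** After multiplication by n = s^2, the power back-off and the saving phase each contribute s cB /
    2. Every other error is at most a constant times w = n^(1/4), that is, n^(-3/4) after division
    by n. *)
Lemma rate_bound {R : realType} (s w L cB k K1 C N m X sg q K y : R) :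
  1 <= w -> s = w ^+ 2 -> 0 <= L -> N = s ^+ 2 - m -> 0 <= m ->
  m <= k + K1 * s -> K1 * L = cB -> y = cB / s ->
  2^-1 * L - (y + y ^+ 2) / 2 <= C -> C <= 2^-1 * L ->
  q <= 0 -> 0 <= sg -> 0 <= K -> 0 <= k ->
  N * C + sg * (s + w) * q - 2 * sg * K - 2 * w <= X ->
  1 / 2 * L - cB / s + sg / s * q
    - (cB ^+ 2 / 2 + k * L / 2 + sg * - q + 2 * sg * K + 2) / (s * w)
  <= (s ^+ 2)^-1 * X.
Proof.
move=> w1 sE L0 NE m0 mk K1L yE C1 C2 q0 sg0 K0 k0 XE.
have w0 : 0 < w by lra.
have s0 : 0 < s by rewrite sE exprn_gt0.
rewrite ler_pdivlMl ?exprn_gt0//; apply: le_trans XE.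
set kap := _ + 2.
have kapw : kap * w <= w * kap by rewrite mulrC.
have -> : s ^+ 2 * (1 / 2 * L - cB / s + sg / s * q - kap / (s * w)) =
  s ^+ 2 * L / 2 - s * cB + sg * s * q - kap * w.
  have -> : kap * w = s ^+ 2 * (kap / (s * w)).
    by rewrite sE; field; rewrite gt_eqF.
  by field; rewrite !gt_eqF.
have h1 : s ^+ 2 * (2^-1 * L - (y + y ^+ 2) / 2) <= s ^+ 2 * C.
  by rewrite ler_pM2l ?exprn_gt0.
have e1 : s ^+ 2 * (2^-1 * L - (y + y ^+ 2) / 2) = s ^+ 2 * L / 2 - s * cB / 2 - cB ^+ 2 / 2.
  by rewrite yE; field; rewrite gt_eqF.
have h2 : m * C <= m * (2^-1 * L) by rewrite ler_wpM2l.
have h3 : m * (2^-1 * L) <= (k + K1 * s) * (2^-1 * L).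
  by rewrite ler_wpM2r// mulr_ge0.
have e3 : (k + K1 * s) * (2^-1 * L) = k * L / 2 + s * cB / 2 by rewrite -K1L; field.
have e4 : N * C = s ^+ 2 * C - m * C by rewrite NE mulrBl.
have cw : cB ^+ 2 / 2 <= cB ^+ 2 / 2 * w by rewrite ler_peMr// divr_ge0// sqr_ge0.
have kw : k * L / 2 <= k * L / 2 * w by rewrite ler_peMr// divr_ge0// mulr_ge0.
have Kw : 2 * sg * K <= 2 * sg * K * w by rewrite ler_peMr// !mulr_ge0.
rewrite e4 /kap; lra.
Qed.

Theorem corollary4 (R : realType) (dE : measure_display)
    (TE : measurableType dE) (mu : probability TE R) (E : {RV mu >-> R})
    (P E2 eps eps1 eps2 : R)
    (E_ge0 : {ae mu, forall t, 0 <= E t})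
    (E_mean : 'E_mu[E]%E = P%:E) (P_gt0 : 0 < P)
    (E_moment2 : 'E_mu[fun t => (E t ^+ 2)%R]%E = E2%:E)
    (eps_gt0 : 0 < eps) (eps_lt : eps < 1 / 2)
    (eps1_gt0 : 0 < eps1) (eps2_gt0 : 0 < eps2) (epsE : eps1 + eps2 = eps) :
  let S := st_power P E2 eps2 in
  let m := saving_length P E2 eps2 in
  [/\ (rho P E2 eps2 : nat -> R^o)
        =Theta_eventually (fun n => 1 / Num.sqrt n%:R : R^o),
      (fun n => (m n)%:R : R^o) =Theta_eventually
        (fun n => Num.sqrt n%:R : R^o)
    & exists2 kappa : R, 0 < kappa &
      \forall n \near \oo,
        [/\ 0 < S n < P, (m n <= n)%N
          & exists (M : nat) (xi : R),
            [/\ (0 < M)%N, 0 < xi,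
                n%:R^-1 * ln (M%:R : R) >=
                  1 / 2 * ln (1 + P)
                  - Num.sqrt ((E2 + 3 * P ^+ 2) * ln (1 + P) * ln (1 / eps2) /
                              (2 * n%:R * P * (P + 1)))
                  + Num.sqrt (P / ((P + 1) * n%:R)) * PhiInv eps1
                  - kappa / n%:R `^ (3 / 4),
                exists (d : measure_display) (T : measurableType d)
                  (Pr : probability T R), inhabited (st_model E n M (S n) Pr)
              & forall (d : measure_display) (T : measurableType d)
                  (Pr : probability T R) (c : st_model E n M (S n) Pr),
                is_st_code (m n) xi eps c /\
                (Pr (mismatch (m n) c) <= eps2%:E)%E]]].
Proof.
move=> S m.
have E20 := moment2_ge0 E_moment2.
have eps21 : eps2 < 1 by lra.
have eps1h : eps1 < 1 / 2 by lra.
split; [exact: rho_Theta|exact: saving_Theta|].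
have l1 := ln_eps_gt0 eps2_gt0 eps21.
have L1 := ln_power_gt0 P_gt0.
have [K K0 KP] := @PhiInv_backoff R eps1 17 eps1_gt0 eps1h (ltr0Sn R 16).
have [_ q0] := PhiInvK eps1_gt0 eps1h.
have sg0 := sdev_gt0 P_gt0.
set q : R := PhiInv eps1 in q0 KP *.
set cB := loss_coef P E2 eps2.
pose k : R := 1 + 63 * ln (1 / eps2).
have k0 : 0 <= k by rewrite /k; lra.
have r13 : 1 / 64 <= 1 / 3 :> R by lra.
(* In order: the quadratic term of the back-off, the bounded part of the saving length, the inflated
   radius, the shift of the quantile, and the division of the threshold by s. *)
exists (cB ^+ 2 / 2 + k * ln (1 + P) / 2 + sdev P * - q + 2 * sdev P * K + 2).
  rewrite ltr_wpDl// !addr_ge0//.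
  - by rewrite divr_ge0// sqr_ge0.
  - by rewrite divr_ge0// mulr_ge0 ?(ltW L1).
  - by apply: mulr_ge0; [exact: ltW|lra].
  - by apply: mulr_ge0; [apply: mulr_ge0 => //; exact: ltW|exact: ltW].
near=> n.
have s4 : 4 <= Num.sqrt n%:R :> R by near: n; exact: near_sqrt.
have sK : K <= Num.sqrt n%:R by near: n; exact: near_sqrt.
have [r1 r2 r3] : [/\ 0 < rho P E2 eps2 n, rho P E2 eps2 n <= 1 / 64
    & rho P E2 eps2 n * E2 <= P ^+ 2 / 5] by near: n; exact: near_rho.
have /andP[_ mle] : ln (1 / eps2) / 2 / rho_coef P E2 eps2 * Num.sqrt n%:R <=
    (saving_length P E2 eps2 n)%:R
    <= 1 + 63 * ln (1 / eps2) + saving_coef P E2 eps2 * Num.sqrt n%:R.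
  by near: n; exact: near_saving.
have [half mn] : n%:R <= 2 * (n - saving_length P E2 eps2 n)%:R :> R
  /\ (saving_length P E2 eps2 n <= n)%N by near: n; exact: near_half.
have S0 : 0 < S n by exact: (st_power_gt0 P_gt0 r2 erefl).
have SP : S n < P by exact: (st_power_lt P_gt0 r1 erefl).
have s0 : 0 < Num.sqrt n%:R :> R by lra.
have w2 : 2 <= Num.sqrt (Num.sqrt n%:R) :> R.
  have : Num.sqrt (2 ^+ 2) <= Num.sqrt (Num.sqrt n%:R) :> R.
    by rewrite ler_wsqrtr// -natrX.
  by rewrite sqrtr_sqr ger0_norm.
set lam := tilt P E2 (rho P E2 eps2 n) (S n).
have lam0 : 0 < lam by exact: (tilt_gt0 P_gt0 E20 r1 r2 erefl).
pose theta := tilted_energy P E2 (rho P E2 eps2 n) (S n).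
have theta0 : 0 <= theta by exact: expR_ge0.
have theta_E : (\int[distribution mu E]_e (expR (- (lam * e)))%:E <= theta%:E)%E.
  by apply: (energy_transform E_ge0 E_mean E_moment2); exact: ltW.
have theta_X : (\int[gau (Num.sqrt (S n))]_x (expR (lam * x ^+ 2))%:E * theta%:E <= 1)%E.
  have ss : Num.sqrt (S n) ^+ 2 = S n by rewrite sqr_sqrtr// ltW.
  rewrite gau_mgf_sq ?sqrtr_gt0// ss.
    by rewrite -EFinM lee_fin; exact: (tilt_balance P_gt0 E20 r1 r2 erefl).
  exact: (tilt_small P_gt0 E20 r1 r2 erefl).
have theta_m : theta ^+ m n <= eps2.
  have := tilted_energy_pow (S := S n) (al := alpha P E2 eps2 n)
    (be := beta P E2 eps2 n) (m := m n) P_gt0 E20 l1 r1 r2 r3 erefl erefl erefl erefl.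
  by rewrite div1r lnV ?posrE// opprK lnK ?posrE.
have Phi_q : Phi (q - K * (Num.sqrt n%:R)^-1) <= eps1 - 17 * (Num.sqrt n%:R)^-1.
  by apply: KP; [rewrite invr_gt0|rewrite ler_pdivrMr// mul1r].
split => //; first by rewrite S0.
exists (num_messages n (m n) (S n) eps1 K), (threshold n (m n) (S n) eps1 K).
split => //.
- exact: expR_gt0.
- have h := ln_num_messages S0 q0 K0 w2 half (ltW SP).
  have nE : n%:R = Num.sqrt n%:R ^+ 2 :> R by rewrite sqr_sqrtr.
  have n0 : 0 < n%:R :> R by rewrite nE exprn_gt0.
  rewrite powR34// (_ : n%:R^-1 = (Num.sqrt n%:R ^+ 2)^-1 :> R); last by rewrite -nE.
  have -> : Num.sqrt ((E2 + 3 * P ^+ 2) * ln (1 + P) * ln (1 / eps2) /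
      (2 * n%:R * P * (P + 1))) = cB / Num.sqrt n%:R.
    have cB0 := loss_coef_gt0 P_gt0 E20 eps2_gt0 eps21.
    rewrite -[RHS]ger0_norm -?sqrtr_sqr; last by rewrite divr_ge0// ltW.
    congr Num.sqrt; rewrite expr_div_n -nE loss_coef2//.
    by field; rewrite !gt_eqF// addr_gt0.
  have -> : Num.sqrt (P / ((P + 1) * n%:R)) = sdev P / Num.sqrt n%:R.
    rewrite -[RHS]ger0_norm -?sqrtr_sqr; last by rewrite divr_ge0// ltW.
    congr Num.sqrt; rewrite /sdev !expr_div_n -nE !sqr_sqrtr ?ltW ?addr_gt0//.
    by field; rewrite !gt_eqF// addr_gt0.
  apply: (@rate_bound R _ _ _ cB k (saving_coef P E2 eps2) (capac (S n))
    (n - m n)%:R (m n)%:R _ (sdev P) q K (rho P E2 eps2 n * P / (1 + P))) => //.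
  + by apply: le_trans w2; rewrite ler1n.
  + by rewrite sqr_sqrtr// ltW.
  + exact: ltW.
  + by rewrite -nE natrB.
  + exact: saving_lossE.
  + rewrite /cB rhoE// -(rho_lossE P_gt0 E20 eps2_gt0 eps21).
    by field; rewrite !gt_eqF// addr_gt0.
  + by apply: capac_ge => //; [exact: ltW|exact: le_trans r2 r13].
  + by apply: capac_le => //; exact: ltW.
  + exact: ltW.
  + exact: ltW.
  + exact: ltW.
- exact: exists_st_model.
- move=> d T Pr c; split.
    rewrite -epsE; apply: (code_at_blocklength (lam := lam) (theta := theta)) => //.
    exact: ltW.
  by apply: (@mismatch_bound _ _ _ _ _ _ _ _ _ _ _ c _ lam theta) => //; exact: ltW.
Unshelve. all: by end_near. Qed.
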